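(* Let $\{u^k\}_{k\ge 0}\subset V$ and $\{\lambda^k\}_{k\ge 0}\subset L^2(\Gamma^-)$ be the sequences produced by the Uzawa iteration: given $\lambda^0\in L^2(\Gamma^-)$, $$u^k:=\arg\min_{u\in V}L(u,\lambda^k),\qquad \lambda^{k+1}:=\lambda^k-\rho\,(u^k-g)\ \text{ in } L^2(\Gamma^-),\qquad k\ge 0.$$ Suppose $\sigma_A,\sigma_T,\rho,\gamma>0$ satisfy $$\sigma_T<\frac{\sigma_A}{4},\qquad 0<\rho<2\gamma-\sigma_A-\sqrt{\sigma_A^2-16\sigma_T^2}.$$ Then $u^k$ converges strongly to $u^*$ as $k\to\infty$ in the norm $$|||u|||^2:=\|u\|_{L^2(\mathcal W)}^2+\|\vec\omega\cdot\nabla_{\vec x}u\|_{L^2(\mathcal W)}^2+\|u\|_{L^2(\Gamma^+)}^2+\|u\|_{L^2(\Gamma^-)}^2 .$$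
   Context: Setting. $D\subset\mathbb{R}^d$, $d\in\{2,3\}$, is a spatial domain with outward unit normal $\vec n(\vec x)$ on $\partial D$; $\mathcal W:=D\times\mathbb{S}^{d-1}$; $\Gamma^{\pm}:=\{(\vec x,\vec\omega)\in\partial D\times\mathbb{S}^{d-1}:\pm\,\vec n(\vec x)\cdot\vec\omega>0\}$. $\sigma_A,\sigma_T$ are constants, and $\pi\in C^1([-1,1];\mathbb{R}_{\ge 0})$ satisfies $\int_{-1}^1\pi(y)\,dy=1$. Define $$\mathcal T u:=\vec\omega\cdot\nabla_{\vec x}u+\sigma_A u,\qquad \mathcal S u:=\sigma_T\Big(u-\frac{1}{|\mathbb{S}^{d-1}|}\int_{\mathbb{S}^{d-1}}\pi(\vec\omega\cdot\vec\omega')\,u(\vec x,\vec\omega')\,d\vec\omega'\Big).$$ $L^2(\Gamma^{\pm})$ carry the inner products $\langle u,v\rangle_{L^2(\Gamma^\pm)}=\int_{\Gamma^\pm}u\,v\,|\vec n(\vec x)\cdot\vec\omega|\,d\vec\omega\,d\vec x$ and the corresponding norms. The space is $$V:=\{u\in L^2(\mathcal W):\ \mathcal T u+\mathcal S u\in L^2(\mathcal W),\ u|_{\Gamma^-}\in L^2(\Gamma^-)\},\qquad \|u\|_V^2:=\|(\mathcal T+\mathcal S)u\|_{L^2(\mathcal W)}^2+\|u\|_{L^2(\Gamma^-)}^2.$$ Given $g\in L^2(\Gamma^-)$, the boundary value problem is: find $u^*\in V$ with $\mathcal T u^*+\mathcal S u^*=0$ in $\mathcal W$ and $u^*=g$ on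 $\Gamma^-$. With $\gamma$ the stabilisation parameter, set $$J(u):=\tfrac12\|\mathcal T u+\mathcal S u\|_{L^2(\mathcal W)}^2+\tfrac{\gamma}{2}\|u-g\|_{L^2(\Gamma^-)}^2,\qquad L(u,\lambda):=J(u)-\langle\lambda,u-g\rangle_{L^2(\Gamma^-)}.$$ $(u^*,\lambda^* )\in V\times L^2(\Gamma^-)$ denotes the saddle point of $\min_{u\in V}\max_{\lambda\in L^2(\Gamma^-)}L(u,\lambda)$, whose first component $u^*$ is the solution of the boundary value problem.
   Formalization: It is additionally assumed that for every λ in L²(Γ⁻) the function L(·,λ) has exactly one minimiser over V; for d=2 the stated normalisation of π does not ensure this (e.g. a disc of critical radius with π peaked at 1), and then arg min and u* are not well defined. *)

(* Defs.v *)
From HB Require Import structures.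
From mathcomp Require Import all_boot all_order all_algebra.
From mathcomp Require Import all_classical all_reals all_analysis.
From mathcomp Require Import measurable_realfun lebesgue_integral.

Set Implicit Arguments.
Unset Strict Implicit.
Unset Printing Implicit Defensive.

Import Order.TTheory GRing.Theory Num.Theory.
Import numFieldNormedType.Exports.

Local Open Scope classical_set_scope.
Local Open Scope ring_scope.

(* The product sigma-algebra on matrices; it is the Borel one because R is
   second countable. *)
Section matrix_measurable.
Context (R : realType) (m n : nat).

Definition mx_cylinder : set (set 'M[R]_(m, n)) :=
  [set A | exists i j (B : set R),
     measurable B /\ A = [set x : 'M[R]_(m, n) | B (x i j)]].

Let mx0 : <<s mx_cylinder >> set0.
Proof. exact: sigma_algebra0. Qed.

Let mxC A : <<s mx_cylinder >> A -> <<s mx_cylinder >> (~` A).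
Proof. exact: sigma_algebraC. Qed.

Let mxU (F : (set 'M[R]_(m, n))^nat) : (forall i, <<s mx_cylinder >> (F i)) ->
  <<s mx_cylinder >> (\bigcup_i (F i)).
Proof. exact: sigma_algebra_bigcup. Qed.

HB.instance Definition _ := @isMeasurable.Build default_measure_display
  'M[R]_(m, n) <<s mx_cylinder >> mx0 mxC mxU.

End matrix_measurable.

Lemma measurable_fun_mx d (S : measurableType d) (R : realType) m n
    (f : S -> 'M[R]_(m, n)) :
  (forall i j, measurable_fun setT (fun s => f s i j)) ->
  measurable_fun setT f.
Proof.
move=> mf; apply: (@measurability _ _ _ _ _ _ (@mx_cylinder R m n)) => //.
move=> _ [_ [i [j [B [mB ->]]]] <-].
exact: (mf i j).
Qed.

Lemma measurable_coord (R : realType) m n (i : 'I_m) (j : 'I_n) :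
  measurable_fun setT (fun x : 'M[R]_(m, n) => x i j).
Proof.
move=> _ B mB; rewrite setTI; apply: sub_sigma_algebra.
by exists i, j, B.
Qed.

Section lebesgue.
Context {R : realType}.

Definition vcons n (p : 'rV[R]_n * R) : 'rV[R]_n.+1 :=
  \row_j (if unlift ord0 j is Some k then p.1 0 k else p.2).

Lemma measurable_vcons n : measurable_fun setT (@vcons n).
Proof.
apply: measurable_fun_mx => i j.
under eq_fun do rewrite mxE.
case: (unlift _ _) => [k|]; last exact: measurable_snd.
exact: (measurableT_comp (measurable_coord 0 k) measurable_fst).
Qed.

Section step.
Context n (m : {measure set 'rV[R]_n -> \bar R}).

Definition vol_step : set 'rV[R]_n.+1 -> \bar R :=
  pushforward (m \x (@lebesgue_measure R))%E (@vcons n).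

Let M : {measure set 'rV[R]_n.+1 -> \bar R} :=
  measure_function_pushforward__canonical__measure_function_Measure
    (m \x (@lebesgue_measure R))%E (@measurable_vcons n).

HB.instance Definition _ := isMeasure.Build _ _ _ vol_step
  (measure0 M) (measure_ge0 M) (@measure_semi_sigma_additive _ _ _ M).
End step.

(* Lebesgue measure on R^n as an iterated product measure. *)
Fixpoint vol n : {measure set 'rV[R]_n -> \bar R} :=
  match n with
  | 0 => dirac (0 : 'rV[R]_0)
  | k.+1 => vol_step (vol k)
  end.

End lebesgue.

Section euclidean.
Context {R : realType}.

Definition dot d (x y : 'rV[R]_d) : R := \sum_(i < d) x 0 i * y 0 i.

Definition enorm d (x : 'rV[R]_d) : R := Num.sqrt (dot x x).

Definition sphere d : set 'rV[R]_d := [set w | enorm w = 1].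

Definition boundary d (D : set 'rV[R]_d) : set 'rV[R]_d :=
  closure D `\` interior D.

End euclidean.

Arguments sphere {R} d _.

Section sphere_measure.
Context {R : realType}.

Lemma dot_ge0 d (x : 'rV[R]_d) : 0 <= dot x x.
Proof. by apply: sumr_ge0 => i _; rewrite -expr2 sqr_ge0. Qed.

Lemma measurable_enorm d : measurable_fun setT (@enorm R d).
Proof.
rewrite (_ : @enorm R d = (@powR R ^~ 2^-1) \o (fun x => dot x x)); last first.
  by apply/funext => x /=; rewrite powR12_sqrt// dot_ge0.
apply: measurableT_comp => //; apply: measurable_sum => i.
by apply: measurable_funM; exact: measurable_coord.
Qed.

Definition direction d (x : 'rV[R]_d) : 'rV[R]_d := (enorm x)^-1 *: x.

Lemma measurable_direction d : measurable_fun setT (@direction d).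
Proof.
apply: measurable_fun_mx => i j; rewrite /direction.
under eq_fun do rewrite mxE.
apply: measurable_funM; last exact: measurable_coord.
rewrite (_ : (fun x => _) = (@powR R ^~ (-1)) \o @enorm R d); last first.
  by apply/funext => x /=; rewrite powR_inv1// sqrtr_ge0.
by apply: measurableT_comp => //; exact: measurable_enorm.
Qed.

Definition punctured_ball d : set 'rV[R]_d := [set x | 0 < enorm x <= 1].
Arguments punctured_ball : clear implicits.

Lemma measurable_punctured_ball d : measurable (punctured_ball d).
Proof.
rewrite (_ : punctured_ball d = @enorm R d @^-1` `]0, 1]).
  by rewrite -[X in measurable X]setTI; exact: measurable_enorm.
by apply/seteqP; split => x /=; rewrite in_itv.
Qed.

(* Surface measure of the unit sphere in polar coordinates: the area of A is
   d times the volume of the cone over A in the unit ball. *)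
Definition sphere_measure d (A : set 'rV[R]_d) : \bar R :=
  (d%:R%:E * vol d (@direction d @^-1` A `&` punctured_ball d))%E.

Section instance.
Variable d : nat.

Let B : {measure set 'rV[R]_d -> \bar R} :=
  mrestr (vol d) (@measurable_punctured_ball d).

Let P : {measure set 'rV[R]_d -> \bar R} :=
  measure_function_pushforward__canonical__measure_function_Measure
    B (@measurable_direction d).

Let M : {measure set 'rV[R]_d -> \bar R} := mscale (d%:R)%:nng P.

HB.instance Definition _ := isMeasure.Build _ _ _ (@sphere_measure d)
  (measure0 M) (measure_ge0 M) (@measure_semi_sigma_additive _ _ _ M).

Definition cube n : set 'rV[R]_n := [set x | forall i, -1 <= x 0 i <= 1].
Arguments cube : clear implicits.

Lemma measurable_cube n : measurable (cube n).
Proof.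
rewrite (_ : cube n =
    \bigcap_(i in [set: 'I_n]) ((fun x : 'rV[R]_n => x 0 i) @^-1` `[-1, 1])).
  apply: fin_bigcap_measurable; first exact: finite_finset.
  by move=> i _; rewrite -[X in measurable X]setTI; exact: measurable_coord.
apply/seteqP; split => x /= h i; first by move=> _; rewrite /= in_itv/=.
by have /= := h i Logic.I; rewrite in_itv.
Qed.

Lemma vol_cube n : (vol n (cube n) < +oo)%E.
Proof.
elim: n => [|n IH]; first by rewrite /= diracE ltry.
rewrite /= /vol_step /pushforward.
rewrite (_ : _ @^-1` _ = cube n `*` `[-1, 1]); last first.
  apply/seteqP; split => [[x t] /= h|[x t] /= [h]].
    split=> /=; last by have := h ord0; rewrite mxE unlift_none /= in_itv.
    by move=> i; have := h (lift ord0 i); rewrite mxE liftK.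
  rewrite in_itv /= => ht i; rewrite mxE.
  by case: unliftP => [j _|_] //=; exact: h.
rewrite product_measure1E//; last exact: measurable_cube.
have L : (lebesgue_measure (`[(-1)%R, 1%R]%classic : set R) < +oo)%E.
  by rewrite lebesgue_measure_itv /=; case: ifP; rewrite ?ltry.
apply: lte_mul_pinfty => //.
by rewrite ge0_fin_numE.
Qed.

Lemma punctured_ball_cube : punctured_ball d `<=` cube d.
Proof.
move=> x /andP[_ x1] i; rewrite -ler_norml -sqrtr_sqr.
apply: le_trans x1; rewrite /enorm ler_sqrt ?dot_ge0// /dot (bigD1 i)//= expr2.
by rewrite lerDl sumr_ge0// => j _; rewrite -expr2 sqr_ge0.
Qed.

Let sphere_measure_fin : fin_num_fun (@sphere_measure d).
Proof.
move=> A mA; rewrite ge0_fin_numE; last exact: (measure_ge0 M).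
rewrite /sphere_measure lte_mul_pinfty ?lee_fin//.
apply: le_lt_trans (vol_cube d); apply: le_measure.
- rewrite inE; apply: measurableI; last exact: measurable_punctured_ball.
  by rewrite -[X in measurable X]setTI; exact: measurable_direction.
- by rewrite inE; exact: measurable_cube.
- by move=> x [_]; exact: punctured_ball_cube.
Qed.

HB.instance Definition _ :=
  Measure_isFinite.Build _ _ _ (@sphere_measure d) sphere_measure_fin.
End instance.
End sphere_measure.

Section hausdorff.
Context {R : realType} (d : nat).
Local Open Scope ereal_scope.

(* The value 0 is adjoined so that the empty set has diameter 0. *)
Definition ediam (A : set 'rV[R]_d) : \bar R :=
  ereal_sup [set r | r = 0 \/ exists x y, [/\ A x, A y & r = (enorm (x - y))%:E]].

(* Volume of the m-dimensional ball of diameter 1. *)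
Definition ball_const (m : nat) : R :=
  (fine (vol m [set x : 'rV[R]_m | enorm x <= 1]) / 2 ^+ m)%R.

Definition hausdorff_premeasure (m : nat) (delta : R) (A : set 'rV[R]_d) :=
  ereal_inf [set s | exists2 F : (set 'rV[R]_d)^nat,
    A `<=` \bigcup_i F i /\ (forall i, ediam (F i) <= delta%:E) &
    s = \sum_(0 <= i <oo) ((ball_const m)%:E * ediam (F i) ^+ m)].

Definition hausdorff_measure (m : nat) (A : set 'rV[R]_d) : \bar R :=
  ereal_sup [set hausdorff_premeasure m delta A | delta in [set x : R | (0 < x)%R]].

End hausdorff.

Section test_functions.
Context {R : realType}.

Definition C1 (V : normedModType R) (f : V -> R) : Prop :=
  (forall x, differentiable f x) /\ (forall v, continuous (fun x => 'D_v f x)).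

Definition supported_in (V : Type) (K : set V) (f : V -> R) : Prop :=
  forall x, ~ K x -> f x = 0.

Definition C1c (V : normedModType R) (f : V -> R) : Prop :=
  C1 f /\ exists2 K, compact K & supported_in K f.

(* [f] is C^1 on the closed interval [[-1, 1]], with one-sided derivatives at
   the endpoints. *)
Definition C1_segment (f : R -> R) : Prop :=
  exists2 f' : R -> R, {within `[-1, 1], continuous f'} &
  forall x, `[-1, 1]%classic x ->
    (f y - f x) / (y - x) @[y --> within `[-1, 1] x^'] --> f' x.

End test_functions.

Section L2.
Context d (T : measurableType d) (R : realType).
Variables (mu : {measure set T -> \bar R}) (A : set T).

Definition L2 (f : T -> R) : Prop := f \_ A \in Lfun mu 2%:E.

Definition sqnorm (f : T -> R) : \bar R := (\int[mu]_(z in A) ((f z) ^+ 2)%:E)%E.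

Definition inner (f g : T -> R) : R := (\int[mu]_(z in A) (f z * g z))%R.

Definition ae_on (P : T -> Prop) : Prop := {ae mu, forall z, A z -> P z}.

End L2.

Section domain.
Context {R : realType} {d : nat}.
Variable D : set 'rV[R]_d.

Definition is_domain : Prop := [/\ open D, connected D & D !=set0].

Definition is_surface_measure (dS : {measure set 'rV[R]_d -> \bar R}) : Prop :=
  forall A, measurable A -> dS A = hausdorff_measure d.-1 (A `&` boundary D).

(* Outward unit normal in the sense of De Giorgi and Federer: the unit field
   for which the Gauss-Green formula holds.  It is determined almost everywhere
   on the boundary, and it is the classical outward normal of a C^1, piecewise
   C^1 or Lipschitz domain. *)
Definition is_outward_unit_normal (dS : {measure set 'rV[R]_d -> \bar R})
    (n : 'rV[R]_d -> 'rV[R]_d) : Prop :=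
  [/\ measurable_fun setT n,
      forall x, boundary D x -> enorm (n x) = 1,
      forall K, compact K -> (dS K < +oo)%E &
      forall (F : 'rV[R]_d -> R) (w : 'rV[R]_d), C1c F ->
        (\int[vol d]_(x in D) ('D_w F x) =
         \int[dS]_(x in boundary D) (F x * dot (n x) w))%R].

End domain.

Section transport.
Context {R : realType} {d : nat}.
Variables (D : set 'rV[R]_d) (dS : {measure set 'rV[R]_d -> \bar R}).
Variable n : 'rV[R]_d -> 'rV[R]_d.
Variables (phase : R -> R) (sigmaA sigmaT : R).

Local Notation point := ('rV[R]_d * 'rV[R]_d)%type.

Definition W : set point := D `*` sphere d.

Definition dW : {measure set point -> \bar R} := (vol d \x @sphere_measure R d)%E.

(* [Gamma 1] is the outflow boundary and [Gamma (-1)] the inflow boundary. *)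
Definition Gamma (s : R) : set point :=
  [set z | [/\ boundary D z.1, sphere d z.2 & 0 < s * dot (n z.1) z.2]].

Definition dG : {measure set point -> \bar R} := (dS \x @sphere_measure R d)%E.

(* Multiplication by [flux] turns the |n . omega|-weighted L^2 structure of
   Gamma into the L^2 structure of [dG]. *)
Definition flux (h : point -> R) (z : point) : R :=
  h z * Num.sqrt `|dot (n z.1) z.2|.

Definition L2G s h := L2 dG (Gamma s) (flux h).
Definition sqnormG s h := sqnorm dG (Gamma s) (flux h).
Definition innerG s h1 h2 := inner dG (Gamma s) (flux h1) (flux h2).

(* Classical omega . grad_x phi: the derivative at (x, omega) along (omega, 0). *)
Definition streaming (phi : point -> R) (z : point) : R := 'D_((z.2, 0)) phi z.

(* By mollification, C^1 test functions define the same weak derivatives as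
   smooth ones; the variable omega ranges over all of R^d, but only its values on
   the sphere matter. *)
Definition test_function (phi : point -> R) : Prop :=
  C1 phi /\ exists K, [/\ compact K, K `<=` D `*` setT & supported_in K phi].

(* [q] is the distributional derivative omega . grad_x u, a locally integrable
   function on W. *)
Definition is_streaming (u q : point -> R) : Prop :=
  measurable_fun W q /\ forall phi, test_function phi ->
    dW.-integrable W (EFin \o (q \* phi)) /\
    inner dW W q phi = - inner dW W u (streaming phi).

(* [h] is the trace of [u] on [Gamma s], [q] being omega . grad_x u: the trace
   is the extension by continuity of the restriction of functions that are C^1
   up to the boundary.  By the Gauss-Green formula for products, [h] is unique
   almost everywhere. *)
Definition is_trace (s : R) (u q h : point -> R) : Prop :=
  L2G s h /\ exists phi : (point -> R)^nat,
    [/\ forall k, C1c (phi k),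
        sqnorm dW W (phi k \- u) @[k --> \oo] --> 0%E,
        sqnorm dW W (streaming (phi k) \- q) @[k --> \oo] --> 0%E &
        sqnormG s (phi k \- h) @[k --> \oo] --> 0%E].

Definition sphere_area : R := fine (@sphere_measure R d setT).

Definition scattering (u : point -> R) (z : point) : R :=
  sigmaT * (u z - sphere_area^-1 *
    (\int[@sphere_measure R d]_(w in sphere d) (phase (dot z.2 w) * u (z.1, w)))%R).

(* An element of V is given with its streaming derivative and its inflow trace,
   both of which are determined almost everywhere by the function. *)
Record Vspace := MkV {
  vfun :> point -> R;
  vstream : point -> R;
  vtrace : point -> R;
  vfunL2 : L2 dW W vfun;
  vstreamP : is_streaming vfun vstream;
  vresL2 : L2 dW W
    (fun z => (vstream z + sigmaA * vfun z) + scattering vfun z);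
  vtraceP : is_trace (-1) vfun vstream vtrace }.

Definition transport (u : Vspace) (z : point) : R := vstream u z + sigmaA * u z.

Definition residual (u : Vspace) (z : point) : R := transport u z + scattering u z.

Definition J (gamma : R) (g : point -> R) (u : Vspace) : R :=
  2^-1 * fine (sqnorm dW W (residual u)) +
  gamma / 2 * fine (sqnormG (-1) (vtrace u \- g)).

Definition L (gamma : R) (g : point -> R) (u : Vspace) (lam : point -> R) : R :=
  J gamma g u - innerG (-1) lam (vtrace u \- g).

Definition solves_bvp (g : point -> R) (u : Vspace) : Prop :=
  ae_on dW W (fun z => residual u z = 0) /\
  ae_on dG (Gamma (-1)) (fun z => vtrace u z = g z).

Definition is_saddle_point gamma g (u : Vspace) (lam : point -> R) : Prop :=
  L2G (-1) lam /\ forall (v : Vspace) (mu : point -> R), L2G (-1) mu ->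
    L gamma g u mu <= L gamma g u lam /\ L gamma g u lam <= L gamma g v lam.

(* The minimiser of [F] over V, unique as an element of L^2(W). *)
Definition is_argmin (F : Vspace -> R) (u : Vspace) : Prop :=
  forall v, F u <= F v /\ (F v = F u -> ae_on dW W (fun z => v z = u z)).

Definition is_uzawa gamma rho g (u : nat -> Vspace) (lam : nat -> point -> R) :
    Prop :=
  forall k, [/\ L2G (-1) (lam k),
    is_argmin (fun v => L gamma g v (lam k)) (u k) &
    ae_on dG (Gamma (-1)) (fun z =>
      lam k.+1 z = lam k z - rho * (vtrace (u k) z - g z))].

(* The square of the norm |||u||| of a function [u] with streaming
   derivative [q], outflow trace [hp] and inflow trace [hm]. *)
Definition triple_sqnorm (u q hp hm : point -> R) : \bar R :=
  (sqnorm dW W u + sqnorm dW W q + sqnormG 1 hp + sqnormG (-1) hm)%E.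

End transport.

(* Main.v *)
Require Import Defs.
From HB Require Import structures.
From mathcomp Require Import all_boot all_order all_algebra.
From mathcomp Require Import all_classical all_reals all_analysis.
From mathcomp Require Import ring lra measurable_realfun.

(* Subtracting the problem solved by [u*] from the optimality condition of [u^k]
   shows that [e^k = u^k - u*] depends linearly on [lambda^k] through
     <(T+S)e^k, (T+S)v> + gamma <e^k, v> = <lambda^k, v>   for all v in V,
   with [lambda^{k+1} = lambda^k - rho e^k].  As [rho < 2 gamma], the norms of the
   [lambda^k] decrease, so that [(T+S)e^k] and the inflow trace of [e^k] tend to
   0.  The iteration operator is self-adjoint, hence <lambda^i, lambda^j> depends
   only on [i + j], and the [lambda^k] form a Cauchy sequence.

   For [d = 2] the collision operator may have norm larger than 1, so [T+S] need
   not be coercive.  Instead, the existence and uniqueness of the minimisers make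
   the map from [lambda] to [e] everywhere defined and injective; its graph is
   closed in the graph norm, so it is bounded by the closed graph theorem.  Thus
   [e^k] converges in V, and its limit, with vanishing residual and inflow trace,
   is 0 by uniqueness.  The outflow trace is controlled by Green's formula
     |phi|^2_{Gamma+} = |phi|^2_{Gamma-} + 2 <phi, omega . grad phi>
   for C^1 functions [phi] with compact support. *)

Set Implicit Arguments.
Unset Strict Implicit.
Unset Printing Implicit Defensive.

Import Order.TTheory GRing.Theory Num.Theory.
Import numFieldNormedType.Exports.

Local Open Scope classical_set_scope.
Local Open Scope ring_scope.

(** * Semi-inner product spaces and bounded inverses *)

(** The decrease of the multipliers makes the residual and the inflow trace of the errors tend to 0,
    but without coercivity this does not control the errors themselves, and a bound of the error by
    the multiplier alone only keeps them bounded. Hence the need for strong convergence of the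
    multipliers: the bound turns it into convergence of the errors, and the residual and trace then
    serve to identify the limit. An element of V is handled as a triple made of the function, its
    streaming derivative and its inflow trace, normed by the sum of the three squared L2 norms. In
    this norm both the weak derivative and the trace are closed conditions, so that V is complete,
    and so is the graph of the map from multipliers to errors. The projection of this graph onto the
    multiplier is bounded, and bijective up to null vectors; the closed graph theorem thus reduces
    to the open mapping theorem for this projection. As functions are not identified almost
    everywhere, that theorem is stated for semi-norms, with surjectivity and injectivity up to null
    vectors. *)

(* A complete space for a semi-definite inner product on a subspace [hdom] of
   [X]: elements at distance 0 (such as functions that agree almost everywhere)
   are not identified. *)
Record semiHilbert (R : realType) (X : lmodType R) := SemiHilbert {
  hdom :> X -> Prop;
  ip : X -> X -> R;
  hdom0 : hdom 0;
  hdomP : forall a x y, hdom x -> hdom y -> hdom (a *: x + y);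
  ipC : forall x y, hdom x -> hdom y -> ip x y = ip y x;
  ipP : forall a x y z, hdom x -> hdom y -> hdom z ->
    ip (a *: x + y) z = a * ip x z + ip y z;
  ip_ge0 : forall x, hdom x -> 0 <= ip x x;
  ip_complete : forall u : nat -> X, (forall k, hdom (u k)) ->
    (forall e, 0 < e -> exists N, forall i j, (N <= i)%N -> (N <= j)%N ->
      ip (u i - u j) (u i - u j) < e) ->
    exists2 x, hdom x & ip (u k - x) (u k - x) @[k --> \oo] --> (0 : R) }.

Section semi_hilbert.
Context (R : realType) (X : lmodType R) (H : semiHilbert X).
Implicit Types (x y z : X) (a : R).
Local Notation ip := (ip H).

Definition hnorm x : R := Num.sqrt (ip x x).

Definition hcvg (u : nat -> X) x := ip (u k - x) (u k - x) @[k --> \oo] --> (0 : R).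

Definition hcauchy (u : nat -> X) :=
  forall e, 0 < e -> exists N, forall i j, (N <= i)%N -> (N <= j)%N ->
    ip (u i - u j) (u i - u j) < e.

Lemma hdomZ a x : H x -> H (a *: x).
Proof. by move=> hx; rewrite -[_ *: _]addr0; apply: hdomP => //; exact: hdom0. Qed.

Lemma hdomD x y : H x -> H y -> H (x + y).
Proof. by move=> hx hy; rewrite -[x]scale1r; exact: hdomP. Qed.

Lemma hdomN x : H x -> H (- x).
Proof. by move=> hx; rewrite -scaleN1r; exact: hdomZ. Qed.

Lemma hdomB x y : H x -> H y -> H (x - y).
Proof. by move=> hx hy; apply: hdomD => //; exact: hdomN. Qed.

Hint Resolve hdomZ hdomD hdomN hdomB : core.

Lemma ipDl x y z : H x -> H y -> H z -> ip (x + y) z = ip x z + ip y z.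
Proof. by move=> hx hy hz; rewrite -{1}[x]scale1r ipP// mul1r. Qed.

Lemma ip0l z : H z -> ip 0 z = 0.
Proof.
move=> hz; have := ipDl (hdom0 H) (hdom0 H) hz.
by rewrite addr0 => /eqP; rewrite addrC -subr_eq subrr => /eqP.
Qed.

Lemma ipZl a x z : H x -> H z -> ip (a *: x) z = a * ip x z.
Proof.
move=> hx hz; rewrite -{1}[a *: x]addr0 ipP// ?ip0l ?addr0//; exact: hdom0.
Qed.

Lemma ipNl x z : H x -> H z -> ip (- x) z = - ip x z.
Proof. by move=> hx hz; rewrite -scaleN1r ipZl// mulN1r. Qed.

Lemma ipBl x y z : H x -> H y -> H z -> ip (x - y) z = ip x z - ip y z.
Proof. by move=> hx hy hz; rewrite ipDl// ?ipNl//; exact: hdomN. Qed.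

Lemma ipDr x y z : H x -> H y -> H z -> ip z (x + y) = ip z x + ip z y.
Proof. by move=> hx hy hz; rewrite ipC ?ipDl// ?(ipC hz)//; exact: hdomD. Qed.

Lemma ipZr a x z : H x -> H z -> ip z (a *: x) = a * ip z x.
Proof. by move=> hx hz; rewrite ipC ?ipZl// ?(ipC hz)//; exact: hdomZ. Qed.

Lemma ipBr x y z : H x -> H y -> H z -> ip z (x - y) = ip z x - ip z y.
Proof. by move=> hx hy hz; rewrite ipC ?ipBl// ?(ipC hz)//; exact: hdomB. Qed.

Lemma ip_sqD a x y : H x -> H y ->
  ip (x + a *: y) (x + a *: y) = ip x x + 2 * a * ip x y + a ^+ 2 * ip y y.
Proof.
move=> hx hy; rewrite ipDl ?ipDr ?ipZl ?ipZr ?(ipC hy hx)//; try by auto.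
by ring.
Qed.

Lemma ip_sqB x y : H x -> H y ->
  ip (x - y) (x - y) = ip x x - 2 * ip x y + ip y y.
Proof. by move=> hx hy; rewrite -scaleN1r ip_sqD//; ring. Qed.

Lemma hnorm_ge0 x : 0 <= hnorm x.
Proof. exact: sqrtr_ge0. Qed.

Lemma hnorm_sqr x : H x -> hnorm x ^+ 2 = ip x x.
Proof. by move=> hx; rewrite sqr_sqrtr// ip_ge0. Qed.

Lemma cauchy_schwarz_sqr x y : H x -> H y -> ip x y ^+ 2 <= ip x x * ip y y.
Proof.
move=> hx hy; have [y0|y0] := eqVneq (ip y y) 0.
  rewrite y0 mulr0; have [xy0|xy0] := eqVneq (ip x y) 0; first by rewrite xy0 expr2 mulr0.
  (* When [y] is null the square of [x + a *: y] is affine in [a]; this [a] makes it -1. *)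
  have := ip_ge0 (hdomD hx (hdomZ (- (ip x x + 1) / (2 * ip x y)) hy)).
  rewrite ip_sqD// y0 mulr0 addr0.
  suff -> : 2 * (- (ip x x + 1) / (2 * ip x y)) * ip x y = - (ip x x + 1) by lra.
  by field.
have {}y0 : 0 < ip y y by rewrite lt_neqAle eq_sym y0 ip_ge0.
have := ip_ge0 (hdomD hx (hdomZ (- ip x y / ip y y) hy)).
rewrite ip_sqD// => h; rewrite -subr_ge0.
suff -> : ip x x * ip y y - ip x y ^+ 2 = ip y y *
   (ip x x + 2 * (- ip x y / ip y y) * ip x y + (- ip x y / ip y y) ^+ 2 * ip y y).
  by rewrite mulr_ge0// ltW.
by field; rewrite gt_eqF.
Qed.

Lemma cauchy_schwarz x y : H x -> H y -> `|ip x y| <= hnorm x * hnorm y.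
Proof.
move=> hx hy; rewrite -(@ler_pXn2r _ 2%N)// ?nnegrE ?mulr_ge0 ?hnorm_ge0//.
by rewrite exprMn !hnorm_sqr// real_normK ?num_real// cauchy_schwarz_sqr.
Qed.

Lemma hnormD x y : H x -> H y -> hnorm (x + y) <= hnorm x + hnorm y.
Proof.
move=> hx hy; rewrite -(@ler_pXn2r _ 2%N)// ?nnegrE ?addr_ge0 ?hnorm_ge0//.
rewrite hnorm_sqr//; last exact: hdomD.
rewrite -{1 2}[y]scale1r ip_sqD// sqrrD !hnorm_sqr//.
have := le_trans (ler_norm _) (cauchy_schwarz hx hy); rewrite mulr2n; lra.
Qed.

Lemma hnormZ a x : H x -> hnorm (a *: x) = `|a| * hnorm x.
Proof.
move=> hx; rewrite /hnorm ipZl// ?ipZr//; last exact: hdomZ.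
by rewrite mulrA -expr2 sqrtrM ?sqr_ge0// sqrtr_sqr.
Qed.

Lemma hnorm0 : hnorm 0 = 0.
Proof. by rewrite /hnorm ip0l ?sqrtr0//; exact: hdom0. Qed.

Lemma hnormN x : H x -> hnorm (- x) = hnorm x.
Proof. by move=> hx; rewrite -scaleN1r hnormZ// normrN1 mul1r. Qed.

Lemma hdistC x y : H x -> H y -> hnorm (x - y) = hnorm (y - x).
Proof. by move=> hx hy; rewrite -hnormN ?opprB//; exact: hdomB. Qed.

Lemma hdistD x y z : H x -> H y -> H z ->
  hnorm (x - z) <= hnorm (x - y) + hnorm (y - z).
Proof.
move=> hx hy hz; have -> : x - z = (x - y) + (y - z) by rewrite addrA subrK.
by apply: hnormD; exact: hdomB.
Qed.

Lemma hnormB x y : H x -> H y -> hnorm (x - y) <= hnorm x + hnorm y.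
Proof. by move=> hx hy; rewrite -(hnormN hy); apply: hnormD; auto. Qed.

Lemma hnorm_lt x e : H x -> 0 < e -> (ip x x < e ^+ 2) = (hnorm x < e).
Proof.
by move=> hx e0; rewrite -hnorm_sqr// ltr_pXn2r// nnegrE ?hnorm_ge0// ltW.
Qed.

Lemma hnorm_eq0 x : H x -> (hnorm x == 0) = (ip x x == 0).
Proof. by move=> hx; rewrite -hnorm_sqr// expf_eq0. Qed.

Lemma hcvgP u x : (forall k, H (u k)) -> H x ->
  hcvg u x <-> (forall e, 0 < e -> exists N, forall i, (N <= i)%N -> hnorm (u i - x) < e).
Proof.
move=> hu hx; split.
  move=> /cvgrPdist_lt + e e0 => /(_ (e ^+ 2)).
  rewrite exprn_gt0// => /(_ isT) [N _ Nh]; exists N => i Ni.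
  rewrite -hnorm_lt//; last by auto.
  have /= := Nh i Ni; rewrite sub0r normrN ger0_norm// ip_ge0//; auto.
move=> h; apply/cvgrPdist_lt => e e0.
have [] := h (Num.sqrt e); first by rewrite sqrtr_gt0.
move=> N Nh; exists N => // i /= Ni; rewrite sub0r normrN ger0_norm; last first.
  by rewrite ip_ge0; auto.
have := Nh i Ni; rewrite -hnorm_lt ?sqrtr_gt0//; last by auto.
by rewrite sqr_sqrtr// ltW.
Qed.

Lemma hcauchyP u : (forall k, H (u k)) ->
  hcauchy u <-> (forall e, 0 < e -> exists N, forall i j, (N <= i)%N -> (N <= j)%N ->
    hnorm (u i - u j) < e).
Proof.
move=> hu; split => h e e0.
  have [] := h (e ^+ 2); first by rewrite exprn_gt0.
  move=> N Nh; exists N => i j Ni Nj; rewrite -hnorm_lt//; last by auto.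
  exact: Nh.
have [] := h (Num.sqrt e); first by rewrite sqrtr_gt0.
move=> N Nh; exists N => i j Ni Nj.
have := Nh i j Ni Nj; rewrite -hnorm_lt ?sqrtr_gt0//; last by auto.
by rewrite sqr_sqrtr// ltW.
Qed.

Lemma hcvg_hnorm u x : (forall k, H (u k)) -> H x ->
  hcvg u x <-> hnorm (u k - x) @[k --> \oo] --> (0 : R).
Proof.
move=> hu hx; rewrite hcvgP//; split.
  move=> h; apply/cvgrPdist_lt => e e0; have [N Nh] := h e e0.
  exists N => // i /= Ni; rewrite sub0r normrN ger0_norm ?hnorm_ge0//; exact: Nh.
move=> /cvgrPdist_lt h e e0; have [N _ Nh] := h e e0.
exists N => // i /= Ni; have /= := Nh i Ni.
by rewrite sub0r normrN ger0_norm ?hnorm_ge0.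
Qed.

Lemma hcvg_cauchy u x : (forall k, H (u k)) -> H x -> hcvg u x -> hcauchy u.
Proof.
move=> hu hx /(hcvgP hu hx) h; apply/(hcauchyP hu) => e e0.
have [] := h (e / 2); first by rewrite divr_gt0.
move=> N Nh; exists N => i j Ni Nj.
apply: le_lt_trans (hdistD (hu i) hx (hu j)) _; rewrite (hdistC hx)//.
have := Nh i Ni; have := Nh j Nj; lra.
Qed.

Lemma hcvg_ip u x v y : (forall k, H (u k)) -> H x -> (forall k, H (v k)) -> H y ->
  hcvg u x -> hcvg v y -> ip (u k) (v k) @[k --> \oo] --> ip x y.
Proof.
move=> hu hx hv hy /(hcvg_hnorm hu hx) cu /(hcvg_hnorm hv hy) cv.
apply/(@subr_cvg0 _ R^o)/cvgr0Pnorm_lt.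
have /cvgr0Pnorm_lt c : (hnorm (u k - x) * (hnorm (v k - y) + hnorm y) +
    hnorm x * hnorm (v k - y)) @[k --> \oo] --> (0 : R).
  rewrite [X in _ --> X](_ : 0 = 0 * (0 + hnorm y) + hnorm x * 0); last by ring.
  apply: cvgD; apply: cvgM => //; [apply: cvgD => //|]; exact: cvg_cst.
move=> e e0; have := c e e0; apply: filterS => k.
apply: le_lt_trans; rewrite [leRHS]ger0_norm; last first.
  by rewrite addr_ge0// mulr_ge0 ?addr_ge0 ?hnorm_ge0.
have -> : ip (u k) (v k) - ip x y = ip (u k - x) (v k) + ip x (v k - y).
  by rewrite ipBl// ipBr//; ring.
apply: le_trans (ler_normD _ _) _; apply: lerD.
  apply: le_trans (cauchy_schwarz _ _) _; try by auto.
  rewrite ler_wpM2l ?hnorm_ge0//.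
  rewrite -[X in hnorm X](subrK y); apply: hnormD; auto.
by apply: cauchy_schwarz; auto.
Qed.

Lemma hcvgZD a u x v y : (forall k, H (u k)) -> H x -> (forall k, H (v k)) -> H y ->
  hcvg u x -> hcvg v y -> hcvg (fun k => a *: u k + v k) (a *: x + y).
Proof.
move=> hu hx hv hy /(hcvg_hnorm hu hx) cu /(hcvg_hnorm hv hy) cv.
apply/hcvg_hnorm; [by move=> k; apply: hdomP|exact: hdomP|].
apply: (@squeeze_cvgr _ _ _ _ (cst 0)
    (fun k => `|a| * hnorm (u k - x) + hnorm (v k - y))); last 2 first.
- exact: cvg_cst.
- rewrite [X in _ --> X](_ : 0 = `|a| * 0 + 0); last by ring.
  by apply: cvgD => //; apply: cvgM => //; exact: cvg_cst.
near=> k; rewrite hnorm_ge0/=.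
have -> : a *: u k + v k - (a *: x + y) = a *: (u k - x) + (v k - y).
  by rewrite scalerBr opprD addrACA.
rewrite -hnormZ; last by auto.
by apply: hnormD; auto.
Unshelve. all: by end_near.
Qed.

Lemma hcvg_cst x : H x -> hcvg (fun=> x) x.
Proof.
by move=> hx; rewrite /hcvg subrr ip0l; [exact: cvg_cst|exact: hdom0].
Qed.

End semi_hilbert.

Section closed_subspace.
Context (R : realType) (X : lmodType R) (H : semiHilbert X) (P : X -> Prop).
Hypotheses (P0 : P 0) (PP : forall a x y, P x -> P y -> P (a *: x + y)).
Hypothesis PH : forall x, P x -> H x.
Hypothesis Pclosed : forall u x, (forall k, P (u k)) -> H x -> hcvg H u x -> P x.

(** Transparent, like the product and pullback constructions that follow, so that [ip] and
    membership reduce to those of the underlying spaces. *)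
Definition subHilbert : semiHilbert X.
Proof.
refine (@SemiHilbert R X P (ip H) P0 PP _ _ _ _).
- by move=> x y /PH hx /PH hy; exact: ipC.
- by move=> a x y z /PH hx /PH hy /PH hz; exact: ipP.
- by move=> x /PH; exact: ip_ge0.
- move=> u Pu cu; have [x hx ux] := ip_complete (fun k => PH (Pu k)) cu.
  by exists x => //; exact: Pclosed ux.
Defined.

End closed_subspace.

Section product.
Context (R : realType) (X Y : lmodType R) (H : semiHilbert X) (K : semiHilbert Y).

Definition prodHilbert : semiHilbert (X * Y)%type.
Proof.
refine (@SemiHilbert R (X * Y)%type (fun z => H z.1 /\ K z.2)
  (fun z w => ip H z.1 w.1 + ip K z.2 w.2) _ _ _ _ _ _).
- by split; exact: hdom0.
- by move=> a x y [hx kx] [hy ky]; split; exact: hdomP.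
- by move=> x y [hx kx] [hy ky]; rewrite ipC// (ipC kx).
- move=> a x y z [hx kx] [hy ky] [hz kz] /=; rewrite !ipP//; ring.
- by move=> x [hx kx]; rewrite addr_ge0 ?ip_ge0.
- move=> u hu cu.
  have [e|x hx cx] := @ip_complete _ _ H (fun k => (u k).1) (fun k => (hu k).1).
    move=> /cu[N Nh]; exists N => i j Ni Nj; apply: le_lt_trans (Nh i j Ni Nj).
    rewrite lerDl ip_ge0//; apply: hdomB; [exact: (hu i).2|exact: (hu j).2].
  have [e|y ky cy] := @ip_complete _ _ K (fun k => (u k).2) (fun k => (hu k).2).
    move=> /cu[N Nh]; exists N => i j Ni Nj; apply: le_lt_trans (Nh i j Ni Nj).
    rewrite lerDr ip_ge0//; apply: hdomB; [exact: (hu i).1|exact: (hu j).1].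
  exists (x, y) => //; rewrite -(addr0 0); exact: cvgD.
Defined.

Lemma hcvg_pair u z : (forall k, prodHilbert (u k)) -> prodHilbert z ->
  hcvg prodHilbert u z <-> hcvg H (fst \o u) z.1 /\ hcvg K (snd \o u) z.2.
Proof.
move=> hu hz; split; last first.
  by move=> [c1 c2]; rewrite /hcvg -(addr0 0); exact: cvgD.
have h1 k : H (u k - z).1 by apply: (@hdomB _ _ H); [case: (hu k)|case: hz].
have h2 k : K (u k - z).2 by apply: (@hdomB _ _ K); [case: (hu k)|case: hz].
have g1 k := ip_ge0 (h1 k); have g2 k := ip_ge0 (h2 k).
move=> c; split; apply: (squeeze_cvgr _ (cvg_cst 0) c); near=> k; apply/andP; split.
- exact: g1.
- by rewrite lerDl; exact: g2.
- exact: g2.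
- by rewrite lerDr; exact: g1.
Unshelve. all: by end_near.
Qed.

End product.

Section pullback.
Context (R : realType) (X Y : lmodType R) (K : semiHilbert Y) (f : X -> Y).
Hypothesis fP : forall a x y, f (a *: x + y) = a *: f x + f y.
Hypothesis fsurj : forall y, K y -> exists x, K (f x) /\ hnorm K (f x - y) = 0.

Lemma pullback0 : f 0 = 0.
Proof.
have := fP 1 0 0; rewrite !scale1r addr0 => /eqP.
by rewrite -subr_eq0 opprD addrA subrr sub0r oppr_eq0 => /eqP.
Qed.

Lemma pullbackB x y : f (x - y) = f x - f y.
Proof. by rewrite addrC -scaleN1r fP scaleN1r addrC. Qed.

(** Made for the weighted spaces on the boundary, which are pulled back along multiplication by the
    square root of |n . omega|. Surjectivity up to null vectors suffices for completeness: the limit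
    found in [K] may be replaced by an image at distance 0 from it. *)
Definition pullHilbert : semiHilbert X.
Proof.
refine (@SemiHilbert R X (K \o f) (fun x y => ip K (f x) (f y)) _ _ _ _ _ _).
- by rewrite /= pullback0; exact: hdom0.
- by move=> a x y; rewrite /= fP; exact: hdomP.
- by move=> x y; exact: ipC.
- by move=> a x y z hx hy hz; rewrite fP ipP.
- by move=> x; exact: ip_ge0.
- move=> u hu cu.
  have [e /cu[N Nh]|y ky cy] := @ip_complete _ _ K (f \o u) hu.
    by exists N => i j Ni Nj; rewrite -pullbackB; exact: Nh.
  have [x [kx xy]] := fsurj ky; exists x => //.
  rewrite (_ : (fun k => _) = fun k => ip K (f (u k) - f x) (f (u k) - f x)); last first.
    by apply/funext => k; rewrite pullbackB.
  apply/(@hcvg_hnorm _ _ K (f \o u)) => //.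
  move/(@hcvg_hnorm _ _ K (f \o u) y hu ky) : cy => cy.
  apply: (squeeze_cvgr _ (cvg_cst 0) cy).
  near=> k; rewrite hnorm_ge0/= -(addr0 (hnorm _ (_ - y))) -xy (hdistC kx ky).
  by apply: hdistD => //; exact: hu.
Unshelve. all: by end_near.
Defined.

End pullback.

(** * The open mapping theorem for semi-norms *)

Section bounded_inverse.
Context (R : realType) (X Y : lmodType R) (H : semiHilbert X) (K : semiHilbert Y).
Variable f : X -> Y.
Hypothesis fP : forall a x y, f (a *: x + y) = a *: f x + f y.
Hypothesis fdom : forall x, H x -> K (f x).
Hypothesis fle : forall x, H x -> hnorm K (f x) <= hnorm H x.
Hypothesis fsurj : forall y, K y -> exists2 x, H x & hnorm K (f x - y) = 0.
Hypothesis finj : forall x, H x -> hnorm K (f x) = 0 -> hnorm H x = 0.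

Let approx m y e := exists x, [/\ H x, hnorm H x <= m & hnorm K (f x - y) < e].

Let fB x y : f (x - y) = f x - f y := pullbackB fP x y.

Let fZ a x : f (a *: x) = a *: f x.
Proof. by rewrite -[a *: x]addr0 fP (pullback0 fP) addr0. Qed.

(** Baire's argument with explicit nested balls. If every [m] failed on every ball, the balls could
    be shrunk one after the other so that the centre chosen at stage [m] is not approximable from
    radius [m]. Their common point is [f x] for some [x] up to a null vector, which is contradictory
    at any [m] above the norm of [x]. *)
Lemma approx_ball : exists (m : nat) y0 r, [/\ K y0, 0 < r &
  forall y, K y -> hnorm K (y - y0) <= r -> forall e, 0 < e -> approx m%:R y e].
Proof.
apply: contrapT => hno.
have step (m : nat) (p : Y * R) : exists q : Y * R, K p.1 -> 0 < p.2 ->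
    [/\ K q.1, 0 < q.2, hnorm K (q.1 - p.1) + q.2 <= p.2, q.2 <= p.2 / 2 &
        ~ approx m%:R q.1 (2 * q.2)].
  have [[Kp p0]|np] := pselect (K p.1 /\ 0 < p.2); last first.
    by exists p => Kp p0; exfalso; apply: np.
  have [y [Ky yp]] : exists y, [/\ K y, hnorm K (y - p.1) <= p.2 / 2 &
      exists2 e, 0 < e & ~ approx m%:R y e].
    apply: contrapT => hy; apply: hno; exists m, p.1, (p.2 / 2); split => //.
      by rewrite divr_gt0.
    move=> y Ky yp e e0; apply: contrapT => ha; apply: hy; exists y; split => //.
    by exists e.
  move=> [e e0 hae].
  have le1 : Num.min (p.2 / 2) (e / 2) <= p.2 / 2 by rewrite ge_min lexx.
  have le2 : Num.min (p.2 / 2) (e / 2) <= e / 2 by rewrite ge_min lexx orbT.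
  (* The bound [e / 2] keeps the doubled radius below [e]; doubling turns the weak inequality
     satisfied by the common point into the strict one of [approx]. *)
  exists (y, Num.min (p.2 / 2) (e / 2)) => _ _ /=; split => //.
  - by rewrite lt_min !divr_gt0.
  - lra.
  - move=> [x [Hx xm xy]]; apply: hae; exists x; split => //.
    by apply: lt_le_trans xy _; lra.
have {step}[F FP] : {F : nat -> Y * R -> Y * R | forall m p, K p.1 -> 0 < p.2 ->
    [/\ K (F m p).1, 0 < (F m p).2, hnorm K ((F m p).1 - p.1) + (F m p).2 <= p.2,
        (F m p).2 <= p.2 / 2 & ~ approx m%:R (F m p).1 (2 * (F m p).2)]}.
  exists (fun m p => projT1 (cid (step m p))) => m p.
  by case: cid.
pose s := fix s n := if n is n'.+1 then F n' (s n') else (0 : Y, 1 : R).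
have sP n : K (s n).1 /\ 0 < (s n).2.
  elim: n => [|n [IH1 IH2]] /=; first by split => //; exact: hdom0.
  by have [] := FP n _ IH1 IH2.
have sK n := (sP n).1.
have s0 n := (sP n).2.
have s2 n : (s n).2 <= 2^-1 ^+ n.
  elim: n => [|n IH] /=; first by rewrite expr0.
  have [_ _ _ h _] := FP n _ (sK n) (s0 n).
  by rewrite exprS; move: h IH; lra.
have snest i j : hnorm K ((s (i + j)%N).1 - (s i).1) + (s (i + j)%N).2 <= (s i).2.
  elim: j => [|j IH]; first by rewrite addn0 subrr hnorm0 add0r.
  rewrite addnS /=; have [hK _ h _ _] := FP (i + j)%N _ (sK (i + j)%N) (s0 (i + j)%N).
  have := hdistD hK (sK (i + j)%N) (sK i); move: IH h; lra.
have [y Ky cy] : exists2 y, K y & hcvg K (fst \o s) y.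
  apply: ip_complete; first by move=> k; exact: sK.
  apply/(@hcauchyP _ _ K (fst \o s) sK) => e e0.
  have /cvgr0Pnorm_lt /(_ (e / 2)) : (2^-1 ^+ n : R) @[n --> \oo] --> (0 : R).
    by apply: cvg_expr; rewrite ger0_norm; lra.
  rewrite divr_gt0// => /(_ isT) [N _ NP]; exists N => i j Ni Nj.
  have := NP N (leqnn N); rewrite ger0_norm ?exprn_ge0 ?invr_ge0// => hN.
  have := snest N (i - N)%N; have := snest N (j - N)%N; rewrite !subnKC//.
  have := hdistD (sK i) (sK N) (sK j); rewrite (hdistC (sK N) (sK j)).
  have := s2 N; have := s0 i; have := s0 j; move: hN => /=; lra.
have yn n : hnorm K (y - (s n).1) <= (s n).2.
  apply/ler_addgt0Pr => e e0.
  move/(@hcvgP _ _ K (fst \o s) _ sK Ky) : cy => /(_ e e0) [N NP].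
  have := NP (n + N)%N (leq_addl _ _); have := snest n N.
  have := hdistD Ky (sK (n + N)%N) (sK n); rewrite (hdistC Ky (sK (n + N)%N)).
  have := s0 (n + N)%N; rewrite /=; lra.
have [x Hx xy] := fsurj Ky.
have [m xm] : exists m : nat, hnorm H x <= m%:R.
  by exists (Num.truncn (hnorm H x)).+1; rewrite ltW// truncnS_gt.
have [_ h0 _ _] := FP m _ (sK m) (s0 m); apply; exists x; split => //.
apply: le_lt_trans (hdistD (fdom Hx) Ky (sK m.+1)) _.
by rewrite xy add0r; apply: le_lt_trans (yn m.+1) _; move: h0; rewrite /=; lra.
Qed.

(** With [t = r / hnorm K y], the vector [t *: y] is the difference of [y0 + t *: y] and [y0], both
    in the ball, so that two elements of norm at most [m] combine into one of norm at most
    [2 * m / t]. The added 1 keeps the constant positive when [m] is 0. *)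
Lemma approx_scaled : exists2 M, 0 < M & forall y, K y -> forall e, 0 < e ->
  approx (M * hnorm K y) y e.
Proof.
have [m [y0 [r [Ky0 r0 h]]]] := approx_ball.
have m0 : 0 <= (m%:R : R) by exact: ler0n.
exists ((2 * m%:R + 1) / r) => [|y Ky e e0]; first by rewrite divr_gt0//; lra.
have := hnorm_ge0 K y; rewrite le_eqVlt => /predU1P[y00|yp].
  exists 0; split; [exact: hdom0|by rewrite hnorm0 -y00 mulr0|].
  by rewrite (pullback0 fP) sub0r hnormN// -y00.
pose t := r / hnorm K y; have t0 : 0 < t by rewrite divr_gt0.
have Kty : K (t *: y) by exact: hdomZ.
have e' : 0 < t * e / 2 by rewrite divr_gt0// mulr_gt0.
have y1 : hnorm K (y0 + t *: y - y0) <= r.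
  by rewrite addrAC subrr add0r hnormZ// gtr0_norm// /t divfK// gt_eqF.
have y2 : hnorm K (y0 - y0) <= r by rewrite subrr hnorm0 ltW.
have [x1 [H1 n1 d1]] := h _ (hdomD Ky0 Kty) y1 _ e'.
have [x2 [H2 n2 d2]] := h _ Ky0 y2 _ e'.
exists (t^-1 *: (x1 - x2)); split.
- by apply: hdomZ; exact: hdomB.
- rewrite hnormZ; last exact: hdomB.
  rewrite gtr0_norm ?invr_gt0// /t invf_div mulrC [leRHS]mulrAC -[leRHS]mulrA ler_pM2r//.
    by have := hnormB H1 H2; lra.
  by rewrite divr_gt0.
have -> : f (t^-1 *: (x1 - x2)) - y =
    t^-1 *: ((f x1 - (y0 + t *: y)) - (f x2 - y0)).
  rewrite fZ fB; have -> : f x1 - (y0 + t *: y) - (f x2 - y0) = f x1 - f x2 - t *: y.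
    by rewrite !opprD opprK !addrA [LHS](AC 5 (1*4*3*(2*5)))/= addNr addr0.
  by rewrite [RHS]scalerBr scalerA mulVf ?scale1r// gt_eqF.
have K1 : K (f x1 - (y0 + t *: y)).
  by apply: hdomB; [exact: fdom|exact: hdomD].
have K2 : K (f x2 - y0) by apply: hdomB => //; exact: fdom.
rewrite hnormZ; last exact: hdomB.
rewrite gtr0_norm ?invr_gt0// mulrC ltr_pdivrMr//.
by have := hnormB K1 K2; rewrite (mulrC e); lra.
Qed.

(** Successive approximation: each correction halves the bound [e n] on the remaining error and has
    norm at most [M * e n], for a total of [2 * M * hnorm K y]. The limit solves the equation up to
    a null vector, and injectivity transfers its bound to the given [x0]. *)
Lemma bounded_inverse : exists C, forall x, H x -> hnorm H x <= C * hnorm K (f x).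
Proof.
have [M M0 h] := approx_scaled.
exists (2 * M) => x0 Hx0; set y := f x0.
have Ky : K y by exact: fdom.
have := hnorm_ge0 K y; rewrite le_eqVlt => /predU1P[y00|yp].
  by rewrite -y00 mulr0 finj.
pose e n := hnorm K y * 2^-1 ^+ n.
have e0 n : 0 < e n by rewrite mulr_gt0// exprn_gt0// invr_gt0.
have eS n : e n.+1 = e n / 2 by rewrite /e exprSr mulrA.
have h' n p : exists q : X, H p -> H q /\
    (hnorm K (f p - y) <= e n -> hnorm H (q - p) <= M * e n /\ hnorm K (f q - y) <= e n.+1).
  have [Hp|nHp] := pselect (H p); last by exists p.
  have Kr : K (y - f p) by apply: hdomB => //; exact: fdom.
  have [x [Hx nx dx]] := h _ Kr _ (e0 n.+1).
  exists (p + x) => _; split; first exact: hdomD.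
  move=> pe; split.
    rewrite addrC addrA addNr add0r; apply: le_trans nx _.
    by rewrite ler_pM2l// hdistC//; exact: fdom.
  suff -> : f (p + x) - y = f x - (y - f p) by exact: ltW.
  by rewrite -{1}[p]scale1r fP scale1r opprB addrA (addrC (f p)).
have {h'}[F FP] : {F : nat -> X -> X | forall n p, H p -> H (F n p) /\
    (hnorm K (f p - y) <= e n -> hnorm H (F n p - p) <= M * e n /\
       hnorm K (f (F n p) - y) <= e n.+1)}.
  by exists (fun n p => projT1 (cid (h' n p))) => n p; case: cid.
pose s := fix s n := if n is n'.+1 then F n' (s n') else (0 : X).
have sH n : H (s n).
  by elim: n => [|n IH]; [exact: hdom0|exact: (FP n _ IH).1].
have sy n : hnorm K (f (s n) - y) <= e n.
  elim: n => [|n IH] /=; last by have [_ /(_ IH)[]] := FP n _ (sH n).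
  by rewrite (pullback0 fP) sub0r hnormN// /e expr0 mulr1.
have ss n : hnorm H (s n.+1 - s n) <= M * e n.
  by have [_ /(_ (sy n))[]] := FP n _ (sH n).
(* A geometric sum with its tail subtracted, the form in which the induction closes. *)
have st i j : hnorm H (s (i + j)%N - s i) <= 2 * M * e i - 2 * M * e (i + j)%N.
  elim: j => [|j IH]; first by rewrite addn0 !subrr hnorm0.
  rewrite addnS; have := hdistD (sH (i + j).+1) (sH (i + j)%N) (sH i).
  have := ss (i + j)%N; move: IH; rewrite eS; nra.
have [x Hx cx] : exists2 x, H x & hcvg H s x.
  apply: ip_complete => //; apply/(@hcauchyP _ _ H s sH) => d d0.
  have /cvgr0Pnorm_lt /(_ (d / (4 * M * hnorm K y))) :
      (2^-1 ^+ n : R) @[n --> \oo] --> (0 : R).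
    by apply: cvg_expr; rewrite ger0_norm; lra.
  rewrite divr_gt0 ?mulr_gt0// => /(_ isT) [N _ NP]; exists N => i j Ni Nj.
  have := NP N (leqnn N); rewrite ger0_norm ?exprn_ge0 ?invr_ge0//.
  rewrite ltr_pdivlMr ?mulr_gt0// => hN.
  have hN' : 4 * M * e N < d by move: hN; rewrite /e; lra.
  have := st N (i - N)%N; have := st N (j - N)%N; rewrite !subnKC//.
  have := hdistD (sH i) (sH N) (sH j); rewrite (hdistC (sH N) (sH j)).
  have := e0 i; have := e0 j; nra.
have xM : hnorm H x <= 2 * M * hnorm K y.
  apply/ler_addgt0Pr => d d0.
  move/(@hcvgP _ _ H s _ sH Hx) : cx => /(_ d d0) [N /(_ N (leqnn N)) NP].
  have := st 0%N N; rewrite add0n subr0 {1}/e expr0 mulr1.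
  have := hdistD Hx (sH N) (hdom0 H); rewrite !subr0 (hdistC Hx)//.
  have := e0 N; nra.
have xy : hnorm K (f x - y) = 0.
  apply/eqP; rewrite eq_le hnorm_ge0 andbT; apply/ler_addgt0Pr => d d0; rewrite add0r.
  have d2 : 0 < d / 2 by rewrite divr_gt0.
  move/(@hcvgP _ _ H s _ sH Hx) : cx => /(_ _ d2) [N NP].
  have /cvgr0Pnorm_lt /(_ (d / 2 / hnorm K y)) : (2^-1 ^+ n : R) @[n --> \oo] --> (0 : R).
    by apply: cvg_expr; rewrite ger0_norm; lra.
  rewrite divr_gt0// => /(_ isT) [N' _ NP'].
  have := NP' (N + N')%N (leq_addl _ _); rewrite ger0_norm ?exprn_ge0 ?invr_ge0//.
  rewrite ltr_pdivlMr// mulrC -/(e _).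
  have := NP (N + N')%N (leq_addr _ _); have := sy (N + N')%N.
  have := hdistD (fdom Hx) (fdom (sH (N + N')%N)) Ky.
  rewrite -fB; have := fle (hdomB Hx (sH (N + N')%N)); rewrite (hdistC Hx)//; lra.
apply: le_trans xM; have /finj : H (x - x0) by exact: hdomB.
rewrite fB xy => /(_ erefl) xx0.
by have := hdistD Hx0 Hx (hdom0 H); rewrite !subr0 (hdistC Hx0)// xx0 add0r.
Qed.

End bounded_inverse.

(** * Completeness of L2 *)

Lemma fct_linE (T : Type) (R : realType) a (f g : T -> R) z :
  (a *: f + g) z = a * f z + g z.
Proof. by []. Qed.

Section L2_semi_hilbert.
Context d (T : measurableType d) (R : realType).
Variables (mu : {measure set T -> \bar R}) (A : set T).
Hypothesis mA : measurable A.
Implicit Types f g h : T -> R.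

Lemma ae_onS (P Q : T -> Prop) : (forall z, A z -> P z -> Q z) ->
  ae_on mu A P -> ae_on mu A Q.
Proof. by move=> PQ; rewrite /ae_on; apply: filterS => z h Az; exact/PQ/h. Qed.

Lemma ae_onS2 (P P' Q : T -> Prop) : (forall z, A z -> P z -> P' z -> Q z) ->
  ae_on mu A P -> ae_on mu A P' -> ae_on mu A Q.
Proof.
move=> PQ; rewrite /ae_on; apply: filterS2 => z h h' Az.
by apply: PQ => //; [exact: h|exact: h'].
Qed.

Lemma L2P f : L2 mu A f <-> measurable_fun A f /\ (sqnorm mu A f < +oo)%E.
Proof.
have E : sqnorm mu A f = (\int[mu]_z ((f \_ A) z ^+ 2)%:E)%E.
  rewrite /sqnorm integral_mkcond; apply: eq_integral => z _.
  by rewrite !patchE; case: ifP => //; rewrite expr0n.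
rewrite /L2 E; split.
  move=> fA; split.
    apply/measurable_restrictT => //.
    by move: fA; rewrite inE => /andP[]; rewrite inE.
  have /integrableP[_] := Lfun2_integrable_sqr fA.
  apply: le_lt_trans; rewrite le_eqVlt; apply/orP; left; apply/eqP.
  by apply: eq_integral => z _; rewrite gee0_abs//= lee_fin sqr_ge0.
move=> [/measurable_restrictT mf foo].
rewrite inE; apply/andP; split; first by rewrite inE; exact: mf.
rewrite inE/= /finite_norm unlock; apply: poweR_lty; apply: le_lt_trans foo.
rewrite le_eqVlt; apply/orP; left; apply/eqP; apply: eq_integral => z _ /=.
by rewrite powR_mulrn ?normr_ge0// real_normK// num_real.
Qed.

Lemma L2_measurable f : L2 mu A f -> measurable_fun A f.
Proof. by case/L2P. Qed.

Lemma L2_mul_integrable f g : L2 mu A f -> L2 mu A g ->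
  mu.-integrable A (EFin \o (f \* g)).
Proof.
move=> lf lg; have /Lfun1_integrable := Lfun2_mul_Lfun1 lf lg.
move=> fg; apply/(integrable_mkcond _ mA); congr (mu.-integrable setT _) : fg.
by apply/funext => z /=; rewrite !patchE; case: ifP => //; rewrite mulr0.
Qed.

Lemma L2_linear a f g : L2 mu A f -> L2 mu A g -> L2 mu A (a *: f + g).
Proof.
move=> lf lg; rewrite /L2.
rewrite (_ : _ \_ _ = (a *: (f \_ A) + g \_ A)); last first.
  apply/funext => z; rewrite fct_linE !patchE; case: ifP => // _.
  by rewrite mulr0 addr0.
have h12 : (1 <= 2%:E :> \bar R)%E by rewrite lee_fin ler1n.
by have [_] := Lfun_submod_closed mu h12; exact.
Qed.

Lemma L2_0 : L2 mu A 0.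
Proof.
apply/L2P; split; first exact: measurable_cst.
rewrite /sqnorm integral0_eq ?ltry// => z _.
by rewrite /GRing.zero/= expr0n.
Qed.

Lemma innerC f g : inner mu A f g = inner mu A g f.
Proof. by rewrite /inner; under eq_Rintegral do rewrite mulrC. Qed.

Lemma innerP a f g h : L2 mu A f -> L2 mu A g -> L2 mu A h ->
  inner mu A (a *: f + g) h = a * inner mu A f h + inner mu A g h.
Proof.
move=> lf lg lh; rewrite /inner -RintegralZl//; last exact: L2_mul_integrable.
rewrite -RintegralD//; last 2 first.
- exact: (integrableZl mA a (L2_mul_integrable lf lh)).
- exact: L2_mul_integrable.
by apply: eq_Rintegral => z _; rewrite fct_linE; ring.
Qed.

Lemma inner_ge0 f : 0 <= inner mu A f f.
Proof. by apply: Rintegral_ge0 => z _; rewrite -expr2 sqr_ge0. Qed.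

Lemma sqnorm_ge0 f : (0 <= sqnorm mu A f)%E.
Proof. by apply: integral_ge0 => z _; rewrite lee_fin sqr_ge0. Qed.

Lemma sqnormE f : L2 mu A f -> sqnorm mu A f = (inner mu A f f)%:E.
Proof.
move=> /L2P[_ foo]; rewrite /inner /Rintegral fineK//.
by rewrite ge0_fin_numE//; exact: sqnorm_ge0.
Qed.

Lemma L2_le f g : measurable_fun A g -> L2 mu A f ->
  (forall z, A z -> `|g z| <= `|f z|) -> L2 mu A g.
Proof.
move=> mg /L2P[mf foo] gf; apply/L2P; split=> //; apply: le_lt_trans foo.
apply: ge0_le_integral => //.
- by move=> z _; rewrite lee_fin sqr_ge0.
- by apply/measurable_EFinP; exact: measurable_funX.
- by apply/measurable_EFinP; exact: measurable_funX.
- move=> z Az; rewrite lee_fin -[leLHS]real_normK ?num_real//.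
  by rewrite -[leRHS]real_normK ?num_real// ler_pXn2r ?nnegrE// gf.
Qed.

Lemma inner_ae_eql f g h : L2 mu A f -> L2 mu A g -> L2 mu A h ->
  ae_on mu A (fun z => f z = g z) -> inner mu A f h = inner mu A g h.
Proof.
move=> /L2_measurable mf /L2_measurable mg /L2_measurable mh fg.
congr fine; apply: ae_eq_integral => //.
- by apply/measurable_EFinP; exact: measurable_funM.
- by apply/measurable_EFinP; exact: measurable_funM.
- by apply: ae_onS fg => z _ /= ->.
Qed.

Lemma inner_eq0_ae f : L2 mu A f -> inner mu A f f = 0 <->
  ae_on mu A (fun z => f z = 0).
Proof.
move=> lf; have [mf _] := (L2P f).1 lf; split.
  move=> f0; have : (\int[mu]_(x in A) `|((f x)^+2)%:E| = 0)%E.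
    have s0 : sqnorm mu A f = 0%E by rewrite sqnormE// f0.
    rewrite -[RHS]s0; apply: eq_integral => z _.
    by rewrite gee0_abs// lee_fin sqr_ge0.
  have mf2 : measurable_fun A (fun x => ((f x) ^+ 2)%:E).
    by apply/measurable_EFinP; exact: measurable_funX.
  move=> /(ae_eq_integral_abs mu mA mf2); apply: ae_onS => z _ [/eqP].
  by rewrite sqrf_eq0 => /eqP.
move=> f0; rewrite (inner_ae_eql lf L2_0 lf f0) /inner.
by under eq_Rintegral do rewrite mul0r; rewrite /Rintegral integral0.
Qed.

Section riesz_fischer.
Variable u : nat -> T -> R.
Hypothesis lu : forall k, L2 mu A (u k).
Hypothesis cu : forall e, 0 < e -> exists N, forall i j, (N <= i)%N -> (N <= j)%N ->
  inner mu A (u i - u j) (u i - u j) < e.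

Lemma L2_sub f g : L2 mu A f -> L2 mu A g -> L2 mu A (f - g).
Proof. by move=> lf lg; rewrite addrC -scaleN1r; exact: L2_linear. Qed.

Lemma fast_subsequence : exists2 s : nat -> nat, {homo s : m n / (m <= n)%N} &
  forall n i j, (s n <= i)%N -> (s n <= j)%N ->
    inner mu A (u i - u j) (u i - u j) < 8^-1 ^+ n.
Proof.
have h n : exists N, forall i j, (N <= i)%N -> (N <= j)%N ->
    inner mu A (u i - u j) (u i - u j) < 8^-1 ^+ n.
  by apply: cu; rewrite exprn_gt0// invr_gt0.
(* Partial sums turn the thresholds [N n] into a monotone sequence that dominates them. *)
have [N NP] := choice h; exists (fun n => \sum_(k < n.+1) N k)%N.
  apply: homo_leq => // [|n]; first exact: leq_trans.
  by rewrite [leqRHS]big_ord_recr/= leq_addr.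
move=> n i j ni nj; apply: NP.
  by apply: leq_trans ni; rewrite big_ord_recr/= leq_addl.
by apply: leq_trans nj; rewrite big_ord_recr/= leq_addl.
Qed.

(* The series of the [4^n (v_{n+1} - v_n)^2] has a finite integral along a
   subsequence [v] with squared increments below [8^-n], so that almost
   everywhere [|v_{n+1} - v_n| <= C 2^-n]. *)
Lemma ae_cvg_subsequence (s : nat -> nat) : {homo s : m n / (m <= n)%N} ->
  (forall n i j, (s n <= i)%N -> (s n <= j)%N ->
    inner mu A (u i - u j) (u i - u j) < 8^-1 ^+ n) ->
  {ae mu, forall z, A z -> cvgn (fun n => u (s n) z)}.
Proof.
move=> sh sP; pose g n z := (4 ^+ n * (u (s n.+1) z - u (s n) z) ^+ 2)%:E.
have lv n : L2 mu A (u (s n.+1) - u (s n)) by exact: L2_sub.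
have mg n : measurable_fun A (g n).
  apply/measurable_EFinP; apply: measurable_funM; first exact: measurable_cst.
  exact: measurable_funX (L2_measurable (lv n)).
have g0 n z : A z -> (0 <= g n z)%E.
  by move=> _; rewrite lee_fin mulr_ge0 ?sqr_ge0 ?exprn_ge0.
have ig : (\int[mu]_(z in A) (\sum_(n <oo) g n z) < +oo)%E.
  rewrite integral_nneseries//.
  apply: (@le_lt_trans _ _ 2%:E); last exact: ltry.
  apply: lime_le; first by apply: is_cvg_nneseries => n _ _; apply: integral_ge0 => z; exact: g0.
  apply: nearW => n.
  apply: (@le_trans _ _ (\sum_(0 <= k < n) (2^-1 ^+ k : R)%:E)%E).
    apply: lee_sum => k _; rewrite /g; under eq_integral do rewrite EFinM.
    rewrite ge0_integralZl_EFin ?exprn_ge0//; last 2 first.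
    - by move=> z _; rewrite lee_fin sqr_ge0.
    - by apply/measurable_EFinP; exact: measurable_funX (L2_measurable (lv k)).
    have := sqnormE (lv k); rewrite /sqnorm => ->.
    rewrite -EFinM lee_fin.
    have -> : 2^-1 ^+ k = 4 ^+ k * 8^-1 ^+ k :> R.
      by rewrite -exprMn; congr (_ ^+ _); field.
    by rewrite ler_wpM2l ?exprn_ge0// ltW// sP// sh.
  rewrite sumEFin lee_fin.
  suff -> : \sum_(0 <= k < n) 2^-1 ^+ k = 2 - 2 * 2^-1 ^+ n :> R.
    by rewrite gerBl mulr_ge0// exprn_ge0.
  elim: n => [|n IH]; first by rewrite big_geq// expr0 mulr1 subrr.
  by rewrite big_nat_recr//= IH exprS; field.
have : mu.-integrable A (fun z => \sum_(n <oo) g n z)%E.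
  apply/integrableP; split; first exact:
    (@ge0_emeasurable_sum _ _ _ A g xpredT (fun k x Ax _ => g0 k x Ax) (fun k _ => mg k)).
  apply: le_lt_trans ig; rewrite le_eqVlt; apply/orP; left; apply/eqP.
  apply: eq_integral => z zA; rewrite gee0_abs//; apply: nneseries_ge0 => n _ _.
  by apply: g0; exact: set_mem.
move=> /(integrable_ae mA); apply: filterS => z + Az => /(_ Az) gz.
pose a n := u (s n.+1) z - u (s n) z.
have ale n : `|a n| <= Num.sqrt (fine (\sum_(n <oo) g n z)%E) * 2^-1 ^+ n.
  have gn : (g n z <= \sum_(n <oo) g n z)%E.
    have := @nneseries_lim_ge _ (fun n => g n z) xpredT 0%N n.+1.
    move=> /(_ (fun n _ _ => g0 n z Az)); apply: le_trans.
    rewrite big_nat_recr//= leeDr// sume_ge0// => k _; exact: g0.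
  have := gn; rewrite -(fineK gz) lee_fin => {}gn.
  rewrite -(@ler_pXn2r _ 2%N)// ?nnegrE ?mulr_ge0 ?sqrtr_ge0 ?exprn_ge0//.
  rewrite exprMn sqr_sqrtr; last by apply: le_trans gn; rewrite -lee_fin; exact: g0.
  rewrite real_normK ?num_real//.
  have -> : (2^-1 ^+ n) ^+ 2 = (4 ^+ n)^-1 :> R.
    by rewrite -exprM mulnC exprM -exprVn; congr (_ ^+ _); field.
  by rewrite ler_pdivlMr ?exprn_gt0// mulrC.
have : cvgn (series a).
  apply: normed_cvg; apply: (series_le_cvg (fun n => normr_ge0 (a n)) _ ale).
    by move=> n; rewrite mulr_ge0 ?sqrtr_ge0 ?exprn_ge0.
  by apply: is_cvg_geometric_series; rewrite ger0_norm; lra.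
rewrite (_ : series a = [sequence u (s n) z - u (s 0%N) z]_n); last first.
  by rewrite -(telescopeK (fun n => u (s n) z)).
move=> ca; have c := is_cvgD ca (is_cvg_cst (u (s 0%N) z)).
have E : (fun n => u (s n) z) =
    (fun n => [sequence u (s n) z - u (s 0%N) z]_n n + u (s 0%N) z).
  by apply/funext => n; rewrite /= subrK.
rewrite E; exact: c.
Qed.

(** The almost everywhere limit of a fast subsequence is the L2 limit of the whole sequence: for [i]
    beyond [s n], Fatou's lemma bounds the squared distance from [u i] to [f] by the lower limit of
    those from [u i] to the subsequence. *)
Lemma riesz_fischer : exists2 f, L2 mu A f &
  inner mu A (u k - f) (u k - f) @[k --> \oo] --> (0 : R).
Proof.
have [s sh sP] := fast_subsequence.
have cs := ae_cvg_subsequence sh sP.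
(* An upper limit is measurable on all of [A], whatever happens on the exceptional null set, where
   [fine] still gives a real value. *)
pose f z := fine (limn_esup (fun n => (u (s n) z)%:E)).
have mf : measurable_fun A f.
  apply: measurableT_comp => //; apply: measurable_fun_limn_esup => n.
  by apply/measurable_EFinP; exact: L2_measurable.
have {}cs : {ae mu, forall z, A z -> u (s n) z @[n --> \oo] --> f z}.
  apply: filterS cs => z /[apply] c.
  have c' : (u (s n) z)%:E @[n --> \oo] --> (limn (fun n => u (s n) z))%:E.
    by apply: cvg_EFin => //; exact: nearW.
  rewrite /f is_cvg_limn_esupE; last by apply/cvg_ex; eexists; exact: c'.
  by rewrite (cvg_lim _ c').
have key n i : (s n <= i)%N -> (sqnorm mu A (u i - f)%R <= (8^-1 ^+ n)%:E)%E.
  move=> ni; pose g m z := ((u i z - u (s m) z) ^+ 2)%:E.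
  have mg m : measurable_fun A (g m).
    apply/measurable_EFinP/measurable_funX/measurable_funB; exact: L2_measurable.
  apply: (@le_trans _ _ (\int[mu]_(z in A) limn_einf (g ^~ z))%E).
    rewrite le_eqVlt; apply/orP; left; apply/eqP; apply: ae_eq_integral => //.
    - apply/measurable_EFinP/measurable_funX/measurable_funB => //; exact: L2_measurable.
    - rewrite (_ : (fun z => _) = (fun z => - limn_esup (fun m => - g m z))%E)//.
      apply: measurableT_comp => //; apply: measurable_fun_limn_esup => m.
      exact: measurableT_comp.
    - apply: filterS cs => z /[apply] c.
      have c' : (g m z) @[m --> \oo] --> ((u i z - f z) ^+ 2)%:E.
        apply: cvg_EFin; first exact: nearW.
        have c2 : u i z - u (s m) z @[m --> \oo] --> u i z - f z.
          by apply: cvgB => //; exact: cvg_cst.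
        have c3 : (u i z - u (s m) z) ^+ 2 @[m --> \oo] --> (u i z - f z) ^+ 2.
          exact: (cvgM c2 c2).
        exact: c3.
      rewrite is_cvg_limn_einfE; last by apply/cvg_ex; eexists; exact: c'.
      by rewrite (cvg_lim _ c').
  have g0 m z : A z -> (0 <= g m z)%E by move=> _; rewrite lee_fin sqr_ge0.
  apply: le_trans (@fatou _ _ _ mu _ mA _ mg g0) _.
  apply: le_trans (limn_einf_sup _) _.
  rewrite limn_esup_lim; apply: lime_le; first exact: is_cvg_esups.
  exists n => // m /= nm; apply: ge_ereal_sup => _ [k /= mk <-].
  have := sqnormE (L2_sub (lu i) (lu (s k))); rewrite /sqnorm => ->.
  rewrite lee_fin ltW// sP//; apply: sh; exact: leq_trans mk.
(* [key] with [n = 0] shows that [u (s 0) - f] has a finite norm, so [f] is a difference of two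
   elements of L2. *)
have lf : L2 mu A f.
  rewrite (_ : f = u (s 0%N) - (u (s 0%N) - f)); last by rewrite opprB addrC subrK.
  apply: L2_sub => //; apply/L2P; split.
    by apply: measurable_funB => //; exact: L2_measurable.
  by apply: le_lt_trans (key 0%N _ (leqnn _)) (ltry _).
exists f => //; apply/cvgr0Pnorm_lt => e e0.
have /cvgr0Pnorm_lt /(_ e e0)[n _ nP] : (8^-1 ^+ n : R) @[n --> \oo] --> (0 : R).
  by apply: cvg_expr; rewrite ger0_norm; lra.
exists (s n) => // i /= ni; rewrite ger0_norm ?inner_ge0//.
have := nP n (leqnn n); rewrite ger0_norm ?exprn_ge0 ?invr_ge0//.
apply: le_lt_trans; rewrite -lee_fin -sqnormE; [exact: key|exact: L2_sub].
Qed.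

End riesz_fischer.

Definition L2Hilbert : semiHilbert (T -> R) :=
  @SemiHilbert R (T -> R) (L2 mu A) (inner mu A) L2_0 L2_linear
    (fun f g _ _ => innerC f g) innerP (fun f _ => inner_ge0 f) riesz_fischer.

Lemma hnorm_eq0_ae f g : L2 mu A f -> L2 mu A g ->
  hnorm L2Hilbert (f - g) = 0 <-> ae_on mu A (fun z => f z = g z).
Proof.
move=> lf lg; have lfg := L2_sub lf lg.
have E z : (f - g) z = f z - g z by [].
split=> [/eqP|fg].
  rewrite hnorm_eq0// => /eqP /(inner_eq0_ae lfg); apply: ae_onS => z _.
  by rewrite E => /eqP; rewrite subr_eq0 => /eqP.
apply/eqP; rewrite hnorm_eq0//; apply/eqP/(inner_eq0_ae lfg).
by apply: ae_onS fg => z _; rewrite E => ->; rewrite subrr.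
Qed.

End L2_semi_hilbert.

(** * Measurability and volume in spaces of row vectors *)

Section measurable_base.
Context d (T : measurableType d) (I : countType) (B : I -> set T).
Hypothesis mB : forall i, measurable (B i).

Lemma measurable_base (U : set T) :
  (forall x, U x -> exists2 i, B i x & B i `<=` U) -> measurable U.
Proof.
move=> h; rewrite (_ : U = \bigcup_i (if `[< B i `<=` U >] then B i else set0)).
  apply: countable_bigcupT_measurable => // i.
  by case: asboolP => // _; exact: measurable0.
apply/seteqP; split => [x /h[i Bx BU]|x [i _]].
  by exists i => //; case: asboolP.
by case: asboolP => // BU; exact: BU.
Qed.

End measurable_base.

Section row_vectors.
Context {R : realType}.

(** A countable base of the topology, made of sets that are measurable coordinate by coordinate: it
    places the open sets in the sigma-algebra generated by the coordinates. *)
Definition rat_box n (p : 'rV[rat]_n * nat) : set 'rV[R]_n :=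
  [set x | forall i, `|x 0 i - ratr (p.1 0 i)| < p.2.+1%:R^-1].

Lemma measurable_rat_box n p : measurable (@rat_box n p).
Proof.
rewrite (_ : rat_box p = \bigcap_(i in [set: 'I_n])
    ((fun x : 'rV[R]_n => `|x 0 i - ratr (p.1 0 i)|) @^-1` `]-oo, p.2.+1%:R^-1[)).
  apply: fin_bigcap_measurable; first exact: finite_finset.
  move=> i _; rewrite -[X in measurable X]setTI.
  suff m : measurable_fun setT (fun x : 'rV[R]_n => `|x 0 i - ratr (p.1 0 i)|) by exact: m.
  apply: measurableT_comp => //; apply: measurable_funB => //.
  exact: measurable_coord.
apply/seteqP; split => x /= h i; first by move=> _; rewrite /= in_itv/=.
by have := h i Logic.I; rewrite /= in_itv.
Qed.

Lemma rat_box_nbhs n (x : 'rV[R]_n) (U : set 'rV[R]_n) : nbhs x U ->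
  exists2 p, rat_box p x & rat_box p `<=` U.
Proof.
move=> /nbhs_ballP[e /= e0 xU].
have [k ke] : exists k : nat, k.+1%:R^-1 < e / 2.
  have e2 : 0 < e / 2 by rewrite divr_gt0.
  exists (Num.truncn (e / 2)^-1); rewrite invf_plt ?posrE//.
  exact: truncnS_gt.
have k0 : 0 < k.+1%:R^-1 :> R by rewrite invr_gt0.
have hq i : exists q : rat, `|x 0 i - ratr q| < k.+1%:R^-1.
  have [|q] := @rat_in_itvoo R (x 0 i - k.+1%:R^-1) (x 0 i + k.+1%:R^-1).
    by rewrite ltrD2l; apply: lt_trans k0; rewrite oppr_lt0.
  by rewrite in_itv/= => /andP[q1 q2]; exists q; rewrite ltr_distlC q1 q2.
have [q qP] := choice hq.
exists (\row_i q i, k) => [i|y yb] /=; first by rewrite mxE.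
apply: xU; split => // i j; rewrite ord1 -ball_normE /ball_/=.
have := yb j; rewrite /= mxE; have := qP j.
have := ler_distD (ratr (q j)) (x 0 j) (y 0 j); rewrite [`|ratr _ - _|]distrC.
by move: ke; move: (k.+1%:R^-1 : R) => r; lra.
Qed.

Lemma open_measurable_row n (U : set 'rV[R]_n) : open U -> measurable U.
Proof.
rewrite openE => oU; apply: (measurable_base (@measurable_rat_box n)) => x /oU.
exact: rat_box_nbhs.
Qed.

Lemma open_measurable_rows m n (U : set ('rV[R]_m * 'rV[R]_n)) :
  open U -> measurable U.
Proof.
rewrite openE => oU.
apply: (@measurable_base _ _ _
    (fun p : ('rV[rat]_m * nat) * ('rV[rat]_n * nat) => rat_box p.1 `*` rat_box p.2)).
  by move=> p; apply: measurableX; exact: measurable_rat_box.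
move=> [x y] /oU [[V W] /= [xV yW] VWU].
have [p px pV] := rat_box_nbhs xV; have [q qy qW] := rat_box_nbhs yW.
by exists (p, q) => // z [/pV ? /qW ?]; exact: VWU.
Qed.

Lemma continuous_measurable_rows m n (f : 'rV[R]_m * 'rV[R]_n -> R) :
  continuous f -> measurable_fun setT f.
Proof.
move=> /continuousP cf; apply: (measurability _ (RGenOInfty.measurableE R)).
move=> _ [_ [a ->] <-]; rewrite setTI; apply: open_measurable_rows.
exact/cf/interval_open.
Qed.

Lemma measurable_boundary n (D : set 'rV[R]_n) : measurable (boundary D).
Proof.
apply: measurableD; last by apply: open_measurable_row; exact: open_interior.
rewrite -[closure D]setCK; apply: measurableC; apply: open_measurable_row.
by apply: closed_openC; exact: closed_closure.
Qed.

Lemma measurable_sphere n : measurable (@sphere R n).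
Proof.
rewrite (_ : sphere n = @enorm R n @^-1` [set 1])//.
by rewrite -[X in measurable X]setTI; exact: measurable_enorm.
Qed.

Definition box n (M : R) : set 'rV[R]_n := [set x | forall i, -M <= x 0 i <= M].

Lemma compact_box n M : compact (@box n M).
Proof.
rewrite (_ : box M = [set v : 'rV[R]_n | forall i, `[-M, M]%classic (v ord0 i)]).
  by apply: (@rV_compact R n (fun=> `[-M, M]%classic)) => i; exact: segment_compact.
by apply/seteqP; split => x /= h i; have := h i; rewrite in_itv.
Qed.

Lemma measurable_box n M : measurable (@box n M).
Proof.
rewrite -[box M]setCK; apply: measurableC; apply: open_measurable_row.
by apply: closed_openC; apply: compact_closed (@compact_box n M); exact: norm_hausdorff.
Qed.

Lemma vol_box n M : (vol n (@box n M) < +oo)%E.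
Proof.
elim: n => [|n IH]; first by rewrite /= diracE ltry.
rewrite /= /vol_step /pushforward.
rewrite (_ : _ @^-1` _ = @box n M `*` (`[- M, M]%classic : set R)); last first.
  apply/seteqP; split => [[x t] /= h|[x t] /= [h]].
    split=> /=; last by have := h ord0; rewrite mxE unlift_none /= in_itv.
    by move=> i; have := h (lift ord0 i); rewrite mxE liftK.
  rewrite in_itv /= => ht i; rewrite mxE.
  by case: unliftP => [j _|_] //=; exact: h.
rewrite product_measure1E//; last exact: measurable_box.
have L : (lebesgue_measure (`[(- M)%R, M]%classic : set R) < +oo)%E.
  by rewrite lebesgue_measure_itv /=; case: ifP; rewrite ?ltry.
by apply: lte_mul_pinfty => //; rewrite ge0_fin_numE.
Qed.

Lemma bounded_box n (K : set 'rV[R]_n) : bounded_set K -> exists M, K `<=` box M.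
Proof.
move=> [M [_ /(_ (M + 1))]]; rewrite ltrDl ltr01 => /(_ isT) h.
exists (M + 1) => x /h /= xM i; rewrite -ler_norml; apply: le_trans xM.
rewrite /Num.norm/= mx_normrE.
by rewrite (bigD1 (0, i))//= le_max lexx.
Qed.

Lemma compact_sub_box n (K : set 'rV[R]_n) : compact K -> exists M, K `<=` box M.
Proof. by move=> /compact_bounded/bounded_box. Qed.

Lemma compact_sub_box_prod m n (K : set ('rV[R]_m * 'rV[R]_n)) : compact K ->
  exists M, K `<=` box M `*` box M.
Proof.
move=> cK.
have [|M1 h1] := @compact_sub_box m (fst @` K).
  by apply: continuous_compact => //; apply: continuous_subspaceT => x; exact: cvg_fst.
have [|M2 h2] := @compact_sub_box n (snd @` K).
  by apply: continuous_compact => //; apply: continuous_subspaceT => x; exact: cvg_snd.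
have M12 : M1 <= Num.max M1 M2 by rewrite le_max lexx.
have M21 : M2 <= Num.max M1 M2 by rewrite le_max lexx orbT.
exists (Num.max M1 M2) => z Kz; split=> i.
  have /h1 /(_ i) : (fst @` K) z.1 by exists z.
  lra.
have /h2 /(_ i) : (snd @` K) z.2 by exists z.
lra.
Qed.

Lemma box_cover n : [set: 'rV[R]_n] = \bigcup_k @box n k%:R.
Proof.
apply/seteqP; split => // x _.
exists (Num.truncn `|x|).+1 => // i; rewrite -ler_norml.
apply: (@le_trans _ _ `|x|); last by rewrite ltW// truncnS_gt.
by rewrite /Num.norm/= mx_normrE (bigD1 (0, i))//= le_max lexx.
Qed.

Lemma compact_finite_sigma_finite n (mu : {measure set 'rV[R]_n -> \bar R}) :
  (forall K, compact K -> (mu K < +oo)%E) -> sigma_finite setT mu.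
Proof.
move=> h; exists (fun k => box k%:R); first exact: box_cover.
by move=> k; split; [exact: measurable_box|apply: h; exact: compact_box].
Qed.

Lemma vol_sigma_finite n : sigma_finite setT (@vol R n).
Proof.
exists (fun k => box k%:R); first exact: box_cover.
by move=> k; split; [exact: measurable_box|exact: vol_box].
Qed.

End row_vectors.

(** * Integral operators on a product space *)

Section sigma_finite_structure.
Context d (T : measurableType d) (R : realType) (mu : {measure set T -> \bar R}).

(* Turns a proof of sigma-finiteness into the structure Fubini's theorem expects. *)
Definition sigma_finite_copy (h : sigma_finite setT mu) : set T -> \bar R := mu.

Section instances.
Variable h : sigma_finite setT mu.
HB.instance Definition _ := isMeasure.Build _ _ _ (sigma_finite_copy h)
  (measure0 mu) (measure_ge0 mu) (@measure_semi_sigma_additive _ _ _ mu).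
HB.instance Definition _ := Measure_isSigmaFinite.Build _ _ _ (sigma_finite_copy h) h.
End instances.

End sigma_finite_structure.

Section kernel_operator.
Context d1 d2 (X : measurableType d1) (Y : measurableType d2) (R : realType).
Variables (m1 : {measure set X -> \bar R}) (s1 : sigma_finite setT m1).
Variables (m2 : {finite_measure set Y -> \bar R}).
Variables (A : set X) (B : set Y).
Hypotheses (mA : measurable A) (mB : measurable B).

Local Notation m12 := (m1 \x m2)%E.

Let mAB : measurable (A `*` B).
Proof. exact: measurableX. Qed.

Lemma ae_product1 (P : X -> Prop) : {ae m1, forall x, P x} ->
  {ae m12, forall z, P z.1}.
Proof.
move=> [N [mN N0 PN]]; exists (N `*` setT); split.
- exact: measurableX.
- by rewrite product_measure1E// N0 mul0e.
- by move=> z nPz; split => //; exact: PN.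
Qed.

Lemma measurable_section (f : X * Y -> R) x : measurable_fun (A `*` B) f -> A x ->
  measurable_fun B (fun w => f (x, w)).
Proof.
move=> /(measurable_restrictT _ mAB) mf Ax.
have := measurableT_comp mf (pair1_measurable x).
move=> /(measurable_funS measurableT (@subsetT _ B)).
by apply: eq_measurable_fun => w /set_mem Bw; rewrite /= patchE mem_set.
Qed.

Lemma L2_sections (f : X * Y -> R) : L2 m12 (A `*` B) f ->
  {ae m1, forall x, A x -> L2 m2 B (fun w => f (x, w))}.
Proof.
move=> /[dup] /(L2P _ mAB)[mf _] /Lfun2_integrable_sqr fi.
have := @ae_integrable1 _ _ _ _ _ (sigma_finite_copy s1) m2 _ fi.
apply: filterS => x /integrableP[_ fx] Ax; apply/(L2P _ mB).
split; first exact: (measurable_section mf).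
apply: le_lt_trans fx; rewrite /sqnorm integral_mkcond.
rewrite le_eqVlt; apply/orP; left; apply/eqP; apply: eq_integral => w _.
rewrite [RHS]gee0_abs; last by rewrite lee_fin sqr_ge0.
rewrite /= !patchE.
have [wB|wB] := boolP (w \in B).
  by rewrite mem_set//=; split => //=; exact: set_mem.
rewrite memNset ?expr0n//= => -[_ /mem_set]; exact/negP.
Qed.

Variables (k : Y -> Y -> R) (M : R).
Hypothesis mk : measurable_fun setT (fun p : Y * Y => k p.1 p.2).
Hypothesis kM : forall y w, `|k y w| <= M.

Definition kop (f : X * Y -> R) (z : X * Y) : R :=
  (\int[m2]_(w in B) (k z.2 w * f (z.1, w)))%R.

(** At [z = (x, y)] the integrand involves [f (x, w)], so it is a function on the triple product.
    Tonelli's theorem is applied to its positive and negative parts separately, which gives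
    measurability without integrability. *)
Lemma measurable_kop f : measurable_fun (A `*` B) f -> measurable_fun (A `*` B) (kop f).
Proof.
move=> /(measurable_restrictT _ mAB) mf.
pose h (p : (X * Y) * Y) : R := (k p.1.2 p.2 * (f \_ (A `*` B)) (p.1.1, p.2)) * \1_B p.2.
have mh : measurable_fun setT h.
  apply: measurable_funM; last first.
    by apply: measurableT_comp measurable_snd; exact: measurable_indic.
  have m1' : measurable_fun setT (fun p : (X * Y) * Y => (p.1.2, p.2)).
    by apply: measurable_fun_pair => //; exact: measurableT_comp measurable_snd measurable_fst.
  have m2' : measurable_fun setT (fun p : (X * Y) * Y => (p.1.1, p.2)).
    by apply: measurable_fun_pair => //; exact: measurableT_comp measurable_fst measurable_fst.
  by apply: measurable_funM; [exact: (measurableT_comp mk m1')|exact: (measurableT_comp mf m2')].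
have mH : measurable_fun setT (fun z => \int[m2]_w (h (z, w))%:E)%E.
  rewrite (_ : (fun z => _) = (fun z =>
    \int[m2]_w (EFin \o h)^\+ (z, w) - \int[m2]_w (EFin \o h)^\- (z, w))%E); last first.
    apply/funext => z; rewrite [LHS]integralE.
    by congr (_ - _)%E; apply: eq_integral => w _; rewrite ?funeposE ?funenegE.
  apply: emeasurable_funB; apply: measurable_fun_fubini_tonelli_F => //.
    by apply: measurable_funepos; exact/measurable_EFinP.
  by apply: measurable_funeneg; exact/measurable_EFinP.
have : measurable_fun setT (fun z => fine (\int[m2]_w (h (z, w))%:E)%E).
  exact: measurableT_comp.
move=> /(measurable_funS measurableT (@subsetT _ (A `*` B))).
apply: eq_measurable_fun => z /set_mem[Az Bz]; rewrite /kop /Rintegral; congr fine.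
rewrite [RHS]integral_mkcond; apply: eq_integral => w _.
rewrite /h/= !patchE indicE; have [wB|wB] := boolP (w \in B); last by rewrite mulr0.
by rewrite mem_set ?mulr1//; split => //; exact: set_mem.
Qed.

Let cB := fine (m2 B).

Lemma kernel_L2 y : L2 m2 B (k y).
Proof.
have l1 : L2 m2 B (cst 1).
  apply/(L2P _ mB); split; first exact: measurable_cst.
  rewrite /sqnorm; under eq_integral do rewrite /= expr1n.
  by rewrite integral_cst// mul1e; rewrite -ge0_fin_numE// fin_num_measure.
have M0 : 0 <= M by apply: le_trans (kM y y).
apply: (@L2_le _ _ _ _ _ mB (M *: (cst 1 : Y -> R) + 0)).
- have : measurable_fun setT (k y).
    exact: (measurableT_comp mk (pair1_measurable y)).
  exact: measurable_funS.
- by apply: L2_linear => //; exact: L2_0.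
- by move=> w _; rewrite fct_linE mulr1 addr0 (ger0_norm M0).
Qed.

Lemma kop_section f z : L2 m2 B (fun w => f (z.1, w)) ->
  kop f z ^+ 2 <= M ^+ 2 * cB * inner m2 B (fun w => f (z.1, w)) (fun w => f (z.1, w)).
Proof.
move=> fz.
have lk := kernel_L2 z.2.
have -> : kop f z = inner m2 B (k z.2) (fun w => f (z.1, w)) by [].
apply: le_trans (@cauchy_schwarz_sqr _ _ (L2Hilbert m2 mB) _ _ lk fz) _.
rewrite ler_wpM2r ?inner_ge0//.
rewrite -lee_fin -sqnormE// /sqnorm.
have -> : (M ^+ 2 * cB)%:E = (\int[m2]_(w in B) (M ^+ 2)%:E)%E.
  by rewrite integral_cst// EFinM fineK// fin_num_measure.
apply: ge0_le_integral => //.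
- by move=> w _; rewrite lee_fin sqr_ge0.
- by apply/measurable_EFinP/measurable_funX; exact: (L2_measurable mB lk).
- move=> w _; rewrite lee_fin -real_normK ?num_real// ler_pXn2r ?nnegrE//.
  exact: le_trans (kM z.2 z.2).
Qed.

Lemma section_integralE (f : X * Y -> \bar R) x : A x ->
  fubini_F m2 (f \_ (A `*` B)) x = (\int[m2]_(w in B) f (x, w))%E.
Proof.
move=> Ax; rewrite [RHS]integral_mkcond; apply: eq_integral => w _; rewrite !patchE.
have [wB|wB] := boolP (w \in B); first by rewrite mem_set//; split => //; exact: set_mem.
by rewrite memNset// => -[_ /mem_set]; exact/negP.
Qed.

Lemma restrict_ge0 (f : X * Y -> \bar R) : (forall z, (0 <= f z)%E) ->
  forall z, (0 <= (f \_ (A `*` B)) z)%E.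
Proof. by move=> f0 z; rewrite patchE; case: ifP. Qed.

Lemma measurable_section_integral (f : X * Y -> \bar R) :
  measurable_fun (A `*` B) f -> (forall z, (0 <= f z)%E) ->
  measurable_fun A (fun x => \int[m2]_(w in B) f (x, w))%E.
Proof.
move=> /(measurable_restrictT _ mAB) mf f0.
have := measurable_fun_fubini_tonelli_F (m2 := m2) _ mf (restrict_ge0 f0).
move=> /(measurable_funS measurableT (@subsetT _ A)).
by apply: eq_measurable_fun => x /set_mem; exact: section_integralE.
Qed.

Lemma tonelli_product (f : X * Y -> \bar R) : measurable_fun (A `*` B) f ->
  (forall z, (0 <= f z)%E) ->
  (\int[m12]_(z in A `*` B) f z = \int[m1]_(x in A) \int[m2]_(w in B) f (x, w))%E.
Proof.
move=> /(measurable_restrictT _ mAB) mf f0.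
rewrite [LHS]integral_mkcond.
have E : (\int[m1 \x m2]_z (f \_ (A `*` B)) z =
    \int[m1]_x fubini_F m2 (f \_ (A `*` B)) x)%E.
  exact: (@fubini_tonelli1 _ _ _ _ _ (sigma_finite_copy s1) m2 _ mf (restrict_ge0 f0)).
rewrite [LHS]E.
rewrite [RHS]integral_mkcond; apply: eq_integral => x _.
rewrite [in RHS]patchE; case: ifPn => [/set_mem Ax|xA]; first exact: section_integralE.
apply: integral0_eq => w _; rewrite patchE memNset// => -[/mem_set] /=.
by move: xA => /negP.
Qed.

(** Cauchy-Schwarz in the integration variable bounds the square of [kop f] at a point by
    [M ^+ 2 * cB] times the integral of the square of [f] over the section; integrating over the
    second variable contributes the other factor [cB]. *)
Lemma kop_bound f : L2 m12 (A `*` B) f -> L2 m12 (A `*` B) (kop f) /\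
  inner m12 (A `*` B) (kop f) (kop f) <= (M * cB) ^+ 2 * inner m12 (A `*` B) f f.
Proof.
move=> lf; have mf := L2_measurable mAB lf.
have mK := measurable_kop mf.
have cB0 : 0 <= cB by rewrite fine_ge0.
have key : (sqnorm m12 (A `*` B) (kop f) <=
    ((M * cB) ^+ 2)%:E * sqnorm m12 (A `*` B) f)%E.
  rewrite /sqnorm -ge0_integralZl_EFin ?sqr_ge0//; last 2 first.
  - by move=> z _; rewrite lee_fin sqr_ge0.
  - by apply/measurable_EFinP; exact: measurable_funX.
  rewrite !tonelli_product//; last 4 first.
  - by apply: measurable_funeM; apply/measurable_EFinP; exact: measurable_funX.
  - by move=> z; rewrite mule_ge0 ?lee_fin ?sqr_ge0.
  - by apply/measurable_EFinP; exact: measurable_funX.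
  - by move=> z; rewrite lee_fin sqr_ge0.
  have f20 z : (0 <= ((f z) ^+ 2)%:E)%E by rewrite lee_fin sqr_ge0.
  have mf2 : measurable_fun (A `*` B) (fun z => ((f z) ^+ 2)%:E).
    by apply/measurable_EFinP; exact: measurable_funX.
  apply: ae_ge0_le_integral => //.
  - by move=> x _; apply: integral_ge0 => w _; rewrite lee_fin sqr_ge0.
  - apply: (@measurable_section_integral (fun z => ((kop f z) ^+ 2)%:E)).
      by apply/measurable_EFinP; exact: measurable_funX.
    by move=> z; rewrite lee_fin sqr_ge0.
  - by move=> x _; apply: integral_ge0 => w _; rewrite mule_ge0 ?lee_fin ?sqr_ge0.
  - apply: (@measurable_section_integral (fun z => ((M * cB) ^+ 2)%:E * ((f z) ^+ 2)%:E)%E).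
      exact: measurable_funeM.
    by move=> z; rewrite mule_ge0 ?lee_fin ?sqr_ge0.
  have := L2_sections lf; apply: filterS => x + Ax => /(_ Ax) lx.
  pose G := inner m2 B (fun w => f (x, w)) (fun w => f (x, w)).
  have mx2 : measurable_fun B (fun w => ((f (x, w)) ^+ 2)%:E).
    by apply/measurable_EFinP/measurable_funX; exact: (L2_measurable mB lx).
  rewrite ge0_integralZl_EFin ?sqr_ge0//.
  have := sqnormE mB lx; rewrite /sqnorm => ->; rewrite -/G.
  have -> : (((M * cB) ^+ 2)%:E * G%:E = \int[m2]_(w in B) (M ^+ 2 * cB * G)%:E)%E.
    have E : m2 B = cB%:E by rewrite fineK// fin_num_measure.
    by rewrite integral_cst// [X in _ = (_ * X)%E]E -!EFinM; congr EFin; ring.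
  apply: ge0_le_integral => //.
  - by move=> w _; rewrite lee_fin sqr_ge0.
  - apply: measurableT_comp => //; apply: measurable_funX; exact: (measurable_section mK Ax).
  - by move=> w _; rewrite lee_fin; exact: kop_section.
have LK : L2 m12 (A `*` B) (kop f).
  apply/(L2P _ mAB); split=> //; apply: le_lt_trans key _.
  by rewrite (sqnormE mAB lf) -EFinM ltry.
by split => //; rewrite -lee_fin EFinM -!sqnormE.
Qed.

(** Only almost everywhere: additivity of the integral uses that the sections of [f] and [g] are
    square integrable, which holds for almost every [x]. *)
Lemma kop_linear a f g : L2 m12 (A `*` B) f -> L2 m12 (A `*` B) g ->
  ae_on m12 (A `*` B) (fun z => kop (a *: f + g) z = a * kop f z + kop g z).
Proof.
move=> lf lg; have := ae_product1 (L2_sections lg).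
have := ae_product1 (L2_sections lf).
rewrite /ae_on; apply: filterS2 => -[x y] /= lx ly [/= Ax _].
have lk := kernel_L2 y.
have -> : kop f (x, y) = inner m2 B (k y) (fun w => f (x, w)) by [].
have -> : kop g (x, y) = inner m2 B (k y) (fun w => g (x, w)) by [].
have -> : kop (a *: f + g) (x, y) =
  inner m2 B (k y) (a *: (fun w => f (x, w)) + (fun w => g (x, w))) by [].
rewrite innerC innerP ?(innerC _ _ (k y))//; [exact: lx|exact: ly].
Qed.

End kernel_operator.

(** * C1 functions and Green's formula on phase space *)

Section C1_functions.
Context {R : realType}.

Lemma C1_continuous (V : normedModType R) (f : V -> R) : C1 f -> continuous f.
Proof. by move=> [df _] x; exact: differentiable_continuous. Qed.

Lemma C1_derivable (V : normedModType R) (f : V -> R) x v : C1 f -> derivable f x v.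
Proof. by move=> [df _]; exact: diff_derivable. Qed.

Lemma C1_linear (V : normedModType R) a (f g : V -> R) : C1 f -> C1 g -> C1 (a *: f + g).
Proof.
move=> Cf Cg; split.
  move=> x; apply: differentiableD; last exact: Cg.1.
  by apply: differentiableZ; exact: Cf.1.
move=> v; rewrite (_ : (fun x => _) = (fun x => a * 'D_v f x + 'D_v g x)).
  move=> x; apply: cvgD; last exact: Cg.2.
  by apply: cvgM; [exact: cvg_cst|exact: Cf.2].
apply/funext => x; rewrite deriveD; last 2 first.
- by apply: derivableZ; exact: C1_derivable.
- exact: C1_derivable.
by rewrite deriveZ//; exact: C1_derivable.
Qed.

Lemma derive_linear (V : normedModType R) a (f g : V -> R) x v : C1 f -> C1 g ->
  'D_v (a *: f + g) x = a * 'D_v f x + 'D_v g x.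
Proof.
move=> Cf Cg; rewrite deriveD; last 2 first.
- by apply: derivableZ; exact: C1_derivable.
- exact: C1_derivable.
by rewrite deriveZ//; exact: C1_derivable.
Qed.

Lemma derive_sqr (V : normedModType R) (f : V -> R) x v : C1 f ->
  'D_v (f * f) x = 2 * (f x * 'D_v f x).
Proof.
move=> Cf; rewrite deriveM; try exact: C1_derivable.
rewrite /GRing.scale/=; ring.
Qed.

Lemma C1_sqr (V : normedModType R) (f : V -> R) : C1 f -> C1 (f * f).
Proof.
move=> Cf; split.
  by move=> x; apply: differentiableM; exact: Cf.1.
move=> v; rewrite (_ : (fun x => _) = (fun x => 2 * (f x * 'D_v f x))).
  move=> x; apply: cvgM; first exact: cvg_cst.
  by apply: cvgM; [exact: (C1_continuous Cf)|exact: Cf.2].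
by apply/funext => x; exact: derive_sqr.
Qed.

Lemma supported_derive (V : normedModType R) (K : set V) (f : V -> R) v :
  compact K -> supported_in K f -> supported_in K (fun x => 'D_v f x).
Proof.
move=> cK fK x nKx; rewrite (@near_eq_derive _ _ _ f (cst 0)).
  by rewrite derive_cst.
have : open (~` K) by apply: closed_openC; apply: compact_closed cK; exact: norm_hausdorff.
rewrite openE => /(_ x nKx); apply: filterS => y; exact: fK.
Qed.

Lemma C1c_linear (V : normedModType R) a (f g : V -> R) : C1c f -> C1c g -> C1c (a *: f + g).
Proof.
move=> [Cf [K cK fK]] [Cg [K' cK' gK']]; split; first exact: C1_linear.
exists (K `|` K'); first exact: compactU.
move=> x nKx; rewrite fct_linE fK ?gK' ?mulr0 ?addr0//.
  by move=> ?; apply: nKx; right.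
by move=> ?; apply: nKx; left.
Qed.

Lemma C1c_sqr (V : normedModType R) (f : V -> R) : C1c f -> C1c (f * f).
Proof.
move=> [Cf [K cK fK]]; split; first exact: C1_sqr.
by exists K => // x nKx; rewrite [(f * f) x](_ : _ = f x * f x)// fK// mulr0.
Qed.

Lemma compact_support_bounded (V : normedModType R) (K : set V) (f : V -> R) :
  continuous f -> compact K -> supported_in K f -> exists2 M, 0 <= M & forall x, `|f x| <= M.
Proof.
move=> cf cK fK.
have /compact_bounded[M [_ /(_ (`|M| + 1))]] : compact (f @` K).
  by apply: continuous_compact cK; exact: continuous_subspaceT.
have -> : M < `|M| + 1 by have := ler_norm M; lra.
move=> /(_ isT) fM; exists (`|M| + 1) => [|x]; first by rewrite addr_ge0.
have [Kx|nKx] := pselect (K x); first by apply: fM; exists x.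
by rewrite fK// normr0 addr_ge0.
Qed.

End C1_functions.

Section streaming_derivative.
Context {R : realType} {d : nat}.
Local Notation point := ('rV[R]_d * 'rV[R]_d)%type.
Implicit Types phi psi : point -> R.

(** [C1] gives continuity of derivatives in fixed directions, whereas the streaming direction moves
    with [z]; expanding it in coordinate directions reduces to the fixed ones. *)
Lemma streamingE phi z : C1 phi ->
  streaming phi z = \sum_(i < d) z.2 0 i * 'D_((delta_mx 0 i, 0)) phi z.
Proof.
move=> Cphi; rewrite /streaming deriveE; last exact: Cphi.1.
rewrite {1}(_ : (z.2, 0) = \sum_(i < d) z.2 0 i *: (delta_mx 0 i, 0) :> point); last first.
  suff -> : \sum_(i < d) z.2 0 i *: (delta_mx 0 i, 0) =
      (\sum_(i < d) z.2 0 i *: delta_mx 0 i, 0) :> point by rewrite -row_sum_delta.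
  elim/big_rec2 : _ => // i a b _ ->.
  by apply: injective_projections => //=; rewrite scaler0 addr0.
rewrite linear_sum; apply: eq_bigr => i _.
by rewrite linearZ/= deriveE//; exact: Cphi.1.
Qed.

Lemma streaming_continuous phi : C1 phi -> continuous (streaming phi).
Proof.
move=> Cphi; rewrite (_ : streaming phi =
    (fun z => \sum_(i < d) z.2 0 i * 'D_((delta_mx 0 i, 0)) phi z)).
  apply: continuous_big => [|i _ z]; first exact: add_continuous.
  apply: cvgM; last exact: Cphi.2.
  apply: (@cvg_comp _ _ _ snd (fun x : 'rV[R]_d => x 0 i)).
    exact: cvg_snd.
  exact: coord_continuous.
by apply/funext => z; exact: streamingE.
Qed.

Lemma streaming_linear a phi psi : C1 phi -> C1 psi ->
  streaming (a *: phi + psi) = a *: streaming phi + streaming psi.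
Proof. by move=> Cf Cg; apply/funext => z; rewrite /streaming derive_linear. Qed.

Lemma streaming_sqr phi z : C1 phi ->
  streaming (phi * phi) z = 2 * (phi z * streaming phi z).
Proof. by move=> Cf; exact: derive_sqr. Qed.

Lemma supported_streaming K phi : compact K -> supported_in K phi ->
  supported_in K (streaming phi).
Proof. by move=> cK phiK z nKz; exact: (supported_derive _ cK phiK). Qed.

Lemma derive_slice phi w v x : 'D_v (fun x => phi (x, w)) x = 'D_((v, 0)) phi (x, w).
Proof.
rewrite /derive; set F := (fun h : R => _); set G := (fun h : R => _).
suff -> : F = G by [].
apply/funext => h; rewrite /F /G /=; congr (_ *: (phi _ - _)).
by apply: injective_projections => //=; rewrite scaler0 add0r.
Qed.

Lemma C1c_slice phi w : C1c phi -> C1c (fun x => phi (x, w)).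
Proof.
move=> [Cphi [K cK phiK]].
have dpair x : differentiable (fun x : 'rV[R]_d => (x, w) : point) x.
  exact: differentiable_pair.
have cpair x := differentiable_continuous (dpair x).
split; first split.
- by move=> x; apply: (differentiable_comp (dpair x)); exact: Cphi.1.
- move=> v; rewrite (_ : (fun x => _) = (fun x => 'D_((v, 0)) phi (x, w))).
    by move=> x; exact: (continuous_comp (cpair x) (Cphi.2 (v, 0) (x, w))).
  by apply/funext => x; exact: derive_slice.
exists (fst @` K).
  by apply: continuous_compact cK; apply: continuous_subspaceT => x; exact: cvg_fst.
move=> x nx; apply: phiK => Kx; apply: nx; by exists (x, w).
Qed.

End streaming_derivative.

Section bounded_support.
Context d (T : measurableType d) (R : realType).
Variables (mu : {measure set T -> \bar R}) (A E : set T) (f : T -> R) (M : R).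
Hypotheses (mA : measurable A) (mE : measurable E) (muE : (mu E < +oo)%E).
Hypotheses (mf : measurable_fun A f) (fM : forall z, A z -> `|f z| <= M).
Hypothesis fE : forall z, A z -> ~ E z -> f z = 0.

Let indic_L2 : L2 mu A (\1_E : T -> R).
Proof.
apply/(L2P _ mA); split.
  by apply: measurable_funS measurableT _ _ => //; exact: measurable_indic.
rewrite /sqnorm; under eq_integral => z _.
  rewrite (_ : \1_E z ^+ 2 = \1_E z :> R).
    over.
  by rewrite indicE; case: (_ \in _); rewrite ?expr1n ?expr0n.
rewrite integral_indic//; apply: le_lt_trans muE; apply: le_measure; rewrite ?inE//.
exact: measurableI.
Qed.

Lemma bounded_support_L2 : L2 mu A f.
Proof.
apply: (@L2_le _ _ _ mu A mA (M *: (\1_E : T -> R) + 0)) => //.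
  by apply: L2_linear => //; exact: L2_0.
move=> z Az; rewrite fct_linE addr0; have [Ez|nEz] := pselect (E z).
  by rewrite indicE mem_set// mulr1; apply: le_trans (fM Az) (ler_norm _).
by rewrite fE// normr0.
Qed.

(** On [A] the function equals its product with [\1_E], hence a product of two elements of L2. *)
Lemma bounded_support_integrable : mu.-integrable A (EFin \o f).
Proof.
have := L2_mul_integrable mA bounded_support_L2 indic_L2.
apply: eq_integrable => // z /set_mem Az /=.
have [Ez|nEz] := pselect (E z); first by rewrite indicE mem_set// mulr1.
by rewrite fE// mul0r.
Qed.

End bounded_support.

Section fubini_product.
Context d1 d2 (X : measurableType d1) (Y : measurableType d2) (R : realType).
Variables (m1 : {measure set X -> \bar R}) (m2 : {sigma_finite_measure set Y -> \bar R}).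
Hypothesis s1 : sigma_finite setT m1.
Variables (A : set X) (B : set Y).
Hypotheses (mA : measurable A) (mB : measurable B).

Let mAB : measurable (A `*` B).
Proof. exact: measurableX. Qed.

(** The direction is made the outer variable, because Gauss-Green in [D] is applied at each fixed
    direction. *)
Lemma Rintegral_product (f : X * Y -> R) :
  (m1 \x m2)%E.-integrable (A `*` B) (EFin \o f) ->
  (\int[(m1 \x m2)%E]_(z in A `*` B) f z =
   \int[m2]_(y in B) \int[m1]_(x in A) f (x, y))%R.
Proof.
move=> /(integrable_mkcond _ mAB) fi.
pose F := (EFin \o f) \_ (A `*` B).
pose m1' : {sigma_finite_measure set X -> \bar R} := sigma_finite_copy s1.
have GE y : B y -> fubini_G m1 F y = (\int[m1]_(x in A) (f (x, y))%:E)%E.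
  move=> By; rewrite [RHS]integral_mkcond; apply: eq_integral => x _; rewrite /F !patchE.
  have [xA|xA] := boolP (x \in A); first by rewrite mem_set//; split => //; exact: set_mem.
  by rewrite memNset// => -[/mem_set + _]; exact/negP.
have GE0 y : ~ B y -> fubini_G m1 F y = 0%E.
  by move=> nBy; apply: integral0_eq => x _; rewrite /F patchE memNset// => -[].
have mG : measurable_fun setT (fubini_G m1 F) := @measurable_fubini_G _ _ _ _ _ m1' m2 _ fi.
rewrite /Rintegral integral_mkcond.
have /= <- := @integral21_prod_meas1 _ _ _ _ _ m1' m2 _ fi.
congr fine; rewrite [RHS]integral_mkcond.
have E y : ((fun y => (fine (\int[m1]_(x in A) (f (x, y))%:E))%:E) \_ B) y =
    (fine (fubini_G m1 F y))%:E.
  rewrite patchE; case: ifPn => [/set_mem By|yB]; first by rewrite GE.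
  by rewrite GE0// => /mem_set; exact/negP.
apply: ae_eq_integral => //.
  rewrite (_ : _ \_ _ = EFin \o (fine \o fubini_G m1 F)); last by apply/funext.
  by apply: measurableT_comp => //; exact: measurableT_comp.
have := @ae_integrable2 _ _ _ _ _ m1' m2 _ fi; apply: filterS => y fy _.
by rewrite E fineK//; exact: (@integrable_fin_num _ _ _ m1' _ measurableT).
Qed.

End fubini_product.

Section phase_space.
Context {R : realType} {d : nat}.
Variables (D : set 'rV[R]_d) (dS : {measure set 'rV[R]_d -> \bar R}).
Variable n : 'rV[R]_d -> 'rV[R]_d.
Hypotheses (oD : open D) (hn : is_outward_unit_normal D dS n).
Local Notation point := ('rV[R]_d * 'rV[R]_d)%type.
Local Notation W := (W D).
Local Notation dW := (@dW R d).
Local Notation dG := (dG dS).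
Local Notation Gamma := (Gamma D n).
Implicit Types (phi psi f h : point -> R) (s : R).

Lemma measurable_D : measurable D.
Proof. exact: open_measurable_row. Qed.

Lemma measurable_W : measurable W.
Proof. by apply: measurableX; [exact: measurable_D|exact: measurable_sphere]. Qed.

Lemma measurable_normal : measurable_fun setT n.
Proof. by case: hn. Qed.

Lemma measurable_normal_dot : measurable_fun setT (fun z : point => dot (n z.1) z.2).
Proof.
apply: measurable_sum => i; apply: measurable_funM.
  apply: (measurableT_comp (measurable_coord 0 i)).
  exact: measurableT_comp measurable_normal measurable_fst.
exact: (measurableT_comp (measurable_coord 0 i) measurable_snd).
Qed.

Lemma measurable_boundary_sphere : measurable (boundary D `*` @sphere R d).
Proof. by apply: measurableX; [exact: measurable_boundary|exact: measurable_sphere]. Qed.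

Lemma measurable_Gamma s : measurable (Gamma s).
Proof.
rewrite (_ : Gamma s = (boundary D `*` @sphere R d) `&`
    ((fun z : point => s * dot (n z.1) z.2) @^-1` `]0, +oo[)).
  apply: measurableI; first exact: measurable_boundary_sphere.
  rewrite -[X in measurable X]setTI.
  have m : measurable_fun setT (fun z : point => s * dot (n z.1) z.2).
    by apply: measurable_funM => //; exact: measurable_normal_dot.
  exact: m.
apply/seteqP; split => z /=; first by move=> [? ? ?]; rewrite in_itv/= andbT.
by rewrite in_itv/= andbT => -[[? ?] ?].
Qed.

Lemma measurable_flux A h : measurable_fun A h -> measurable_fun A (flux n h).
Proof.
move=> mh; apply: measurable_funM => //.
apply: (@measurable_funS _ _ _ _ setT) => //.
rewrite (_ : (fun z : point => _) =
    (fun z : point => `|dot (n z.1) z.2| `^ 2^-1)).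
  have m : measurable_fun setT (fun z : point => `|dot (n z.1) z.2|).
    by apply: measurableT_comp => //; exact: measurable_normal_dot.
  exact: (measurableT_comp (measurable_powR _) m).
by apply/funext => z; rewrite powR12_sqrt.
Qed.

Lemma dot_unit_le1 (x y : 'rV[R]_d) : enorm x = 1 -> enorm y = 1 -> `|dot x y| <= 1.
Proof.
have sq z : enorm z = 1 -> dot z z = 1 :> R.
  by move=> z1; rewrite -[LHS]sqr_sqrtr ?dot_ge0// -/(enorm z) z1 expr1n.
move=> /sq x1 /sq y1.
have H (a : R) : a ^+ 2 = 1 -> 0 <= 2 + 2 * a * dot x y.
  move=> a1; have := dot_ge0 (x + a *: y).
  suff -> : dot (x + a *: y) (x + a *: y) = dot x x + 2 * a * dot x y + a ^+ 2 * dot y y.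
    by rewrite x1 y1 a1; lra.
  rewrite /dot !mulr_sumr -!big_split/=; apply: eq_bigr => i _; rewrite !mxE; ring.
have := H 1 (expr1n _ _); have := H (-1); rewrite sqrrN expr1n => /(_ erefl).
by move=> h1 h2; rewrite ler_norml; apply/andP; split; lra.
Qed.

Lemma normal_dot_le1 z : (boundary D `*` @sphere R d) z -> `|dot (n z.1) z.2| <= 1.
Proof. by move=> [bz sz]; apply: dot_unit_le1 => //; case: hn => _ + _ _; exact. Qed.

Lemma dW_box M : (dW (box M `*` setT) < +oo)%E.
Proof.
have -> : dW (box M `*` setT) = (vol d (box M) * @sphere_measure R d setT)%E.
  by apply: product_measure1E => //; exact: measurable_box.
by apply: lte_mul_pinfty => //; rewrite ?ge0_fin_numE ?vol_box// -ge0_fin_numE ?fin_num_measure.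
Qed.

Lemma dG_box M : (dG (box M `*` setT) < +oo)%E.
Proof.
have -> : dG (box M `*` setT) = (dS (box M) * @sphere_measure R d setT)%E.
  by apply: product_measure1E => //; exact: measurable_box.
have K : (dS (box M) < +oo)%E by case: hn => _ _ + _; apply; exact: compact_box.
by apply: lte_mul_pinfty => //; rewrite ?ge0_fin_numE// -ge0_fin_numE ?fin_num_measure.
Qed.

Lemma dS_sigma_finite : sigma_finite setT dS.
Proof. by apply: compact_finite_sigma_finite; case: hn. Qed.

Lemma compact_support_box K f : continuous f -> compact K -> supported_in K f ->
  exists M N, [/\ measurable_fun setT f, forall z, `|f z| <= M &
    forall z, ~ (box N `*` setT) z -> f z = 0].
Proof.
move=> cf cK fK; have [M M0 fM] := compact_support_bounded cf cK fK.
have [N KN] := compact_sub_box_prod cK; exists M, N; split => //.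
  exact: continuous_measurable_rows.
by move=> z nz; apply: fK => /KN[? ?]; exact: nz.
Qed.

Let mbox N : measurable (@box R d N `*` [set: 'rV[R]_d]).
Proof. by apply: measurableX => //; exact: measurable_box. Qed.

Lemma compact_support_L2W K f : continuous f -> compact K -> supported_in K f ->
  L2 dW W f /\ dW.-integrable W (EFin \o f).
Proof.
move=> cf cK fK; have [M [N [mf fM fN]]] := compact_support_box cf cK fK.
have mfW : measurable_fun W f by apply: measurable_funS mf.
by split; [apply: (bounded_support_L2 _ (mbox N) (dW_box N))|
  apply: (bounded_support_integrable _ (mbox N) (dW_box N))]; eauto; exact: measurable_W.
Qed.

Lemma flux_le h z : (boundary D `*` @sphere R d) z -> `|flux n h z| <= `|h z|.
Proof.
move=> bz; rewrite normrM ler_piMr// ger0_norm ?sqrtr_ge0//.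
by rewrite -sqrtr1 ler_wsqrtr// normal_dot_le1.
Qed.

Lemma Gamma_sub s : Gamma s `<=` boundary D `*` @sphere R d.
Proof. by move=> z []. Qed.

Lemma compact_support_L2G s K f : continuous f -> compact K -> supported_in K f ->
  L2G D dS n s f.
Proof.
move=> cf cK fK; have [M [N [mf fM fN]]] := compact_support_box cf cK fK.
apply: (bounded_support_L2 (measurable_Gamma s) (mbox N) (dG_box N) (M := M)).
- by apply: measurable_flux; apply: measurable_funS mf.
- by move=> z /Gamma_sub bz; apply: le_trans (flux_le f bz) (fM z).
- by move=> z _ /fN; rewrite /flux => ->; rewrite mul0r.
Qed.

Lemma C1c_L2W phi : C1c phi -> L2 dW W phi.
Proof.
by move=> [/C1_continuous cphi [K cK phiK]]; have [] := compact_support_L2W cphi cK phiK.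
Qed.

Lemma C1c_streaming_L2W phi : C1c phi -> L2 dW W (streaming phi).
Proof.
move=> [/streaming_continuous cphi [K cK phiK]].
by have [] := compact_support_L2W cphi cK (supported_streaming cK phiK).
Qed.

Lemma C1c_L2G s phi : C1c phi -> L2G D dS n s phi.
Proof. by move=> [/C1_continuous cphi [K cK phiK]]; exact: compact_support_L2G phiK. Qed.

Lemma flux_sqr h z : flux n h z * flux n h z = h z * h z * `|dot (n z.1) z.2|.
Proof. by rewrite /flux mulrACA; congr (_ * _); rewrite -expr2 sqr_sqrtr. Qed.

Lemma gauss_green_phase psi : C1c psi ->
  (\int[dW]_(z in W) streaming psi z =
   \int[dG]_(z in boundary D `*` sphere d) (psi z * dot (n z.1) z.2))%R.
Proof.
move=> Cpsi; have [C1psi [K cK psiK]] := Cpsi; have cpsi := C1_continuous C1psi.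
have [_ iS] := compact_support_L2W (streaming_continuous C1psi) cK (supported_streaming cK psiK).
have [M [N [mf fM fN]]] := compact_support_box cpsi cK psiK.
have iG : dG.-integrable (boundary D `*` sphere d)
    (EFin \o (fun z => psi z * dot (n z.1) z.2)).
  apply: (bounded_support_integrable measurable_boundary_sphere (mbox N) (dG_box N) (M := M)).
  - apply: measurable_funM; first exact: measurable_funS mf.
    by apply: measurable_funS measurable_normal_dot.
  - move=> z bz; rewrite normrM; apply: le_trans (fM z).
    by rewrite ler_piMr// normal_dot_le1.
  - by move=> z _ /fN ->; rewrite mul0r.
have -> := Rintegral_product (vol_sigma_finite d) measurable_D (@measurable_sphere R d) iS.
have -> := @Rintegral_product _ _ _ _ R dS (@sphere_measure R d) dS_sigma_finite _ _
  (measurable_boundary D) (@measurable_sphere R d) _ iG.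
apply: eq_Rintegral => w _ /=; case: hn => _ _ _ /(_ _ w (C1c_slice w Cpsi)) <-.
by apply: eq_Rintegral => x _; rewrite derive_slice.
Qed.

(** Gauss-Green for [phi * phi], whose streaming derivative is twice the product of [phi] and
    [streaming phi]. The sign of n . omega splits the boundary integral into outflow minus inflow,
    and the grazing directions, where n . omega is 0, contribute nothing. *)
Lemma green_formula phi : C1c phi ->
  2 * inner dW W phi (streaming phi) = innerG D dS n 1 phi phi - innerG D dS n (-1) phi phi.
Proof.
move=> Cphi; have C1phi := Cphi.1.
have iG s : dG.-integrable setT (EFin \o ((flux n phi \* flux n phi) \_ (Gamma s))).
  rewrite -restrict_EFin; apply/(integrable_mkcond _ (measurable_Gamma s)).
  by apply: L2_mul_integrable; [exact: measurable_Gamma|exact: C1c_L2G|exact: C1c_L2G].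
rewrite /innerG /inner -RintegralZl; last 2 first.
- exact: measurable_W.
- by apply: L2_mul_integrable; [exact: measurable_W|exact: C1c_L2W|exact: C1c_streaming_L2W].
under eq_Rintegral => z _ do rewrite -streaming_sqr//.
rewrite gauss_green_phase; last exact: C1c_sqr.
rewrite Rintegral_mkcond [X in _ = X - _]Rintegral_mkcond [X in _ = _ - X]Rintegral_mkcond.
rewrite -RintegralB//; apply: eq_Rintegral => z _.
rewrite !patchE /= !flux_sqr.
have [bz|nbz] := pselect ((boundary D `*` sphere d) z); last first.
  by rewrite !memNset ?subrr// => /Gamma_sub.
rewrite mem_set//; have [zp|zn|z0] := ltrgt0P (dot (n z.1) z.2).
- rewrite mem_set; last by case: bz => ? ?; split => //; rewrite mul1r.
  by rewrite memNset ?subr0// => -[_ _]; rewrite mulN1r oppr_gt0 ltNge ltW.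
- rewrite memNset; last by move=> -[_ _]; rewrite mul1r ltNge ltW.
  rewrite mem_set; last by case: bz => ? ?; split => //; rewrite mulN1r oppr_gt0.
  by rewrite sub0r mulrN opprK.
- by rewrite z0 !mulr0 !memNset ?subrr// => -[_ _]; rewrite z0 mulr0 ltxx.
Qed.

End phase_space.

(** * Function spaces of the transport problem *)

Section sequential_closure.
Context (R : realType) (X : lmodType R) (H : semiHilbert X) (S : X -> Prop).
Hypothesis SH : forall x, S x -> H x.
Hypothesis SP : forall a x y, S x -> S y -> S (a *: x + y).

(** A sequential closure, because [is_trace] is stated with approximating sequences. It is closed in
    turn: from the sequence approximating the k-th point one picks a term with error below
    1/(k+1). *)
Definition hcl x := H x /\ exists2 u : nat -> X, (forall k, S (u k)) & hcvg H u x.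

Lemma hcl_linear a x y : hcl x -> hcl y -> hcl (a *: x + y).
Proof.
move=> [hx [u Su ux]] [hy [v Sv vy]]; split; first exact: hdomP.
by exists (fun k => a *: u k + v k) => [k|]; [exact: SP|apply: hcvgZD => // k; exact: SH].
Qed.

Lemma hcl_closed u x : (forall k, hcl (u k)) -> H x -> hcvg H u x -> hcl x.
Proof.
move=> cu hx ux; have hu k := (cu k).1.
have h k : exists s, S s /\ hnorm H (s - u k) < k.+1%:R^-1.
  have [_ [v Sv /hcvgP]] := cu k.
  move=> /(_ (fun j => SH (Sv j)) (hu k) k.+1%:R^-1); rewrite invr_gt0 ltr0n => /(_ isT) [N NP].
  by exists (v N); split => //; exact: NP.
have [s sP] := choice h; split => //; exists s => [k|]; first by have [] := sP k.
have hs k : H (s k) by apply: SH; have [] := sP k.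
apply/(hcvg_hnorm hs hx); move/(hcvg_hnorm hu hx) : ux => ux.
apply: (@squeeze_cvgr _ _ _ _ (cst 0) (fun k => k.+1%:R^-1 + hnorm H (u k - x))); last 2 first.
- exact: cvg_cst.
- by rewrite -[X in _ --> X]addr0; apply: cvgD => //; exact: cvg_harmonic.
near=> k; rewrite hnorm_ge0/=; apply: le_trans (hdistD (hs k) (hu k) hx) _.
by rewrite lerD2r; have [_ /ltW] := sP k.
Unshelve. all: by end_near.
Qed.

End sequential_closure.

Section null_vectors.
Context (R : realType) (X : lmodType R) (H : semiHilbert X).
Implicit Types x y z : X.

Lemma ip_null x y : H x -> H y -> hnorm H x = 0 -> ip H x y = 0.
Proof.
move=> hx hy x0; apply/eqP; rewrite -normr_le0.
by apply: le_trans (cauchy_schwarz hx hy) _; rewrite x0 mul0r.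
Qed.

Lemma ip_congr x x' y : H x -> H x' -> H y -> hnorm H (x - x') = 0 ->
  ip H x y = ip H x' y.
Proof.
move=> hx hx' hy e; apply/eqP; rewrite -subr_eq0 -ipBl//; apply/eqP.
by apply: ip_null => //; exact: hdomB.
Qed.

Lemma hnorm_congr x x' : H x -> H x' -> hnorm H (x - x') = 0 -> hnorm H x = hnorm H x'.
Proof.
move=> hx hx' e; rewrite /hnorm (ip_congr hx hx' hx e) ipC//.
by rewrite (ip_congr hx hx' hx' e).
Qed.

Lemma hcvg_null_lim u x : (forall k, H (u k)) -> H x -> hcvg H u x ->
  ip H (u k) (u k) @[k --> \oo] --> (0 : R) -> hnorm H x = 0.
Proof.
move=> hu hx ux u0; apply/eqP; rewrite hnorm_eq0//; apply/eqP.
exact: (cvg_unique _ (hcvg_ip hu hx hu hx ux ux) u0).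
Qed.

Lemma hcvg_null u x : (forall k, H (u k)) -> H x -> hcvg H u x -> hnorm H x = 0 ->
  ip H (u k) (u k) @[k --> \oo] --> (0 : R).
Proof.
move=> hu hx ux x0; have := hcvg_ip hu hx hu hx ux ux.
by rewrite -(hnorm_sqr hx) x0 expr0n.
Qed.

End null_vectors.

Lemma C1_segment_continuous (R : realType) (f : R -> R) : C1_segment f ->
  {within `[-1, 1], continuous f}.
Proof.
move=> [f' _ df]; apply/subspace_continuousP => x xI.
have /cvgrPdist_lt /(_ 1 ltr01) dfx := df x xI.
have [r /= r0 xr] := (nbhs_ballP _ _).1 dfx.
apply/cvgrPdist_lt => e e0; rewrite /within/=.
(* Near [x] the difference quotient is bounded by |f' x| + 1, which dictates the radius below. *)
have M0 : 0 < `|f' x| + 1 by rewrite ltr_wpDl.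
apply/nbhs_ballP; exists (Num.min r (e / (`|f' x| + 1))).
  by rewrite /= lt_min r0 divr_gt0.
move=> y; rewrite /ball/= lt_min => /andP[yr ye] yI.
have [->|yx] := eqVneq y x; first by rewrite subrr normr0.
have := xr y yr yx yI; set q := (f y - f x) / (y - x) => q1.
have -> : f x - f y = - (q * (y - x)) by rewrite /q divfK ?subr_eq0// opprB.
rewrite normrN normrM (distrC y); move: ye; rewrite ltr_pdivlMr// mulrC.
apply: le_lt_trans; rewrite ler_wpM2r//.
by have := ler_normB (f' x) (f' x - q); rewrite subKr; lra.
Qed.

Section transport_space.
Context {R : realType} {d : nat}.
Variables (D : set 'rV[R]_d) (dS : {measure set 'rV[R]_d -> \bar R}).
Variable n : 'rV[R]_d -> 'rV[R]_d.
Hypotheses (oD : open D) (hn : is_outward_unit_normal D dS n).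
Local Notation point := ('rV[R]_d * 'rV[R]_d)%type.
Local Notation W := (W D).
Local Notation dW := (@dW R d).
Local Notation dG := (dG dS).
Local Notation Gamma := (Gamma D n).
Local Notation mG := (measurable_Gamma D oD hn).

Lemma fluxP a (f g : point -> R) : flux n (a *: f + g) = a *: flux n f + flux n g.
Proof. by apply/funext => z; rewrite fct_linE /flux fct_linE; ring. Qed.

Lemma flux_surj s (f : point -> R) : L2 dG (Gamma s) f ->
  exists h, L2 dG (Gamma s) (flux n h) /\
    hnorm (L2Hilbert dG (measurable_Gamma hn s)) (flux n h - f) = 0.
Proof.
move=> lf; pose h z := f z / Num.sqrt `|dot (n z.1) z.2|.
have hf z : Gamma s z -> flux n h z = f z.
  move=> [_ _ sz]; rewrite /flux /h divfK// sqrtr_eq0 -ltNge normr_gt0.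
  by apply: contraTneq sz => ->; rewrite mulr0 ltxx.
have lh : L2 dG (Gamma s) (flux n h).
  apply: (L2_le (measurable_Gamma hn s) _ lf) => [|z Gz]; last by rewrite hf.
  apply: eq_measurable_fun (L2_measurable (measurable_Gamma hn s) lf) => z /set_mem Gz.
  by rewrite hf.
exists h; split => //; apply/hnorm_eq0_ae => //.
by rewrite /ae_on; apply: aeW => z; exact: hf.
Qed.

Definition HW : semiHilbert (point -> R) := L2Hilbert dW (measurable_W oD).

Definition HG s : semiHilbert (point -> R) :=
  @pullHilbert _ _ _ (L2Hilbert dG (measurable_Gamma hn s)) _ fluxP (@flux_surj s).

End transport_space.

Lemma L2_eq d (T : measurableType d) (R : realType) (mu : {measure set T -> \bar R})
  (A : set T) (f g : T -> R) : (forall z, A z -> f z = g z) -> L2 mu A f -> L2 mu A g.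
Proof.
move=> fg; rewrite /L2; suff -> : f \_ A = g \_ A by [].
by apply/funext => z; rewrite !patchE; case: ifP => // /set_mem /fg.
Qed.

Lemma inner_eq d (T : measurableType d) (R : realType) (mu : {measure set T -> \bar R})
  (A : set T) (f f' g g' : T -> R) : (forall z, A z -> f z = f' z) ->
  (forall z, A z -> g z = g' z) -> inner mu A f g = inner mu A f' g'.
Proof. by move=> ff gg; apply: eq_Rintegral => z /set_mem Az; rewrite ff// gg. Qed.

(** * The residual as a bounded operator *)

Section residual_operator.
Context {R : realType} {d : nat}.
Variables (D : set 'rV[R]_d) (oD : open D).
Variables (phase : R -> R) (sigmaA sigmaT : R).
Hypothesis hphase : C1_segment phase.
Local Notation point := ('rV[R]_d * 'rV[R]_d)%type.
Local Notation W := (W D).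
Local Notation dW := (@dW R d).
Local Notation HW := (HW oD).
Local Notation S := (@sphere R d).
Local Notation sigma := (@sphere_measure R d).
Implicit Types u q : point -> R.

(** The phase function is controlled on [-1, 1] only. Cutting it off outside gives a kernel that is
    measurable and bounded on the whole space and unchanged on pairs of unit vectors. *)
Definition phase_kernel (y w : 'rV[R]_d) : R := (phase \_ `[-1, 1]) (dot y w).

Lemma measurable_phase_kernel :
  measurable_fun setT (fun p : point => phase_kernel p.1 p.2).
Proof.
have mphase : measurable_fun setT (phase \_ `[-1, 1]).
  apply/(measurable_restrictT phase (measurable_itv `[-1, 1])).
  exact: (subspace_continuous_measurable_fun (measurable_itv _) (C1_segment_continuous hphase)).
apply: (measurableT_comp mphase); apply: measurable_sum => i; apply: measurable_funM.
  exact: measurableT_comp (measurable_coord 0 i) measurable_fst.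
exact: (measurableT_comp (measurable_coord 0 i) measurable_snd).
Qed.

Lemma phase_kernel_bounded : exists M, forall y w, `|phase_kernel y w| <= M.
Proof.
have /compact_bounded[M [_ /(_ (`|M| + 1))]] : compact (phase @` `[-1, 1]).
  by apply: continuous_compact; [exact: (C1_segment_continuous hphase)|exact: segment_compact].
have -> : M < `|M| + 1 by have := ler_norm M; lra.
move=> /(_ isT) fM; exists (`|M| + 1) => y w; rewrite /phase_kernel patchE.
case: ifPn => [/set_mem yw|_]; first by apply: fM; exists (dot y w).
by rewrite normr0 addr_ge0.
Qed.

Lemma phase_kernelE y w : S y -> S w -> phase_kernel y w = phase (dot y w).
Proof.
move=> Sy Sw; rewrite /phase_kernel patchE mem_set//= in_itv/= -ler_norml.
exact: dot_unit_le1.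
Qed.

Definition collision u := kop sigma S phase_kernel u.

Let c := sigmaT * (@sphere_area R d)^-1.

(** With the streaming derivative [q] as an independent argument, the residual is a bounded operator
    on pairs of L2 functions. It is linear up to null vectors only, because of the collision
    integral. *)
Definition resop u q : point -> R := (q + (sigmaA + sigmaT) *: u) - c *: collision u.

Lemma resopE u q z : W z ->
  resop u q z = (q z + sigmaA * u z) + scattering phase sigmaT u z.
Proof.
move=> [_ Sz]; rewrite /scattering.
have -> : (\int[sigma]_(w in S) (phase (dot z.2 w) * u (z.1, w)))%R = collision u z.
  by apply: eq_Rintegral => w /set_mem Sw; rewrite phase_kernelE.
rewrite [LHS](_ : _ = q z + (sigmaA + sigmaT) * u z - c * collision u z)//.
rewrite /c; ring.
Qed.


Lemma collision_bounded : exists2 C, 0 <= C & forall u, HW u ->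
  HW (collision u) /\ hnorm HW (collision u) <= C * hnorm HW u.
Proof.
have [M kM] := phase_kernel_bounded.
exists (`|M * fine (sigma S)|) => // u lu.
have [lK Kle] := @kop_bound _ _ _ _ R (vol d) (vol_sigma_finite d) sigma D S (measurable_D oD)
  (@measurable_sphere R d) _ M measurable_phase_kernel kM u lu.
split; first exact: lK.
rewrite -(@ler_pXn2r _ 2%N)// ?nnegrE ?mulr_ge0 ?hnorm_ge0//.
rewrite exprMn (@hnorm_sqr _ _ HW _ lK) (hnorm_sqr lu).
by rewrite real_normK ?num_real//; exact: Kle.
Qed.

Lemma collision_linear a u v : HW u -> HW v ->
  hnorm HW (collision (a *: u + v) - (a *: collision u + collision v)) = 0.
Proof.
have [M kM] := phase_kernel_bounded; have [C C0 hC] := collision_bounded.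
move=> lu lv; have [lu' _] := hC u lu; have [lv' _] := hC v lv.
have [luv' _] := hC _ (hdomP a lu lv).
apply/hnorm_eq0_ae => //; first exact: (@hdomP _ _ HW a _ _ lu' lv').
exact: (@kop_linear _ _ _ _ R (vol d) (vol_sigma_finite d) sigma D S (measurable_D oD)
  (@measurable_sphere R d) _ M measurable_phase_kernel kM a u v lu lv).
Qed.

Lemma resop_dom u q : HW u -> HW q -> HW (resop u q).
Proof.
move=> lu lq; have [C _ /(_ u lu)[lK _]] := collision_bounded.
apply: hdomB; last exact: hdomZ.
by apply: hdomD => //; exact: hdomZ.
Qed.

Lemma resop_linear a u q v r : HW u -> HW q -> HW v -> HW r ->
  hnorm HW (resop (a *: u + v) (a *: q + r) - (a *: resop u q + resop v r)) = 0.
Proof.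
move=> lu lq lv lr; have [C C0 hC] := collision_bounded.
have -> : resop (a *: u + v) (a *: q + r) - (a *: resop u q + resop v r) =
    (- c) *: (collision (a *: u + v) - (a *: collision u + collision v)).
  apply/funext => z; pose Kz f := collision f z; pose s := sigmaA + sigmaT.
  change (((a * q z + r z) + s * (a * u z + v z) - c * Kz (a *: u + v)) -
      (a * (q z + s * u z - c * Kz u) + (r z + s * v z - c * Kz v)) =
    - c * (Kz (a *: u + v) - (a * Kz u + Kz v))); ring.
rewrite hnormZ ?collision_linear ?mulr0//.
have [lu' _] := hC u lu; have [lv' _] := hC v lv.
by have [luv' _] := hC _ (hdomP a lu lv); apply: hdomB => //; exact: hdomP.
Qed.

Lemma resop_bounded : exists2 C, 0 <= C & forall u q, HW u -> HW q ->
  hnorm HW (resop u q) <= hnorm HW q + C * hnorm HW u.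
Proof.
have [C C0 hC] := collision_bounded.
exists (`|sigmaA + sigmaT| + `|c| * C) => [|u q lu lq]; first by rewrite addr_ge0 ?mulr_ge0.
have [lu' leu] := hC u lu.
apply: (le_trans (hnormB (hdomD lq (hdomZ (sigmaA + sigmaT) lu)) (hdomZ c lu'))).
have h1 := hnormD lq (hdomZ (sigmaA + sigmaT) lu).
have h2 : `|c| * hnorm HW (collision u) <= `|c| * (C * hnorm HW u) by rewrite ler_wpM2l.
rewrite hnormZ// in h1; rewrite hnormZ//; apply: le_trans (lerD h1 h2) _.
by rewrite le_eqVlt; apply/orP; left; apply/eqP; ring.
Qed.

Lemma resop_cvg (u q : nat -> point -> R) u0 q0 : (forall k, HW (u k)) ->
  (forall k, HW (q k)) -> HW u0 -> HW q0 -> hcvg HW u u0 -> hcvg HW q q0 ->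
  hcvg HW (fun k => resop (u k) (q k)) (resop u0 q0).
Proof.
move=> lu lq lu0 lq0 /(hcvg_hnorm lu lu0) cu /(hcvg_hnorm lq lq0) cq.
have [C C0 hC] := resop_bounded.
apply/hcvg_hnorm; [by move=> k; exact: resop_dom|exact: resop_dom|].
apply: (@squeeze_cvgr _ _ _ _ (cst 0)
    (fun k => hnorm HW (q k - q0) + C * hnorm HW (u k - u0))); last 2 first.
- exact: cvg_cst.
- rewrite [X in _ --> X](_ : 0 = 0 + C * 0); last by ring.
  by apply: cvgD => //; apply: cvgM => //; exact: cvg_cst.
near=> k; rewrite hnorm_ge0/=.
have lr := resop_dom (lu k) (lq k); have lr0 := resop_dom lu0 lq0.
have E : hnorm HW (resop (u k - u0) (q k - q0) - (resop (u k) (q k) - resop u0 q0)) = 0.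
  have := resop_linear (-1) lu0 lq0 (lu k) (lq k).
  by rewrite !scaleN1r [- u0 + _]addrC [- q0 + _]addrC [- resop _ _ + _]addrC.
rewrite -(hnorm_congr _ _ E); [|apply: resop_dom|]; try exact: hdomB.
by apply: hC; exact: hdomB.
Unshelve. all: by end_near.
Qed.

End residual_operator.

Lemma cvg_sqnorm d (T : measurableType d) (R : realType)
    (mu : {measure set T -> \bar R}) (A : set T) (mA : measurable A) (f : nat -> T -> R) :
  (forall k, L2 mu A (f k)) ->
  sqnorm mu A (f k) @[k --> \oo] --> 0%E <-> inner mu A (f k) (f k) @[k --> \oo] --> (0 : R).
Proof.
move=> lf; rewrite (_ : (fun k => sqnorm mu A (f k)) =
    (fun k => (inner mu A (f k) (f k))%:E)); last first.
  by apply/funext => k; rewrite sqnormE.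
split => [/fine_cvg//|h]; apply: cvg_EFin => //; exact: nearW.
Qed.

(** * V as a complete space of triples *)

Section solution_space.
Context {R : realType} {d : nat}.
Variables (D : set 'rV[R]_d) (dS : {measure set 'rV[R]_d -> \bar R}).
Variable n : 'rV[R]_d -> 'rV[R]_d.
Variables (phase : R -> R) (sigmaA sigmaT : R).
Hypotheses (oD : open D) (hn : is_outward_unit_normal D dS n).
Hypothesis hphase : C1_segment phase.
Local Notation point := ('rV[R]_d * 'rV[R]_d)%type.
Local Notation W := (W D).
Local Notation dW := (@dW R d).
Local Notation dG := (dG dS).
Local Notation Gamma := (Gamma D n).
Local Notation HW := (HW oD).
Local Notation HG := (HG hn).
Local Notation V := (Vspace D dS n phase sigmaA sigmaT).
Local Notation res := (resop phase sigmaA sigmaT).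
Implicit Types u q h phi : point -> R.

(** Triples formed by a function, its streaming derivative and its trace on [Gamma s]. *)
Definition H3 s := prodHilbert (prodHilbert HW HW) (HG s).

Definition C1c_graph (p : (point -> R) * (point -> R) * (point -> R)) :=
  exists2 phi, C1c phi & p = (phi, streaming phi, phi).

Lemma C1c_graph_dom s p : C1c_graph p -> H3 s p.
Proof.
move=> [phi Cphi ->]; split; last exact: C1c_L2G.
by split; [exact: C1c_L2W|exact: C1c_streaming_L2W].
Qed.

Lemma C1c_graph_linear a p r : C1c_graph p -> C1c_graph r -> C1c_graph (a *: p + r).
Proof.
move=> [phi Cphi ->] [psi Cpsi ->]; exists (a *: phi + psi); first exact: C1c_linear.
by rewrite streaming_linear; [|exact: Cphi.1|exact: Cpsi.1].
Qed.

Lemma is_traceP s u q h : HW u -> HW q ->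
  is_trace D dS n s u q h <-> hcl (H3 s) C1c_graph (u, q, h).
Proof.
move=> lu lq; have mW := measurable_W oD; have mG := measurable_Gamma hn.
split.
  move=> [lh [phi [Cphi pu pq ph]]]; split; first by [].
  exists (fun k => (phi k, streaming (phi k), phi k)) => [k|]; first by exists (phi k).
  apply/hcvg_pair => //.
    by move=> k; apply: C1c_graph_dom; exists (phi k).
  split; last first.
    apply/(cvg_sqnorm (mG s)) => // k.
    exact: (@hdomB _ _ (HG s) _ _ (C1c_L2G hn s (Cphi k)) lh).
  apply/hcvg_pair => //.
    move=> k; split; first exact: (C1c_L2W oD (Cphi k)).
    exact: (C1c_streaming_L2W oD (Cphi k)).
  split; apply/(cvg_sqnorm mW) => // k.
    exact: (@hdomB _ _ HW _ _ (C1c_L2W oD (Cphi k)) lu).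
  exact: (@hdomB _ _ HW _ _ (C1c_streaming_L2W oD (Cphi k)) lq).
move=> [[_ lh] [p Sp px]]; split; first exact: lh.
have hS k : exists phi, C1c phi /\ p k = (phi, streaming phi, phi).
  by have [phi ? ?] := Sp k; exists phi.
have [phi phiP] := choice hS.
have Cphi k : C1c (phi k) by have [] := phiP k.
have pE : p = fun k => (phi k, streaming (phi k), phi k).
  by apply/funext => k; have [] := phiP k.
rewrite pE in Sp px.
have Hz2 : prodHilbert HW HW (u, q) by [].
have Hz : H3 s (u, q, h) by [].
have [p1 p2] := (hcvg_pair (fun k => C1c_graph_dom s (Sp k)) Hz).1 px.
have [p3 p4] := (hcvg_pair (fun k => (C1c_graph_dom s (Sp k)).1) Hz2).1 p1.
exists phi; split => //.
- apply/(cvg_sqnorm mW) => // k; exact: (@hdomB _ _ HW _ _ (C1c_L2W oD (Cphi k)) lu).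
- apply/(cvg_sqnorm mW) => // k.
  exact: (@hdomB _ _ HW _ _ (C1c_streaming_L2W oD (Cphi k)) lq).
- apply/(cvg_sqnorm (mG s)) => // k.
  exact: (@hdomB _ _ (HG s) _ _ (C1c_L2G hn s (Cphi k)) lh).
Qed.

Definition weak_streaming u q := forall phi, test_function D phi ->
  ip HW q phi = - ip HW u (streaming phi).

Lemma test_function_C1c phi : test_function D phi -> C1c phi.
Proof. by move=> [C1phi [K [cK _ phiK]]]; split => //; exists K. Qed.

Lemma is_streamingP u q : HW u -> HW q -> is_streaming D u q <-> weak_streaming u q.
Proof.
move=> lu lq; split; first by move=> [_ h] phi /h[].
move=> h; split; first exact: (L2_measurable (measurable_W oD) lq).
move=> phi tphi; split; last exact: h.
apply: L2_mul_integrable => //; first exact: (measurable_W oD).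
exact/(C1c_L2W oD)/test_function_C1c.
Qed.

(** Both conditions pass to limits in [H3 (-1)]: the first is a family of identities between
    continuous functionals, the second a sequential closure. Completeness is thus obtained for the
    graph norm, which, unlike the residual norm, asks for no coercivity. *)
Definition Vdom (p : (point -> R) * (point -> R) * (point -> R)) :=
  weak_streaming p.1.1 p.1.2 /\ hcl (H3 (-1)) C1c_graph p.

Lemma Vdom_H3 p : Vdom p -> H3 (-1) p.
Proof. by case=> _ []. Qed.

Lemma Vdom_linear a p r : Vdom p -> Vdom r -> Vdom (a *: p + r).
Proof.
move=> [wp cp] [wr cr]; split; last exact: (hcl_linear (C1c_graph_dom (-1)) C1c_graph_linear).
case: cp => -[[pu pq] _] _; case: cr => -[[ru rq] _] _.
move=> phi tphi; have Cphi := test_function_C1c tphi.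
have lphi : HW phi by exact: C1c_L2W.
have lsphi : HW (streaming phi) by exact: C1c_streaming_L2W.
by rewrite !ipP// wp// wr//; ring.
Qed.

Lemma Vdom0 : Vdom 0.
Proof.
have C0 : C1c_graph 0.
  exists 0; last first.
    congr (_, _, _); apply/funext => z; rewrite /streaming.
    by rewrite (_ : (0 : point -> R) = cst 0)// derive_cst.
  split; last by exists set0 => //; exact: compact0.
  split => [x|v]; first exact: differentiable_cst.
  rewrite (_ : (fun x => _) = cst 0); first exact: cst_continuous.
  by apply/funext => x; rewrite (_ : (0 : point -> R) = cst 0)// derive_cst.
split; last first.
  by split; [exact: hdom0|exists (fun=> 0) => //; apply: hcvg_cst; exact: hdom0].
move=> phi tphi; have Cphi := test_function_C1c tphi.
rewrite !ip0l ?oppr0//; [exact: C1c_streaming_L2W|exact: C1c_L2W].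
Qed.

Lemma Vdom_closed (p : nat -> _) r : (forall k, Vdom (p k)) -> H3 (-1) r ->
  hcvg (H3 (-1)) p r -> Vdom r.
Proof.
move=> Vp Hr pr; split; last first.
  by apply: (hcl_closed (C1c_graph_dom (-1)) _ Hr pr) => k; have [] := Vp k.
have Hp k := Vdom_H3 (Vp k).
have [c12 _] := (hcvg_pair Hp Hr).1 pr.
have [c1 c2] := (hcvg_pair (fun k => (Hp k).1) Hr.1).1 c12.
move=> phi tphi; have Cphi := test_function_C1c tphi.
have lphi : HW phi by exact: C1c_L2W.
have lsphi : HW (streaming phi) by exact: C1c_streaming_L2W.
have e1 := hcvg_ip (fun k => (Hp k).1.2) Hr.1.2 (fun=> lphi) lphi c2 (hcvg_cst lphi).
have e2 := hcvg_ip (fun k => (Hp k).1.1) Hr.1.1 (fun=> lsphi) lsphi c1 (hcvg_cst lsphi).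
have /cvgN e3 := e2.
have E : (fun k => ip HW (p k).1.2 phi) = (fun k => - ip HW (p k).1.1 (streaming phi)).
  by apply/funext => k; have [wk _] := Vp k; exact: wk.
by rewrite E in e1; exact: (cvg_unique _ e1 e3).
Qed.

Definition VH := subHilbert Vdom0 Vdom_linear Vdom_H3 Vdom_closed.

Definition Vdata (v : V) := (vfun v, vstream v, vtrace v).

(** The record asks for square integrability of the residual; subtracting the bounded zero-order
    part [res (vfun v) 0] leaves the streaming derivative. *)
Lemma Vspace_L2 (v : V) : HW (vfun v) /\ HW (vstream v).
Proof.
have lu : HW (vfun v) by exact: vfunL2.
split => //; have mq := (vstreamP v).1.
have lr : HW (res (vfun v) 0) by apply: resop_dom => //; exact: hdom0.
have lR := vresL2 v.
apply: (@L2_eq _ _ _ _ _ ((fun z => (vstream v z + sigmaA * vfun v z) +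
  scattering phase sigmaT (vfun v) z) - res (vfun v) 0)).
  move=> z Wz; rewrite [LHS](_ : _ = ((vstream v z + sigmaA * vfun v z) +
    scattering phase sigmaT (vfun v) z) - res (vfun v) 0 z)// (@resopE _ _ D _ _ _ _ _ _ Wz).
  rewrite [(0 : point -> R) z](_ : _ = 0)//; ring.
exact: (@hdomB _ _ HW).
Qed.

Lemma Vdata_dom (v : V) : Vdom (Vdata v).
Proof.
have [lu lq] := Vspace_L2 v; split; first exact/(is_streamingP lu lq)/(vstreamP v).
exact: (is_traceP _ _ lu lq).1 (vtraceP v).
Qed.

Lemma Vdata_surj p : Vdom p -> exists v : V, Vdata v = p.
Proof.
case: p => -[u q] h [/= w c]; have [[[/= lu lq] lh] _] := c.
have lr : L2 dW W (fun z => (q z + sigmaA * u z) + scattering phase sigmaT u z).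
  apply: (@L2_eq _ _ _ dW W (res u q)).
    by move=> z Wz; rewrite (@resopE _ _ D _ _ _ _ _ _ Wz).
  exact: (@resop_dom _ _ _ oD _ sigmaA sigmaT hphase).
by exists (MkV lu ((is_streamingP lu lq).2 w) lr ((is_traceP _ _ lu lq).2 c)).
Qed.

End solution_space.

(** * Outflow traces and optimality conditions *)

Lemma pair_lin1 (R : pzRingType) (X Y : lmodType R) a (p r : X * Y) :
  (a *: p + r).1 = a *: p.1 + r.1.
Proof. by []. Qed.

Lemma pair_lin2 (R : pzRingType) (X Y : lmodType R) a (p r : X * Y) :
  (a *: p + r).2 = a *: p.2 + r.2.
Proof. by []. Qed.

Lemma quadratic_ge0_linear_coef (R : realFieldType) (b c : R) :
  (forall t, 0 <= t * b + t ^+ 2 * c) -> b = 0.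
Proof.
move=> h; apply/eqP; apply: contraT => b0.
have c1 : 0 < 1 + `|c| by rewrite ltr_wpDr.
(* The denominator is positive and exceeds [c], so that this [t] gives a negative multiple of the
   square of [b] whatever the sign of [c]. *)
have := h (- b / (1 + `|c|)).
have -> : - b / (1 + `|c|) * b + (- b / (1 + `|c|)) ^+ 2 * c =
    (b / (1 + `|c|)) ^+ 2 * (c - `|c| - 1).
  by field; rewrite gt_eqF.
rewrite pmulr_rge0; first by have := ler_norm c; lra.
by rewrite exprn_even_gt0//= mulf_neq0// invr_eq0 gt_eqF.
Qed.

Section outflow_trace.
Context {R : realType} {d : nat}.
Variables (D : set 'rV[R]_d) (dS : {measure set 'rV[R]_d -> \bar R}).
Variable n : 'rV[R]_d -> 'rV[R]_d.
Hypotheses (oD : open D) (hn : is_outward_unit_normal D dS n).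
Local Notation point := ('rV[R]_d * 'rV[R]_d)%type.
Local Notation HW := (HW oD).
Local Notation HG := (HG hn).
Local Notation H3 := (H3 oD hn).

Definition H4 := prodHilbert (H3 (-1)) (HG 1).

Definition C1c_graph4
    (p : (point -> R) * (point -> R) * (point -> R) * (point -> R)) :=
  exists2 phi, C1c phi & p = (phi, streaming phi, phi, phi).

Lemma C1c_graph4_dom p : C1c_graph4 p -> H4 p.
Proof.
move=> [phi Cphi ->]; split; last exact: (C1c_L2G hn 1 Cphi).
by apply: C1c_graph_dom; exists phi.
Qed.

Lemma C1c_graph4_linear a p r : C1c_graph4 p -> C1c_graph4 r -> C1c_graph4 (a *: p + r).
Proof.
move=> [phi Cphi ->] [psi Cpsi ->]; exists (a *: phi + psi); first exact: C1c_linear.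
by rewrite streaming_linear; [|exact: Cphi.1|exact: Cpsi.1].
Qed.

Lemma green_closure p : hcl H4 C1c_graph4 p ->
  ip (HG 1) p.2 p.2 = ip (HG (-1)) p.1.2 p.1.2 + 2 * ip HW p.1.1.1 p.1.1.2.
Proof.
move=> [Hp [u Su up]]; have Hu k := C1c_graph4_dom (Su k).
have [c3 c4] := (hcvg_pair Hu Hp).1 up.
have H3u k := (Hu k).1.
have [c12 ct] := (hcvg_pair H3u Hp.1).1 c3.
have [c1 c2] := (hcvg_pair (fun k => (H3u k).1) Hp.1.1).1 c12.
have e4 := hcvg_ip (fun k => (Hu k).2) Hp.2 (fun k => (Hu k).2) Hp.2 c4 c4.
have et := hcvg_ip (fun k => (H3u k).2) Hp.1.2 (fun k => (H3u k).2) Hp.1.2 ct ct.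
have e12 := hcvg_ip (fun k => (H3u k).1.1) Hp.1.1.1 (fun k => (H3u k).1.2) Hp.1.1.2 c1 c2.
have e : ip (HG (-1)) (u k).1.2 (u k).1.2 + 2 * ip HW (u k).1.1.1 (u k).1.1.2 @[k --> \oo] -->
    ip (HG (-1)) p.1.2 p.1.2 + 2 * ip HW p.1.1.1 p.1.1.2.
  by apply: cvgD => //; apply: cvgM => //; exact: cvg_cst.
have E : (fun k => ip (HG 1) (u k).2 (u k).2) = (fun k =>
    ip (HG (-1)) (u k).1.2 (u k).1.2 + 2 * ip HW (u k).1.1.1 (u k).1.1.2).
  apply/funext => k; have [phi Cphi ->] := Su k => /=.
  have := green_formula oD hn Cphi.
  rewrite /innerG /ip/=; lra.
by rewrite E in e4; exact: (cvg_unique _ e4 e).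
Qed.

(** Green's identity in the limit, where twice the inner product of the function and its streaming
    derivative is at most the sum of their squared norms. *)
Lemma outflow_le p : hcl H4 C1c_graph4 p -> ip (HG 1) p.2 p.2 <= ip (H3 (-1)) p.1 p.1.
Proof.
move=> cp; rewrite green_closure//; have [[[[h1 h2] h3] h4] _] := cp.
have := ip_ge0 (hdomB h1 h2); rewrite ip_sqB//.
have -> : ip (H3 (-1)) p.1 p.1 = ip HW p.1.1.1 p.1.1.1 + ip HW p.1.1.2 p.1.1.2 +
  ip (HG (-1)) p.1.2 p.1.2 by [].
lra.
Qed.

(** A sequence of C^1 functions that converges in [H3 (-1)] is Cauchy on the outflow boundary as
    well, by [outflow_le] for differences. The outflow trace thus arises along the very sequence
    that defines the inflow trace, which keeps Green's identity available for the pair. *)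
Lemma outflow_exists p : hcl (H3 (-1)) C1c_graph p ->
  exists h, hcl H4 C1c_graph4 (p, h).
Proof.
move=> [Hp [u Su up]].
have hS k : exists phi, C1c phi /\ u k = (phi, streaming phi, phi).
  by have [phi ? ?] := Su k; exists phi.
have [phi phiP] := choice hS.
have Cphi k : C1c (phi k) by have [] := phiP k.
pose v k := (u k, phi k).
have Sv k : C1c_graph4 (v k) by exists (phi k) => //; rewrite /v; have [_ ->] := phiP k.
have Hv k := C1c_graph4_dom (Sv k).
have [e e0|h Hh hphi] := @ip_complete _ _ (HG 1) phi (fun k => (Hv k).2).
  have [N NP] := hcvg_cauchy (fun k => (Hv k).1) Hp up e0.
  exists N => i j Ni Nj; apply: le_lt_trans (NP i j Ni Nj).
  have Sij : C1c_graph4 (v i - v j).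
    by rewrite addrC -scaleN1r; exact: C1c_graph4_linear.
  apply: (@outflow_le (v i - v j)); split; first exact: C1c_graph4_dom.
  by exists (fun=> v i - v j) => //; apply: hcvg_cst; exact: C1c_graph4_dom.
exists h; split; first by [].
by exists v => //; apply/(hcvg_pair Hv).
Qed.

Lemma outflow_graph p h : hcl H4 C1c_graph4 (p, h) -> hcl (H3 1) C1c_graph (p.1, h).
Proof.
move=> [[[Hp Ht] Hh] [u Su up]]; split; first by [].
have Hu k := C1c_graph4_dom (Su k).
have [c3 c4] := (hcvg_pair Hu (conj (conj Hp Ht) Hh : H4 (p, h))).1 up.
have [c12 _] := (hcvg_pair (fun k => (Hu k).1) (conj Hp Ht : H3 (-1) p)).1 c3.
exists (fun k => ((u k).1.1, (u k).2)).
  by move=> k; have [phi Cphi ->] := Su k; exists phi.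
by apply/hcvg_pair => // k; split; [exact: (Hu k).1.1|exact: (Hu k).2].
Qed.

End outflow_trace.

(** * Optimality conditions and injectivity *)

Section variational_problem.
Context {R : realType} {d : nat}.
Variables (D : set 'rV[R]_d) (dS : {measure set 'rV[R]_d -> \bar R}).
Variable n : 'rV[R]_d -> 'rV[R]_d.
Variables (phase : R -> R) (sigmaA sigmaT gamma : R).
Hypotheses (oD : open D) (hn : is_outward_unit_normal D dS n).
Hypothesis hphase : C1_segment phase.
Local Notation point := ('rV[R]_d * 'rV[R]_d)%type.
Local Notation W := (W D).
Local Notation dW := (@dW R d).
Local Notation dG := (dG dS).
Local Notation Gamma := (Gamma D n).
Local Notation HW := (HW oD).
Local Notation HG := (HG hn (-1)).
Local Notation H3 := (H3 oD hn (-1)).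
Local Notation V := (Vspace D dS n phase sigmaA sigmaT).
Local Notation Vdom := (Vdom oD hn).
Local Notation VH := (VH oD hn).
Local Notation data := ((point -> R) * (point -> R) * (point -> R))%type.

Definition Res (p : data) := resop phase sigmaA sigmaT p.1.1 p.1.2.

Lemma Res_dom p : H3 p -> HW (Res p).
Proof. by move=> [[h1 h2] _]; exact: (@resop_dom _ _ _ oD _ sigmaA sigmaT hphase). Qed.

Lemma Res_linear a p r : H3 p -> H3 r ->
  hnorm HW (Res (a *: p + r) - (a *: Res p + Res r)) = 0.
Proof.
move=> [[p1 p2] _] [[r1 r2] _]; rewrite /Res.
rewrite !pair_lin1 !pair_lin2; exact: resop_linear.
Qed.

Definition energy (p r : data) := ip HW (Res p) (Res r) + gamma * ip HG p.2 r.2.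

Lemma energyC p r : H3 p -> H3 r -> energy p r = energy r p.
Proof.
move=> hp hr; rewrite /energy (ipC (Res_dom hp) (Res_dom hr)).
by rewrite (@ipC _ _ HG _ _ hp.2 hr.2).
Qed.

Lemma energyP a p r s : H3 p -> H3 r -> H3 s ->
  energy (a *: p + r) s = a * energy p s + energy r s.
Proof.
move=> hp hr hs; rewrite /energy.
have hp' := Res_dom hp; have hr' := Res_dom hr; have hs' := Res_dom hs.
rewrite (ip_congr (Res_dom (hdomP a hp hr)) (hdomP a hp' hr') hs' (Res_linear a hp hr)).
rewrite (ipP a hp' hr' hs').
by rewrite pair_lin2 (@ipP _ _ HG a _ _ _ hp.2 hr.2 hs.2) !mulrDr addrACA (mulrCA gamma).
Qed.

Lemma energy_cvg (p : nat -> data) p0 r : (forall k, H3 (p k)) -> H3 p0 -> H3 r ->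
  hcvg H3 p p0 -> energy (p k) r @[k --> \oo] --> energy p0 r.
Proof.
move=> hp hp0 hr cp; have [c12 ct] := (hcvg_pair hp hp0).1 cp.
have [c1 c2] := (hcvg_pair (fun k => (hp k).1) hp0.1).1 c12.
have cR := resop_cvg sigmaA sigmaT hphase (fun k => (hp k).1.1) (fun k => (hp k).1.2)
  hp0.1.1 hp0.1.2 c1 c2.
apply: cvgD.
  exact: (hcvg_ip (fun k => Res_dom (hp k)) (Res_dom hp0) (fun=> Res_dom hr) (Res_dom hr)
    cR (hcvg_cst (Res_dom hr))).
apply: cvgM; first exact: cvg_cst.
exact: (hcvg_ip (fun k => (hp k).2) hp0.2 (fun=> hr.2) hr.2 ct (hcvg_cst hr.2)).
Qed.

Variable g : point -> R.
Hypothesis hg : HG g.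
Local Notation Vdata := (@Vdata R d D dS n phase sigmaA sigmaT).

Lemma Vdata_H3 (v : V) : H3 (Vdata v).
Proof. exact: (Vdom_H3 (Vdata_dom oD hn hphase v)). Qed.

Lemma LE (v : V) lam : HG lam ->
  L gamma g v lam = 2^-1 * ip HW (Res (Vdata v)) (Res (Vdata v)) +
    gamma / 2 * ip HG (vtrace v - g) (vtrace v - g) - ip HG lam (vtrace v - g).
Proof.
move=> hlam; have [h12 ht] := Vdata_H3 v.
rewrite /L /J; congr (_ * _ + _ * _ - _).
  rewrite -[RHS]/(fine (ip HW (Res (Vdata v)) (Res (Vdata v)))%:E).
  have -> : ip HW (Res (Vdata v)) (Res (Vdata v)) =
      inner dW W (residual v) (residual v).
    by apply: inner_eq => z Wz; rewrite /Res (@resopE _ _ D _ _ _ _ _ _ Wz).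
  rewrite -sqnormE//; first exact: measurable_W.
  exact: vresL2.
Qed.

(** An exact expansion in [t]: the first-order condition uses it for all [t], the uniqueness
    argument for [t = 1]. *)
Lemma L_shift (u v : V) (r : data) lam t : HG lam -> H3 r ->
  Vdata v = t *: r + Vdata u ->
  L gamma g v lam = L gamma g u lam +
    (t * (ip HW (Res (Vdata u)) (Res r) + gamma * ip HG (vtrace u - g) r.2 -
      ip HG lam r.2) +
     t ^+ 2 * (2^-1 * ip HW (Res r) (Res r) + gamma / 2 * ip HG r.2 r.2)).
Proof.
move=> hlam hr E; rewrite !LE// E.
have hu := Vdata_H3 u; have hu' := Res_dom hu; have hr' := Res_dom hr.
have hs := hdomP t hr' hu'.
have hRE := Res_dom (hdomP t hr hu).
rewrite (ip_congr hRE hs hRE (Res_linear t hr hu)) (ipC hs hRE).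
rewrite (ip_congr hRE hs hs (Res_linear t hr hu)) [t *: Res r + _]addrC ip_sqD//.
have -> : vtrace v - g = (vtrace u - g) + t *: r.2.
  have -> : vtrace v = t *: r.2 + vtrace u by have := congr1 snd E.
  by rewrite -addrA addrC.
have hr2 : HG r.2 := hr.2; have hug : HG (vtrace u - g) by apply: hdomB => //; exact: hu.2.
have hz : HG (t *: r.2) := @hdomZ _ _ HG t _ hr2.
rewrite (@ip_sqD _ _ HG t _ _ hug hr2) (@ipDr _ _ HG _ _ _ hug hz hlam).
rewrite (@ipZr _ _ HG _ _ _ hr2 hlam).
generalize (ip HW (Res (Vdata u)) (Res (Vdata u))) (ip HW (Res (Vdata u)) (Res r))
  (ip HW (Res r) (Res r)) (ip HG (vtrace u - g) (vtrace u - g)) (ip HG (vtrace u - g) r.2)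
  (ip HG r.2 r.2) (ip HG lam r.2) (ip HG lam (vtrace u - g)).
by move=> *; field.
Qed.

Lemma first_order (u : V) lam : HG lam -> is_argmin (fun w => L gamma g w lam) u ->
  forall r, Vdom r ->
  ip HW (Res (Vdata u)) (Res r) + gamma * ip HG (vtrace u - g) r.2 = ip HG lam r.2.
Proof.
move=> hlam amin r Vr; apply/eqP; rewrite -subr_eq0; apply/eqP.
apply: (@quadratic_ge0_linear_coef _ _
  (2^-1 * ip HW (Res r) (Res r) + gamma / 2 * ip HG r.2 r.2)) => t.
have [v vE] := @Vdata_surj _ _ _ _ _ phase sigmaA sigmaT oD hn hphase _
  (Vdom_linear t Vr (Vdata_dom oD hn hphase u)).
have [+ _] := amin v.
by rewrite (L_shift hlam (Vdom_H3 Vr) vE) lerDl.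
Qed.

(** In a direction with null residual and null trace the Lagrangian does not change, so the shifted
    point attains the minimum too, and uniqueness makes the function part of [r] null. The streaming
    part is the residual minus zero-order terms in that function, hence null as well. *)
Lemma argmin_injective (u : V) lam : HG lam -> is_argmin (fun w => L gamma g w lam) u ->
  forall r, Vdom r -> hnorm HW (Res r) = 0 -> hnorm HG r.2 = 0 -> hnorm H3 r = 0.
Proof.
move=> hlam amin r Vr Rr0 tr0; have hr := Vdom_H3 Vr.
have [v vE] := @Vdata_surj _ _ _ _ _ phase sigmaA sigmaT oD hn hphase _
  (Vdom_linear 1 Vr (Vdata_dom oD hn hphase u)).
have rr0 : ip HW (Res r) (Res r) = 0 by rewrite ip_null//; exact: Res_dom.
have t0 : ip HG r.2 r.2 = 0 by rewrite ip_null//; exact: hr.2.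
have [_] := amin v; rewrite (L_shift hlam hr vE).
have := first_order hlam amin Vr => ->; rewrite subrr rr0 t0 !mulr0 addr0 mulr0 !addr0.
move=> /(_ erefl) vu.
have u0 : hnorm HW r.1.1 = 0.
  have -> : r.1.1 = vfun v - vfun u.
    have -> : vfun v = (1 *: r.1.1 + vfun u) by have := congr1 (fun p => p.1.1) vE.
    by rewrite scale1r addrK.
  by apply/(hnorm_eq0_ae (measurable_W oD)) => //; exact: vfunL2.
have [C C0 hC] := @resop_bounded _ _ _ oD phase sigmaA sigmaT hphase.
have q0 : hnorm HW r.1.2 = 0.
  have h0 := hdom0 HW; have [[h1 h2] _] := hr.
  have E : r.1.2 = Res r - resop phase sigmaA sigmaT r.1.1 0.
    by rewrite /Res /resop add0r -[r.1.2 + _ - _]addrA addrK.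
  have := hnormB (Res_dom hr) (@resop_dom _ _ _ oD _ sigmaA sigmaT hphase _ _ h1 h0).
  rewrite -E Rr0 add0r => h.
  have := hC _ _ h1 h0; rewrite hnorm0 u0 mulr0 addr0 => h'.
  by apply/eqP; rewrite eq_le hnorm_ge0 andbT (le_trans h).
have [[h1 h2] h3] := hr; apply/eqP; rewrite hnorm_eq0//; apply/eqP.
have -> : ip H3 r r = ip HW r.1.1 r.1.1 + ip HW r.1.2 r.1.2 + ip HG r.2 r.2 by [].
by rewrite t0 (ip_null h1 h1 u0) (ip_null h2 h2 q0) !addr0.
Qed.

End variational_problem.

(** * The map from multipliers to errors *)

Section multiplier_to_solution.
Context {R : realType} {d : nat}.
Variables (D : set 'rV[R]_d) (dS : {measure set 'rV[R]_d -> \bar R}).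
Variable n : 'rV[R]_d -> 'rV[R]_d.
Variables (phase : R -> R) (sigmaA sigmaT gamma : R).
Hypotheses (oD : open D) (hn : is_outward_unit_normal D dS n).
Hypothesis hphase : C1_segment phase.
Local Notation point := ('rV[R]_d * 'rV[R]_d)%type.
Local Notation W := (W D).
Local Notation dW := (@dW R d).
Local Notation dG := (dG dS).
Local Notation Gamma := (Gamma D n).
Local Notation HW := (HW oD).
Local Notation HG := (HG hn (-1)).
Local Notation H3 := (H3 oD hn (-1)).
Local Notation V := (Vspace D dS n phase sigmaA sigmaT).
Local Notation Vdom := (Vdom oD hn).
Local Notation VH := (VH oD hn).
Local Notation data := ((point -> R) * (point -> R) * (point -> R))%type.
Local Notation Res := (@Res R d phase sigmaA sigmaT).
Local Notation energy := (energy phase sigmaA sigmaT gamma oD hn).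
Local Notation Vdata := (@Vdata R d D dS n phase sigmaA sigmaT).

Lemma hnormG_ae (f h : point -> R) : HG f -> HG h ->
  ae_on dG (Gamma (-1)) (fun z => f z = h z) -> hnorm HG (f - h) = 0.
Proof.
move=> hf hh fh.
have -> : hnorm HG (f - h) = hnorm (L2Hilbert dG (measurable_Gamma hn (-1)))
    (flux n f - flux n h).
  by rewrite -(pullbackB (@fluxP _ _ n)).
apply/hnorm_eq0_ae => //.
by apply: ae_onS fh => z _; rewrite /flux => ->.
Qed.

(** A relation between errors and multipliers, since minimisers are unique only up to null sets. Its
    weak form makes it a subspace and makes its closedness immediate, each identity being continuous
    in [x]. *)
Definition solution_graph (x : data * (point -> R)) :=
  [/\ Vdom x.1, HG x.2 & forall r, Vdom r -> energy x.1 r = ip HG x.2 r.2].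

Lemma solution_graph0 : solution_graph 0.
Proof.
have H0 : H3 0 by exact: hdom0.
split; [exact: Vdom0|exact: (hdom0 HG)|] => r Vr; have hr := Vdom_H3 Vr.
rewrite (@ip0l _ _ HG _ hr.2).
have := energyP sigmaA sigmaT gamma hphase (-1) H0 H0 hr.
by rewrite scaleN1r addNr mulN1r addNr.
Qed.

Lemma solution_graph_linear a x y :
  solution_graph x -> solution_graph y -> solution_graph (a *: x + y).
Proof.
move=> [Vx Gx Ex] [Vy Gy Ey]; split.
- by rewrite pair_lin1; exact: Vdom_linear.
- by rewrite pair_lin2; exact: (@hdomP _ _ HG).
move=> r Vr; have hr := Vdom_H3 Vr; rewrite pair_lin1 pair_lin2.
rewrite (energyP sigmaA sigmaT gamma hphase a (Vdom_H3 Vx) (Vdom_H3 Vy) hr) Ex// Ey//.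
by rewrite (@ipP _ _ HG a _ _ _ Gx Gy hr.2).
Qed.

Lemma solution_graph_dom x : solution_graph x -> prodHilbert VH HG x.
Proof. by case. Qed.

Lemma solution_graph_closed u x : (forall k, solution_graph (u k)) ->
  prodHilbert VH HG x -> hcvg (prodHilbert VH HG) u x -> solution_graph x.
Proof.
move=> Su [Vx Gx] ux; split => // r Vr; have hr := Vdom_H3 Vr.
have Hu k := solution_graph_dom (Su k).
have [c1 c2] := (hcvg_pair Hu (conj Vx Gx : prodHilbert VH HG x)).1 ux.
have hu k := Vdom_H3 (Hu k).1; have hx := Vdom_H3 Vx.
have e1 : energy (u k).1 r @[k --> \oo] --> energy x.1 r.
  exact: (energy_cvg hphase hu hx hr c1).
have e2 := hcvg_ip (fun k => (Hu k).2) Gx (fun=> hr.2) hr.2 c2 (hcvg_cst hr.2).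
have E : (fun k => energy (u k).1 r) = (fun k => ip HG (u k).2 r.2).
  by apply/funext => k; have [_ _] := Su k; exact.
by rewrite E in e1; exact: (cvg_unique _ e1 e2).
Qed.

Definition XH := subHilbert solution_graph0 solution_graph_linear solution_graph_dom
  solution_graph_closed.

Variables (g : point -> R) (ustar : V).
Hypotheses (hg : HG g) (hgamma : 0 < gamma).
Hypothesis hbvp : solves_bvp g ustar.
Hypothesis hargmin : forall lam, HG lam ->
  exists v : V, is_argmin (fun w => L gamma g w lam) v.

Lemma argmin_solution (v : V) lam : HG lam -> is_argmin (fun w => L gamma g w lam) v ->
  solution_graph (Vdata v - Vdata ustar, lam).
Proof.
move=> hlam amin.
have hv := Vdata_dom oD hn hphase v; have hs := Vdata_dom oD hn hphase ustar.
have Hv := Vdom_H3 hv; have Hs := Vdom_H3 hs.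
have E : Vdata v - Vdata ustar = (-1) *: Vdata ustar + Vdata v.
  by rewrite scaleN1r addrC.
split => //=; first by rewrite E; exact: Vdom_linear.
move=> r Vr; have hr := Vdom_H3 Vr.
change (energy (Vdata v - Vdata ustar) r = ip HG lam r.2).
rewrite -(first_order hphase hg hlam amin Vr).
rewrite E (energyP sigmaA sigmaT gamma hphase (-1) Hs Hv hr) mulN1r.
have [res0 tr0] := hbvp.
have R0 : ip HW (Res (Vdata ustar)) (Res r) = 0.
  have h0 := Res_dom sigmaA sigmaT hphase Hs.
  have h1 := Res_dom sigmaA sigmaT hphase hr.
  apply: (ip_null h0 h1); apply/eqP; rewrite hnorm_eq0//; apply/eqP/inner_eq0_ae => //.
    exact: measurable_W.
  apply: ae_onS res0 => z Wz; rewrite /Res (@resopE _ _ D _ _ _ _ _ _ Wz).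
  exact.
have T0 : hnorm HG (vtrace ustar - g) = 0 by apply: hnormG_ae => //; exact: Hs.2.
have sg : ip HG (vtrace ustar) r.2 = ip HG g r.2.
  exact: (@ip_congr _ _ HG _ _ _ Hs.2 hg hr.2 T0).
rewrite /energy R0 (@ipBl _ _ HG _ _ _ Hv.2 hg hr.2) -sg.
move: (ip HW _ _) => A.
have -> : ip HG (Vdata ustar).2 r.2 = ip HG (vtrace ustar) r.2 by [].
have -> : ip HG (Vdata v).2 r.2 = ip HG (vtrace v) r.2 by [].
generalize (ip HG (vtrace ustar) r.2) (ip HG (vtrace v) r.2) => B C; ring.
Qed.

Lemma solution_graph_null x : solution_graph x -> hnorm HW (Res x.1) = 0 ->
  hnorm HG x.1.2 = 0 -> hnorm H3 x.1 = 0.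
Proof.
move=> [Vx _ _]; have [v amin] := hargmin hg.
exact: (argmin_injective hphase hg hg amin Vx).
Qed.

(* [hargmin] makes the map from multipliers to solutions everywhere defined and
   injective, so no coercivity of the transport operator is needed. *)
Lemma solution_bounded : exists2 C, 0 < C & forall x, solution_graph x ->
  hnorm XH x <= C * hnorm HG x.2.
Proof.
have [C hC] : exists C, forall x, XH x -> hnorm XH x <= C * hnorm HG x.2.
  (* The operator inverted here is the projection of the complete graph [XH] onto its multiplier. *)
  apply: bounded_inverse.
  - by move=> a x y; rewrite pair_lin2.
  - by move=> x [].
  - move=> x [Vx Gx _]; rewrite /hnorm ler_wsqrtr//.
    rewrite -[X in _ <= X]/(ip VH x.1 x.1 + ip HG x.2 x.2) lerDr.
    exact: (@ip_ge0 _ _ VH).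
  - move=> lam hlam; have [v amin] := hargmin hlam.
    exists (Vdata v - Vdata ustar, lam); first exact: argmin_solution.
    by rewrite subrr hnorm0.
  (* Tested with the error itself, a null multiplier gives zero energy; both terms of the energy are
     nonnegative and therefore vanish. *)
  - move=> x Sx x20; have [Vx Gx Ex] := Sx; have Hx := Vdom_H3 Vx.
    have Rx := Res_dom sigmaA sigmaT hphase Hx.
    have e0 : energy x.1 x.1 = 0 by rewrite Ex// (@ip_null _ _ HG _ _ Gx Hx.2).
    have p1 : 0 <= ip HW (Res x.1) (Res x.1) by exact: ip_ge0.
    have p2 : 0 <= ip HG x.1.2 x.1.2 by exact: (@ip_ge0 _ _ HG _ Hx.2).
    have p3 : 0 <= gamma * ip HG x.1.2 x.1.2 by rewrite mulr_ge0// ltW.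
    have /eqP := e0; rewrite /energy paddr_eq0// mulf_eq0 (gt_eqF hgamma)/=.
    rewrite -(hnorm_eq0 Rx) -(@hnorm_eq0 _ _ HG _ Hx.2).
    move=> /andP[/eqP r0 /eqP t0].
    have h0 := solution_graph_null Sx r0 t0.
    apply/eqP; rewrite hnorm_eq0//; apply/eqP.
    rewrite -[LHS]/(ip H3 x.1 x.1 + ip HG x.2 x.2).
    by rewrite (ip_null Hx Hx h0) (@ip_null _ _ HG _ _ Gx Gx x20) addr0.
exists (`|C| + 1) => [|x /hC h]; first by rewrite ltr_wpDl.
apply: le_trans h _; rewrite ler_wpM2r ?hnorm_ge0//.
by have := ler_norm C; lra.
Qed.

End multiplier_to_solution.

(** * The Uzawa iteration *)

Section uzawa_scalars.
Context {R : realType}.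

Lemma cvg_even_odd (c : nat -> R) (l : R) :
  c (k + k)%N @[k --> \oo] --> l -> c (k + k).+1 @[k --> \oo] --> l ->
  c k @[k --> \oo] --> l.
Proof.
move=> /cvgrPdist_lt h0 /cvgrPdist_lt h1; apply/cvgrPdist_lt => e e0.
have [N0 _ H0] := h0 e e0; have [N1 _ H1] := h1 e e0.
exists (N0 + N1).*2 => // m /= Nm.
have m2 : (N0 + N1 <= m./2)%N by rewrite -[X in (X <= _)%N]doubleK half_leq.
rewrite -(odd_double_half m) -addnn; case: (odd m) => /=.
  by apply: H1 => /=; apply: leq_trans m2; exact: leq_addl.
by apply: H0 => /=; apply: leq_trans m2; exact: leq_addr.
Qed.

(** A nonincreasing sequence bounded below has decrements tending to 0, and each nonnegative part of
    a decrement is at most the whole. *)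
Lemma summable_decrease (N r t : nat -> R) (a b : R) : 0 < a -> 0 < b ->
  (forall k, 0 <= N k) -> (forall k, 0 <= r k) -> (forall k, 0 <= t k) ->
  (forall k, N k.+1 = N k - a * r k - b * t k) ->
  [/\ (exists l : R, N k @[k --> \oo] --> l), r k @[k --> \oo] --> (0 : R) &
      t k @[k --> \oo] --> (0 : R)].
Proof.
move=> a0 b0 N0 r0 t0 NS.
have dN : nonincreasing_seq N.
  apply/nonincreasing_seqP => k; rewrite NS.
  have := mulr_ge0 (ltW a0) (r0 k); have := mulr_ge0 (ltW b0) (t0 k); lra.
have cN : cvgn N by apply: nonincreasing_is_cvgn => //; exists 0 => _ [k _ <-].
have cD : (N k - N k.+1) @[k --> \oo] --> (0 : R).
  by rewrite -[X in _ --> X](subrr (limn N)); apply: cvgB => //; rewrite cvg_shiftS.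
split; first by exists (limn N).
- apply: (@squeeze_cvgr _ _ _ _ (cst 0) (fun k => a^-1 * (N k - N k.+1))); last 2 first.
  + exact: cvg_cst.
  + by rewrite -[X in _ --> X](mulr0 a^-1); apply: cvgM => //; exact: cvg_cst.
  near=> k; rewrite r0/= mulrC ler_pdivlMr// NS.
  by have := mulr_ge0 (ltW b0) (t0 k); lra.
- apply: (@squeeze_cvgr _ _ _ _ (cst 0) (fun k => b^-1 * (N k - N k.+1))); last 2 first.
  + exact: cvg_cst.
  + by rewrite -[X in _ --> X](mulr0 b^-1); apply: cvgM => //; exact: cvg_cst.
  near=> k; rewrite t0/= mulrC ler_pdivlMr// NS.
  by have := mulr_ge0 (ltW a0) (r0 k); lra.
Unshelve. all: by end_near.
Qed.

End uzawa_scalars.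

Section uzawa_iteration.
Context (R : realType) (X : lmodType R) (H : semiHilbert X).
Variables (lam T : nat -> X) (r : nat -> R) (rho gamma : R).
Hypotheses (hlam : forall k, H (lam k)) (hT : forall k, H (T k)).
Hypotheses (rho0 : 0 < rho) (rho2 : rho < 2 * gamma).
Hypothesis lamS : forall k, hnorm H (lam k.+1 - (lam k - rho *: T k)) = 0.
Hypothesis symT : forall i j, ip H (lam i) (T j) = ip H (lam j) (T i).
Hypothesis r0 : forall k, 0 <= r k.
Hypothesis diagT : forall k, ip H (lam k) (T k) = r k + gamma * ip H (T k) (T k).

Let ip_lamS k y : H y -> ip H (lam k.+1) y = ip H (lam k) y - rho * ip H (T k) y.
Proof.
move=> hy; have hz : H (rho *: T k) by exact: hdomZ.
by rewrite (ip_congr (hlam k.+1) (hdomB (hlam k) hz) hy (lamS k)) ipBl// ipZl.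
Qed.

Let ip_shift i j : ip H (lam i.+1) (lam j) = ip H (lam i) (lam j.+1).
Proof.
rewrite ip_lamS// [RHS]ipC// ip_lamS// (ipC (hlam j) (hlam i)).
by rewrite (ipC (hT i) (hlam j)) (ipC (hT j) (hlam i)) symT.
Qed.

(* The iteration operator is self-adjoint, so that inner products of iterates
   depend on the sum of the indices only. *)
Let ip_sum i j : ip H (lam i) (lam j) = ip H (lam (i + j)%N) (lam 0%N).
Proof. by elim: j i => [|j IH] i; rewrite ?addn0// -ip_shift IH addSnnS. Qed.

(** The square of [lam k - rho *: T k] is expanded and its cross term replaced by means of [diagT].
    The coefficient of the trace term is the origin of the bound [rho < 2 * gamma]. *)
Let lam_decrease k : ip H (lam k.+1) (lam k.+1) =
  ip H (lam k) (lam k) - (2 * rho) * r k - rho * (2 * gamma - rho) * ip H (T k) (T k).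
Proof.
rewrite ip_lamS// -ip_shift ip_lamS// (ipC (hT k) (hlam k.+1)) ip_lamS//.
rewrite (ipC (hT k) (hlam k)) diagT.
by generalize (ip H (T k) (T k)) (ip H (lam k) (lam k)) => x y; ring.
Qed.

Lemma uzawa_scalar_cvg :
  r k @[k --> \oo] --> (0 : R) /\ ip H (T k) (T k) @[k --> \oo] --> (0 : R).
Proof.
have a0 : 0 < 2 * rho by rewrite mulr_gt0.
have b0 : 0 < rho * (2 * gamma - rho) by rewrite mulr_gt0// subr_gt0.
by have [] := summable_decrease a0 b0 (fun k => ip_ge0 (hlam k)) r0
  (fun k => ip_ge0 (hT k)) lam_decrease.
Qed.

(** Let [c k] be the inner product of [lam k] and [lam 0]. Its even terms [c (k + k)] are the
    squared norms of the [lam k], which converge; each odd term differs from the preceding even one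
    by [rho] times the inner product of [lam k] and [T k], which tends to 0. So the whole sequence
    [c] converges. *)
Lemma uzawa_cauchy : hcauchy H lam.
Proof.
have a0 : 0 < 2 * rho by rewrite mulr_gt0.
have b0 : 0 < rho * (2 * gamma - rho) by rewrite mulr_gt0// subr_gt0.
have [[l cN] cr ct] := summable_decrease a0 b0 (fun k => ip_ge0 (hlam k)) r0
  (fun k => ip_ge0 (hT k)) lam_decrease.
pose c k := ip H (lam k) (lam 0%N).
have /cvgrPdist_lt cc : c k @[k --> \oo] --> l.
  apply: cvg_even_odd.
    by under eq_fun do rewrite /c -ip_sum.
  have E : (fun k => c (k + k).+1) = (fun k => ip H (lam k) (lam k) -
      rho * (r k + gamma * ip H (T k) (T k))).
    apply/funext => k; rewrite /c -addSn -ip_sum ip_lamS//.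
    by rewrite (ipC (hT k) (hlam k)) diagT.
  rewrite E -[X in _ --> X]subr0; apply: cvgB => //.
  rewrite [X in _ --> X](_ : 0 = rho * (0 + gamma * 0)); last by ring.
  apply: cvgM; first exact: cvg_cst.
  by apply: cvgD => //; apply: cvgM => //; exact: cvg_cst.
(* The squared distance of [lam i] and [lam j] is [c (i + i) - 2 * c (i + j) + c (j + j)], with
   weights 1, 2 and 1 in absolute value. *)
move=> e e0; have e4 : 0 < e / 4 by rewrite divr_gt0.
have [N _ NP] := cc _ e4; exists N => i j Ni Nj.
rewrite ip_sqB// (ip_sum i i) (ip_sum i j) (ip_sum j j) -!/(c _).
have := NP (i + i)%N (leq_trans Ni (leq_addr _ _)).
have := NP (i + j)%N (leq_trans Ni (leq_addr _ _)).
have := NP (j + j)%N (leq_trans Nj (leq_addr _ _)).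
rewrite /= !ltr_norml => /andP[? ?] /andP[? ?] /andP[? ?]; lra.
Qed.

End uzawa_iteration.

(** * Strong convergence of the iterates *)

Lemma pair_sub2 (X Y : zmodType) (p r : X * Y) : (p - r).2 = p.2 - r.2.
Proof. by []. Qed.

Lemma pair_sub (X Y : zmodType) (a c : X) (b d : Y) : (a, b) - (c, d) = (a - c, b - d).
Proof. by []. Qed.

Theorem theorem3p7 (R : realType) (d : nat) (hd : d = 2%N \/ d = 3%N)
  (D : set 'rV[R]_d) (hD : is_domain D)
  (dS : {measure set 'rV[R]_d -> \bar R}) (hdS : is_surface_measure D dS)
  (n : 'rV[R]_d -> 'rV[R]_d) (hn : is_outward_unit_normal D dS n)
  (phase : R -> R) (hphase : C1_segment phase)
  (hphase0 : forall y, -1 <= y <= 1 -> 0 <= phase y)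
  (hphase1 : (\int[lebesgue_measure]_(y in `[(-1)%R, 1%R]) phase y)%R = 1)
  (sigmaA sigmaT rho gamma : R)
  (hsA : 0 < sigmaA) (hsT : 0 < sigmaT) (hgamma : 0 < gamma)
  (hsigma : sigmaT < sigmaA / 4)
  (hrho0 : 0 < rho)
  (hrho : rho < 2 * gamma - sigmaA
                - Num.sqrt (sigmaA ^+ 2 - 16 * sigmaT ^+ 2))
  (g : 'rV[R]_d * 'rV[R]_d -> R) (hg : L2G D dS n (-1) g)
  (ustar : Vspace D dS n phase sigmaA sigmaT)
  (lamstar : 'rV[R]_d * 'rV[R]_d -> R)
  (hbvp : solves_bvp g ustar)
  (hsaddle : is_saddle_point gamma g ustar lamstar)
  (* arg min over V of L(., lam) is well defined, whatever the multiplier *)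
  (hargmin : forall lam, L2G D dS n (-1) lam ->
     exists v : Vspace D dS n phase sigmaA sigmaT,
       is_argmin (fun w => L gamma g w lam) v)
  (u : nat -> Vspace D dS n phase sigmaA sigmaT)
  (lam : nat -> 'rV[R]_d * 'rV[R]_d -> R)
  (huzawa : is_uzawa gamma rho g u lam) :
  exists (hp : nat -> 'rV[R]_d * 'rV[R]_d -> R)
         (hpstar : 'rV[R]_d * 'rV[R]_d -> R),
    [/\ forall k, is_trace D dS n 1 (u k) (vstream (u k)) (hp k),
        is_trace D dS n 1 ustar (vstream ustar) hpstar &
        triple_sqnorm D dS n (u k \- ustar)
          (vstream (u k) \- vstream ustar) (hp k \- hpstar)
          (vtrace (u k) \- vtrace ustar) @[k --> \oo] --> 0%E].

Proof.
have [oD _ _] := hD.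
have rho2 : rho < 2 * gamma.
  by have := sqrtr_ge0 (sigmaA ^+ 2 - 16 * sigmaT ^+ 2); lra.
pose K := HG hn (-1); pose K3 := H3 oD hn (-1); pose K4 := H4 oD hn.
pose e k := Vdata (u k) - Vdata ustar; pose x k := (e k, lam k).
have hlam k : K (lam k) by have [] := huzawa k.
have Sx k : solution_graph phase sigmaA sigmaT gamma oD hn (x k).
  have [_ amin _] := huzawa k.
  exact: (argmin_solution oD hphase hg hbvp (hlam k) amin).
have Ve k : Vdom oD hn (e k) by have [] := Sx k.
have He k : K3 (e k) := Vdom_H3 (Ve k).
have HR k := Res_dom sigmaA sigmaT hphase (He k).
pose T k := (e k).2; have hT k : K (T k) := (He k).2.
have Ee k j : energy phase sigmaA sigmaT gamma oD hn (e k) (e j) = ip K (lam k) (T j).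
  by have [_ _ E] := Sx k; exact: (E _ (Ve j)).
pose r k := ip (HW oD) (Res phase sigmaA sigmaT (e k)) (Res phase sigmaA sigmaT (e k)).
have r0 k : 0 <= r k by exact: ip_ge0 (HR k).
have symT i j : ip K (lam i) (T j) = ip K (lam j) (T i).
  by rewrite -!Ee (energyC sigmaA sigmaT gamma hphase (He i) (He j)).
have lamS k : hnorm K (lam k.+1 - (lam k - rho *: T k)) = 0.
  have [_ _ lamk] := huzawa k; have [_ gstar] := hbvp.
  apply: hnormG_ae => //.
    by apply: (@hdomB _ _ K) => //; exact: (@hdomZ _ _ K).
  (* On the inflow boundary [g] is the trace of [ustar], so the update subtracts [rho] times the
     trace [T k] of the error. *)
  apply: ae_onS2 lamk gstar => z _ -> gz.
  by rewrite -gz.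
have diagT k : ip K (lam k) (T k) = r k + gamma * ip K (T k) (T k) by rewrite -Ee.
have [cr ct] := uzawa_scalar_cvg hlam hT hrho0 rho2 lamS symT r0 diagT.
have clam := uzawa_cauchy hlam hT hrho0 rho2 lamS symT r0 diagT.
have [C C0 hC] := solution_bounded oD hphase hg hgamma hbvp hargmin.
pose X := XH sigmaA sigmaT gamma oD hn hphase.
(* The graph is a subspace, so the bound applies to differences and carries the Cauchy property from
   the multipliers to the errors. *)
have cx : hcauchy X x.
  apply/(@hcauchyP _ _ X x Sx) => eps eps0.
  have [|N NP] := (hcauchyP hlam).1 clam (eps / C); first by rewrite divr_gt0.
  exists N => i j Ni Nj; apply: le_lt_trans (hC _ (@hdomB _ _ X _ _ (Sx i) (Sx j))) _.
  by rewrite pair_sub2 mulrC -ltr_pdivlMr//; exact: NP.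
have [y Sy cy] := @ip_complete _ _ X x Sx cx.
have Hx k := solution_graph_dom (Sx k); have Hy := solution_graph_dom Sy.
have [cey _] := (hcvg_pair Hx Hy).1 cy.
have Hy3 : K3 y.1 := Vdom_H3 Hy.1.
have [cuq cty] := (hcvg_pair He Hy3).1 cey.
have [cu cq] := (hcvg_pair (fun k => (He k).1) Hy3.1).1 cuq.
have cRes := resop_cvg sigmaA sigmaT hphase (fun k => (He k).1.1) (fun k => (He k).1.2)
  Hy3.1.1 Hy3.1.2 cu cq.
have y0 : hnorm K3 y.1 = 0.
  apply: (solution_graph_null hphase hg hargmin Sy).
    exact: (hcvg_null_lim HR (Res_dom sigmaA sigmaT hphase Hy3) cRes cr).
  exact: (hcvg_null_lim hT Hy3.2 cty ct).
have ce : ip K3 (e k) (e k) @[k --> \oo] --> (0 : R) := hcvg_null He Hy3 cey y0.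
(* Outflow traces are chosen jointly with the inflow ones, in a closure that is linear:
   [hp (u k) - hp ustar] is then an outflow trace of the error in the same sense, and [outflow_le]
   bounds it by the graph norm of the error. *)
have hout (v : Vspace D dS n phase sigmaA sigmaT) :
    exists h, hcl K4 C1c_graph4 (Vdata v, h).
  by apply: outflow_exists; have [] := Vdata_dom oD hn hphase v.
have [hp hpP] := choice hout.
have htrace (v : Vspace D dS n phase sigmaA sigmaT) :
    is_trace D dS n 1 v (vstream v) (hp v).
  have [lu lq] := Vspace_L2 oD hphase v.
  apply/(is_traceP hn 1 _ lu lq); exact: (outflow_graph (hpP v)).
exists (fun k => hp (u k)), (hp ustar); split => //.
pose o k := hp (u k) - hp ustar.
have cout k : hcl K4 C1c_graph4 (e k, o k).
  rewrite /e /o -pair_sub addrC -scaleN1r.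
  by apply: hcl_linear => //; [exact: C1c_graph4_dom|exact: C1c_graph4_linear].
have Ho k : HG hn 1 (o k) by have [[_ ho] _] := cout k.
have E k : triple_sqnorm D dS n (u k \- ustar) (vstream (u k) \- vstream ustar)
    (hp (u k) \- hp ustar) (vtrace (u k) \- vtrace ustar) =
    (ip K3 (e k) (e k) + ip (HG hn 1) (o k) (o k))%:E.
  have [[le lq] lt] := He k.
  have e1 := sqnormE (measurable_W oD) le.
  have e2 := sqnormE (measurable_W oD) lq.
  have e3 := sqnormE (measurable_Gamma hn 1) (Ho k).
  have e4 := sqnormE (measurable_Gamma hn (-1)) lt.
  rewrite /triple_sqnorm /sqnormG [X in (X + _ + _ + _)%E]e1 [X in (_ + X + _ + _)%E]e2.
  rewrite [X in (_ + _ + X + _)%E]e3 [X in (_ + _ + _ + X)%E]e4 -!EFinD.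
  by congr (_%:E); rewrite [LHS]addrAC; reflexivity.
rewrite (_ : (fun k => _) = (fun k => (ip K3 (e k) (e k) + ip (HG hn 1) (o k) (o k))%:E)).
  apply: cvg_EFin; first exact: nearW.
  rewrite -[X in _ --> X]addr0; apply: cvgD => //.
  apply: (@squeeze_cvgr _ _ _ _ (cst 0) (fun k => ip K3 (e k) (e k))) => //.
    near=> k; rewrite (ip_ge0 (Ho k))/=; exact: (outflow_le (cout k)).
  exact: cvg_cst.
by apply/funext.
Unshelve. all: by end_near.
Qed.
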